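(* Consider the planar Newtonian three-body problem with masses $m_1=m_2=1$ and $m_3>0$. There is an open set of values of $m_3$, containing $m_3=1$, such that for each $m_3$ in this set there exists a periodic isosceles brake orbit which hits the syzygy plane $C$ orthogonally upon its second hit (counted from the brake instant).
   Context: Planar Newtonian three-body problem: positions $q_1,q_2,q_3\in\mathbb{C}$, center of mass at $0$, $r_{ij}=|q_i-q_j|$, $U=\sum_{i<j}m_im_j/r_{ij}$, equations $m_i\ddot q_i=\nabla_{q_i}U$. A brake orbit is a solution along which all three velocities vanish at some instant (the brake instant); it has negative energy and zero angular momentum. When $m_1=m_2=1$, the set of isosceles configurations with $r_{13}=r_{23}$ moving symmetrically about a fixed axis containing $m_3$ is an invariant subsystem; an isosceles orbit is an orbit of this subsystem. Binary collisions $r_{12}=0$ are regularized (Levi-Civita), so solutions are continued through them, and periodicity is meant for the regularized flow. $C$ denotes the set of collinear configurations in the space of configurations modulo translations and rotations; a hit of $C$ is a time at which the configuration is collinear, binary collisions included. The reduced configuration space carries, away from triple collision, the Riemannian metric $2K_0$ given by the kinetic energy at zero angular momentum: $2K_0=\dot r^2+r^2\frac{\mu_1\mu_2}{\|\xi\|^4}|\xi_1\dot\xi_2-\xi_2\dot\xi_1|^2$, where $r=\|\xi\|$, $\|\xi\|^2=\mu_1|\xi_1|^2+\mu_2|\xi_2|^2$, $\xi_1=q_2-q_1$, $\xi_2=q_3-\frac{m_1q_1+m_2q_2}{m_1+m_2}$, $\mu_1=\frac{m_1m_2}{m_1+m_2}$, $\mu_2=\frac{(m_1+m_2)m_3}{m_1+m_2+m_3}$.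 Hitting $C$ orthogonally means that, at the (non-collision) collinear configuration, the velocity of the reduced curve is orthogonal to $C$ in this metric. *)

(* Defs.v *)
From Stdlib Require Import Reals.
From Coquelicot Require Import Coquelicot.
Open Scope R_scope.

Inductive body : Set := B1 | B2 | B3.

Definition body_eq_dec (i j : body) : {i = j} + {i <> j}.
Proof. decide equality. Defined.

Definition config : Type := body -> C.

Definition upd (q : config) (i : body) (a : C) : config :=
  fun j => if body_eq_dec i j then a else q j.

Definition dist (q : config) (i j : body) : R := Cmod (q j - q i)%C.

(* C is differentiated as a real vector space. *)
Definition is_deriveC (f : R -> C) (t : R) (l : C) : Prop :=
  @is_derive R_AbsRing C_R_NormedModule f t l.

Definition velocity (q : R -> config) (t : R) (v : config) : Prop :=
  forall i, is_deriveC (fun s => q s i) t (v i).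

(* Gradient for the real inner product Re (conj a * b) on C. *)
Definition grad (f : C -> R) (a : C) : C :=
  (Derive (fun x => f (x, Im a)) (Re a), Derive (fun y => f (Re a, y)) (Im a)).

Definition potential (m : body -> R) (q : config) : R :=
  m B1 * m B2 / dist q B1 B2 + m B1 * m B3 / dist q B1 B3
  + m B2 * m B3 / dist q B2 B3.

Definition newton_at (m : body -> R) (q : R -> config) (t : R) : Prop :=
  exists v : R -> config, locally t (fun s => velocity q s (v s)) /\
  exists a : config, velocity v t a /\
  forall i, (m i * a i)%C = grad (fun z => potential m (upd (q t) i z)) (q t i).

Definition centered (m : body -> R) (q : config) : Prop :=
  (m B1 * q B1 + m B2 * q B2 + m B3 * q B3)%C = 0%C.

(* The Jacobi maps are linear, so they are applied to velocities as well. *)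
Definition xi1 (q : config) : C := (q B2 - q B1)%C.
Definition xi2 (m : body -> R) (q : config) : C :=
  (q B3 - (m B1 * q B1 + m B2 * q B2) / RtoC (m B1 + m B2))%C.

Definition mu1 (m : body -> R) : R := m B1 * m B2 / (m B1 + m B2).
Definition mu2 (m : body -> R) : R :=
  (m B1 + m B2) * m B3 / (m B1 + m B2 + m B3).

(* Levi-Civita regularization of the collision of bodies 1 and 2, at energy h:
   xi1 = z^2 and dt = |z|^2 ds. With p1, p the momenta conjugate to xi1, xi2,
   the momentum conjugate to z is w = 2 conj(z) p1, and the Hamiltonian is
   |z|^2 (|p1|^2/(2 mu1) + |p|^2/(2 mu2) - U - h), which in these variables is
   free of singularities at z = 0. *)
Definition lc_hamiltonian (m : body -> R) (h : R) (z w x p : C) : R :=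
  Cmod w ^ 2 / (8 * mu1 m) - m B1 * m B2
  + Cmod z ^ 2 *
    (Cmod p ^ 2 / (2 * mu2 m)
     - m B1 * m B3 / Cmod (x + RtoC (m B2 / (m B1 + m B2)) * (z * z))%C
     - m B2 * m B3 / Cmod (x - RtoC (m B1 / (m B1 + m B2)) * (z * z))%C
     - h).

(* The curve (z, w, x, p), parametrized by the fictitious time s, is an orbit
   of the regularized flow on the level set {Hamiltonian = 0}; tau is the
   physical time. *)
Record lc_orbit (m : body -> R) (h : R) (tau : R -> R) (z w x p : R -> C) : Prop := {
  lc_level : forall s, lc_hamiltonian m h (z s) (w s) (x s) (p s) = 0;
  lc_time : forall s, is_derive tau s (Cmod (z s) ^ 2);
  lc_z : forall s,
    is_deriveC z s (grad (fun b => lc_hamiltonian m h (z s) b (x s) (p s)) (w s));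
  lc_w : forall s,
    is_deriveC w s (- grad (fun a => lc_hamiltonian m h a (w s) (x s) (p s)) (z s))%C;
  lc_x : forall s,
    is_deriveC x s (grad (fun b => lc_hamiltonian m h (z s) (w s) (x s) b) (p s));
  lc_p : forall s,
    is_deriveC p s (- grad (fun a => lc_hamiltonian m h (z s) (w s) a (p s)) (x s))%C
}.

(* A motion defined for all physical times, free of triple collisions and of
   collisions with body 3, and continued through the collisions of bodies 1
   and 2 by the regularized flow. *)
Record regularized_solution (m : body -> R) (q : R -> config) : Prop := {
  sol_centered : forall t, centered m (q t);
  sol_dist13 : forall t, dist (q t) B1 B3 <> 0;
  sol_dist23 : forall t, dist (q t) B2 B3 <> 0;
  sol_newton : forall t, dist (q t) B1 B2 <> 0 -> newton_at m q t;
  sol_regularized : exists (h : R) (tau : R -> R) (z w x p : R -> C),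
    lc_orbit m h tau z w x p /\
    (forall t, exists s, tau s = t) /\
    forall s, xi1 (q (tau s)) = (z s * z s)%C /\ xi2 m (q (tau s)) = x s
}.

(* The axis is the real line spanned by the unit complex number u (it contains
   the center of mass 0), and a |-> u^2 conj(a) is the reflection across it. *)
Definition isosceles (q : R -> config) : Prop :=
  exists u : C, Cmod u = 1 /\ forall t,
    Im (q t B3 * Cconj u)%C = 0 /\ q t B2 = (u * u * Cconj (q t B1))%C.

Definition brake_instant (q : R -> config) (t0 : R) : Prop :=
  velocity q t0 (fun _ => 0%C).

Definition periodic (q : R -> config) : Prop :=
  exists T, 0 < T /\ forall t i, q (t + T) i = q t i.

Definition collinear (q : config) : Prop :=
  Im ((q B2 - q B1) * Cconj (q B3 - q B1))%C = 0.

Definition size (m : body -> R) (q : config) : R :=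
  sqrt (mu1 m * Cmod (xi1 q) ^ 2 + mu2 m * Cmod (xi2 m q) ^ 2).

(* Derivative of [size m] at q in the direction v. *)
Definition size_dot (m : body -> R) (q v : config) : R :=
  (mu1 m * Re (Cconj (xi1 q) * xi1 v)%C
   + mu2 m * Re (Cconj (xi2 m q) * xi2 m v)%C) / size m q.

(* The metric of the reduced space is represented by its pull-back to the
   space of configurations: a semi-definite form whose kernel is spanned by the
   infinitesimal translations and rotations. *)
Definition twoK0 (m : body -> R) (q v : config) : R :=
  size_dot m q v ^ 2
  + size m q ^ 2 * (mu1 m * mu2 m / size m q ^ 4)
    * Cmod (xi1 q * xi2 m v - xi2 m q * xi1 v)%C ^ 2.

Definition reduced_metric (m : body -> R) (q v w : config) : R :=
  (twoK0 m q (fun i => v i + w i)%C - twoK0 m q (fun i => v i - w i)%C) / 4.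

Definition tangent_to_C (q w : config) : Prop :=
  exists c : R -> config,
    (forall i, c 0 i = q i) /\ (forall s, collinear (c s)) /\ velocity c 0 w.

Definition orthogonal_to_C (m : body -> R) (q v : config) : Prop :=
  forall w, tangent_to_C q w -> reduced_metric m q v w = 0.

(* t1 < t2 are the first two hits of the collinear configurations after t0. *)
Definition first_two_hits (q : R -> config) (t0 t1 t2 : R) : Prop :=
  t0 < t1 < t2 /\
  forall t, t0 < t <= t2 -> (collinear (q t) <-> t = t1 \/ t = t2).

Definition hits_C_orthogonally (m : body -> R) (q : R -> config) (t : R) : Prop :=
  collinear (q t) /\
  (forall i j, i <> j -> dist (q t) i j <> 0) /\
  exists v, velocity q t v /\ orthogonal_to_C m (q t) v.

Definition isosceles_masses (m3 : R) (i : body) : R :=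
  match i with B1 => 1 | B2 => 1 | B3 => m3 end.

(* Main.v *)
Require Import Defs.
From Stdlib Require Import Reals Ranalysis5 Lra Lia ZArith List Classical.
From Coquelicot Require Import Coquelicot.
Import Defs.
Open Scope R_scope.

(* An isosceles motion is described by the distance X = z^2 of the twin bodies
   and the height Y of body 3 over them; in the time s with dt = z^2 ds it extends
   smoothly through binary collisions. Shoot from rest at X = 1, Y = th. For
   th = 65/64 the height Y reaches 0 while the velocity w = 2 dz/ds is still
   negative, and for th = 3/2 the velocity w vanishes first. Both facts are open
   in th and hold for all m3 close to 1, as is seen by integrating the two
   trajectories rigorously in integer interval arithmetic.
   A priori estimates exclude triple collision on the way: up to the binary
   collision Y - 4/5 X is convex in physical time, hence stays above
   its initial value, and just after the collision z moves away from 0 faster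
   than Y descends. The interval of th being connected, for some th in between
   Y and w vanish simultaneously. There the binary collision is the first hit of
   C, and the second one is orthogonal, as dX/dt = 0 and dY/dt <> 0. The solution
   is symmetric about the brake instant and, up to Y -> -Y, about that hit, so it
   is periodic with four times the shooting time as its period. *)

(** * Enclosures for solutions of differential equations *)

(** It is replaced by a bounded Lipschitz [cut_field], whose flow is global, depends on [th] in a
    Lipschitz way, and keeps both symmetries because clamping is odd. The price is a circle: the
    estimates hold for the true field, yet they are what shows that the cut is never felt.
    Continuous induction breaks it, since the estimates stay strictly inside the uncut region. The
    connectedness argument also needs one of the two events to occur. A solution with [w < 0 < Y]
    cannot last until [horizon]: [Y] falls at a definite rate away from [z = 0], and the zone around
    [z = 0] is crossed within one unit of time. The lower end 65/64 exceeds 1 because the bootstrap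
    [Y >= X] needs a margin at the start, where [X = 1]. Numerics enter only at the two end values
    of [th]; in between, estimates valid for [m] in [9/10, 11/10] suffice. *)

Record vec (A : Type) : Type := Vec { vz : A; vw : A; vY : A; vV : A; vE : A }.
Arguments Vec {A}. Arguments vz {A}. Arguments vw {A}. Arguments vY {A}.
Arguments vV {A}. Arguments vE {A}.

Inductive coord : Set := Cz | Cw | CY | CV | CE.

Definition get {A} (c : coord) (x : vec A) : A :=
  match c with Cz => vz x | Cw => vw x | CY => vY x | CV => vV x | CE => vE x end.

Definition rho2 (x : vec R) : R := vY x ^ 2 + vz x ^ 4 / 4.

Definition irho3 (r2 : R) : R := / (r2 * sqrt r2).

(* Bodies 1 and 2 are at distance X = z^2 from each other and at height Y below
   body 3; time is regularized by dt = z^2 ds, w / z = dX/dt and V = dY/dt.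
   E = (w^2 / 4 - 1) / z^2 is carried along as an independent coordinate, which
   makes the field smooth at z = 0. *)
Definition field (m : R) (x : vec R) : vec R :=
  let g := irho3 (rho2 x) in
  Vec (vw x / 2)
      (2 * vz x * vE x - m * vz x ^ 5 * g)
      (vz x ^ 2 * vV x)
      (- ((2 + m) * vz x ^ 2 * vY x * g))
      (- (m / 2 * vz x ^ 3 * vw x * g)).

Definition follows (Phi : vec R -> vec R) (u : R -> vec R) : Prop :=
  forall t c, is_derive (fun s => get c (u s)) t (get c (Phi (u t))).

(** Least upper bound argument: the supremum of the times up to which [P] holds satisfies [P] and
    can be passed unless it is the end. All bootstrap arguments below are run in this form. *)
Lemma real_induction (P : R -> Prop) (a b : R) :
  (forall t, a <= t <= b -> (forall s, a <= s < t -> P s) ->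
     P t /\ exists e, 0 < e /\ forall s, t < s < t + e -> s <= b -> P s) ->
  forall t, a <= t <= b -> P t.
Proof.
intros H t Ht.
destruct (classic (P t)) as [|Hn]; [assumption|exfalso].
set (Q := fun r => a <= r <= t /\ forall s, a <= s < r -> P s).
destruct (completeness Q) as [l [Hub Hl]].
{ exists t. intros r [? _]. lra. }
{ exists a. split; [lra|]. intros; lra. }
assert (Hal : a <= l) by (apply Hub; split; [lra|intros; lra]).
assert (Hlt : l <= t) by (apply Hl; intros r [? _]; lra).
assert (Hbelow : forall s, a <= s < l -> P s).
{ intros s Hs. destruct (classic (P s)) as [|Hns]; [assumption|exfalso].
  assert (l <= s); [|lra]. apply Hl. intros r [Hr Hr'].
  destruct (Rle_lt_dec r s); [assumption|]. exfalso. apply Hns, Hr'. lra. }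
destruct (H l) as [Pl [e [He Hext]]]; [lra|assumption|].
destruct (Req_dec l t) as [->|Hne]; [contradiction|].
set (r := Rmin (l + e / 2) t).
assert (Hr : l < r <= t /\ r < l + e).
{ unfold r, Rmin. destruct (Rle_dec (l + e/2) t); lra. }
assert (r <= l); [|lra]. apply Hub. split; [lra|].
intros s Hs. destruct (Rlt_le_dec s l); [apply Hbelow; lra|].
destruct (Req_dec s l) as [->|]; [assumption|]. apply Hext; lra.
Qed.

Lemma derive_bounds (f df : R -> R) (a b l r : R) :
  a <= b -> (forall t, a <= t <= b -> is_derive f t (df t)) ->
  (forall t, a < t < b -> l <= df t <= r) ->
  l * (b - a) <= f b - f a <= r * (b - a).
Proof.
intros Hab Hd Hdf.
destruct (Req_dec a b) as [<-|Hne]; [lra|].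
destruct (MVT_cor2 f df a b) as [c [Hc1 Hc2]]; [lra| |].
{ intros c Hc. apply is_derive_Reals, Hd, Hc. }
rewrite Hc1. specialize (Hdf c Hc2). nra.
Qed.

(** Taylor's formula of order two with a bracketed remainder: the mean value theorem is applied to
    the difference of [f] and each of two comparison parabolas. *)
Lemma derive2_bounds (f df ddf : R -> R) (a b l r : R) :
  a <= b -> (forall t, a <= t <= b -> is_derive f t (df t)) ->
  (forall t, a <= t <= b -> is_derive df t (ddf t)) ->
  (forall t, a <= t <= b -> l <= ddf t <= r) ->
  l * (b - a) ^ 2 / 2 <= f b - f a - df a * (b - a) <= r * (b - a) ^ 2 / 2.
Proof.
intros Hab Hf Hdf Hb.
assert (Hd1 : forall t, a <= t <= b -> l * (t - a) <= df t - df a <= r * (t - a)).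
{ intros t Ht. apply (derive_bounds df ddf); [lra| |].
  - intros; apply Hdf; lra.
  - intros; apply Hb; lra. }
assert (H1 : 0 * (b - a) <= (f b - df a * (b - a) - l * (b - a) ^ 2 / 2)
   - (f a - df a * (a - a) - l * (a - a) ^ 2 / 2)).
{ destruct (Req_dec a b) as [<-|Hne]; [lra|].
  destruct (MVT_cor2 (fun t => f t - df a * (t - a) - l * (t - a) ^ 2 / 2)
     (fun t => df t - df a - l * (t - a)) a b) as [c [Hc1 Hc2]]; [lra| |].
  { intros c Hc. apply is_derive_Reals. specialize (Hf c Hc).
    auto_derive; [exists (df c); assumption|].
    replace (Derive _ c) with (df c) by (symmetry; apply is_derive_unique; exact Hf). field. }
  rewrite Hc1. specialize (Hd1 c). nra. }
assert (H2 : 0 * (b - a) <= (df a * (b - a) + r * (b - a) ^ 2 / 2 - f b)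
   - (df a * (a - a) + r * (a - a) ^ 2 / 2 - f a)).
{ destruct (Req_dec a b) as [<-|Hne]; [lra|].
  destruct (MVT_cor2 (fun t => df a * (t - a) + r * (t - a) ^ 2 / 2 - f t)
     (fun t => df a + r * (t - a) - df t) a b) as [c [Hc1 Hc2]]; [lra| |].
  { intros c Hc. apply is_derive_Reals. specialize (Hf c Hc).
    auto_derive; [exists (df c); assumption|].
    replace (Derive _ c) with (df c) by (symmetry; apply is_derive_unique; exact Hf). field. }
  rewrite Hc1. specialize (Hd1 c). nra. }
replace (a - a) with 0 in * by ring. lra.
Qed.

Lemma is_derive_near (f : R -> R) (t l e : R) :
  is_derive f t l -> 0 < e ->
  exists d, 0 < d /\ forall s, Rabs (s - t) < d -> Rabs (f s - f t) < e.
Proof.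
intros Hf He.
assert (Hc : continuity_pt f t).
{ apply continuity_pt_filterlim. apply (ex_derive_continuous f t). exists l; exact Hf. }
destruct (Hc e He) as [d [Hd H]]. exists d. split; [exact Hd|].
intros s Hs. destruct (Req_dec s t) as [->|Hne].
- replace (f t - f t) with 0 by ring. rewrite Rabs_R0; exact He.
- apply (H s). split; [split; [exact I|auto]|exact Hs].
Qed.

Lemma Rmin_Rmax_segment (d h l : R) :
  0 <= d <= h -> Rmin 0 (h * l) <= l * d <= Rmax 0 (h * l).
Proof.
intros Hd. unfold Rmin, Rmax. destruct (Rle_lt_dec 0 l); destruct Rle_dec; split; nra.
Qed.

(** The a priori enclosure of interval integration. If the box contains, with room to spare, the
    segments of length [h] with all slopes that the field takes on the box, the solution cannot
    leave it within time [h]; the strict inclusion is what lets the induction proceed. *)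
Lemma rough_enclosure (Phi : vec R -> vec R) (u : R -> vec R) (s h : R)
  (flo fhi clo chi : coord -> R) :
  follows Phi u -> 0 <= h ->
  (forall x, (forall c, clo c <= get c x <= chi c) ->
     forall c, flo c <= get c (Phi x) <= fhi c) ->
  (forall c, clo c < get c (u s) + Rmin 0 (h * flo c)) ->
  (forall c, get c (u s) + Rmax 0 (h * fhi c) < chi c) ->
  forall t, s <= t <= s + h -> forall c, clo c <= get c (u t) <= chi c.
Proof.
intros Hu Hh Hf Hlo Hhi.
apply (real_induction (fun t => forall c, clo c <= get c (u t) <= chi c) s (s + h)).
intros t Ht Hprev.
assert (Hin : forall c, clo c < get c (u t) < chi c).
{ intros c.
  destruct (derive_bounds (fun r => get c (u r)) (fun r => get c (Phi (u r))) s t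
    (flo c) (fhi c)) as [H1 H2].
  - lra.
  - intros r _. apply Hu.
  - intros r Hr. apply Hf. apply Hprev. lra.
  - specialize (Hlo c). specialize (Hhi c).
    destruct (Rmin_Rmax_segment (t - s) h (flo c)) as [H3 _]; [lra|].
    destruct (Rmin_Rmax_segment (t - s) h (fhi c)) as [_ H4]; [lra|]. lra. }
split.
{ intros c; specialize (Hin c); lra. }
assert (Hnear : forall c, exists e, 0 < e /\ forall r, t < r < t + e ->
   clo c <= get c (u r) <= chi c).
{ intros c. specialize (Hin c).
  destruct (is_derive_near _ t _ (Rmin (get c (u t) - clo c) (chi c - get c (u t))) (Hu t c))
    as [d [Hd H]].
  { apply Rmin_glb_lt; lra. }
  exists d. split; [exact Hd|]. intros r Hr.
  assert (Hr' : Rabs (r - t) < d) by (apply Rabs_def1; lra).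
  specialize (H r Hr'). apply Rabs_def2 in H. revert H.
  unfold Rmin. destruct Rle_dec; lra. }
destruct (Hnear Cz) as [e1 [He1 H1]]. destruct (Hnear Cw) as [e2 [He2 H2]].
destruct (Hnear CY) as [e3 [He3 H3]]. destruct (Hnear CV) as [e4 [He4 H4]].
destruct (Hnear CE) as [e5 [He5 H5]].
exists (Rmin e1 (Rmin e2 (Rmin e3 (Rmin e4 e5)))).
split; [repeat apply Rmin_glb_lt; assumption|].
intros r Hr _.
assert (r < t + e1 /\ r < t + e2 /\ r < t + e3 /\ r < t + e4 /\ r < t + e5).
{ pose proof (Rmin_l e1 (Rmin e2 (Rmin e3 (Rmin e4 e5)))).
  pose proof (Rmin_r e1 (Rmin e2 (Rmin e3 (Rmin e4 e5)))).
  pose proof (Rmin_l e2 (Rmin e3 (Rmin e4 e5))). pose proof (Rmin_r e2 (Rmin e3 (Rmin e4 e5))).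
  pose proof (Rmin_l e3 (Rmin e4 e5)). pose proof (Rmin_r e3 (Rmin e4 e5)).
  pose proof (Rmin_l e4 e5). pose proof (Rmin_r e4 e5). lra. }
destruct c; [apply H1|apply H2|apply H3|apply H4|apply H5]; lra.
Qed.

(** The derivative of [field] along its own solutions, that is, the second derivative of a solution.
    Products are grouped as in the interval version [ifield12], so that both can be matched term by
    term. *)
Definition field2 (m : R) (x : vec R) : vec R :=
  let g := irho3 (rho2 x) in
  let d := field m x in
  let dg := - (3 * (g * / rho2 x * (vY x * vY d + vz x ^ 3 * vz d / 2))) in
  Vec (vw d / 2)
      (2 * (vz d * vE x + vz x * vE d) - m * vz x ^ 4 * (5 * (vz d * g) + vz x * dg))
      (2 * (vz x * vz d * vV x) + vz x ^ 2 * vV d)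
      (- ((2 + m) * vz x * (2 * (vz d * (vY x * g)) + (vz x * (vY d * g) + vY x * (vz x * dg)))))
      (- (m / 2 * vz x ^ 2 * (3 * (vz d * (vw x * g)) + (vz x * (vw d * g) + vw x * (vz x * dg))))).

Lemma is_derive_irho3 (f : R -> R) (t df : R) :
  0 < f t -> is_derive f t df ->
  is_derive (fun s => irho3 (f s)) t (- (3 / 2 * (irho3 (f t) * / f t * df))).
Proof.
intros Hp Hf. unfold irho3.
assert (Hs : 0 < sqrt (f t)) by (apply sqrt_lt_R0; exact Hp).
auto_derive.
- repeat split; try (exists df; exact Hf); try exact Hp. apply Rgt_not_eq; nra.
- replace (Derive _ t) with df by (symmetry; apply is_derive_unique; exact Hf).
  assert (Hq : f t = sqrt (f t) * sqrt (f t)) by (symmetry; apply sqrt_sqrt; lra).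
  set (r := sqrt (f t)) in *. rewrite Hq. field. lra.
Qed.

Ltac rewrite_derivatives :=
  repeat match goal with
  | H : is_derive ?g ?t ?l |- context [Derive ?f ?t] =>
      rewrite (is_derive_unique f t l H)
  end.

Ltac derivative :=
  auto_derive; [repeat split; try (eexists; eassumption) | rewrite_derivatives].

(** Stated for five separate real functions, so that automatic differentiation meets opaque scalars;
    [field_derive] is the same fact for a curve of states. *)
Lemma field_derive_components (m : R) (z w Y V E : R -> R) (t : R) :
  let u := fun s => Vec (z s) (w s) (Y s) (V s) (E s) in
  let d := field m (u t) in
  0 < rho2 (u t) ->
  is_derive z t (vz d) -> is_derive w t (vw d) -> is_derive Y t (vY d) ->
  is_derive V t (vV d) -> is_derive E t (vE d) ->
  forall c, is_derive (fun s => get c (field m (u s))) t (get c (field2 m (u t))).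
Proof.
intros u d Hp Dz Dw DY DV DE.
unfold field2; fold d. clearbody d. cbv zeta.
assert (Dr : is_derive (fun s => rho2 (u s)) t
   (2 * (Y t * vY d + z t ^ 3 * vz d / 2))).
{ unfold rho2; cbn [u vz vY]. derivative. field. }
set (g := fun s => irho3 (rho2 (u s))).
set (r2 := rho2 (u t)) in *.
assert (Dg : is_derive g t
  (- (3 / 2 * (g t * / r2 * (2 * (Y t * vY d + z t ^ 3 * vz d / 2)))))).
{ exact (is_derive_irho3 _ _ _ Hp Dr). }
change (irho3 r2) with (g t).
assert (Hcomp : forall s, field m (u s) = Vec (w s / 2)
  (2 * z s * E s - m * z s ^ 5 * g s) (z s ^ 2 * V s)
  (- ((2 + m) * z s ^ 2 * Y s * g s)) (- (m / 2 * z s ^ 3 * w s * g s))) by reflexivity.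
clear Dr. clearbody g r2. cbn [u vz vw vY vV vE].
intros c.
apply (is_derive_ext (fun s => get c (Vec (w s / 2)
  (2 * z s * E s - m * z s ^ 5 * g s) (z s ^ 2 * V s)
  (- ((2 + m) * z s ^ 2 * Y s * g s)) (- (m / 2 * z s ^ 3 * w s * g s))))).
{ intros s. rewrite Hcomp. reflexivity. }
clear Hcomp.
destruct c; cbn [get vz vw vY vV vE]; derivative; field; lra.
Qed.

Lemma field_derive (m : R) (u : R -> vec R) (t : R) :
  0 < rho2 (u t) ->
  (forall c, is_derive (fun s => get c (u s)) t (get c (field m (u t)))) ->
  forall c, is_derive (fun s => get c (field m (u s))) t (get c (field2 m (u t))).
Proof.
intros Hp Hd.
exact (field_derive_components m (fun s => vz (u s)) (fun s => vw (u s))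
  (fun s => vY (u s)) (fun s => vV (u s)) (fun s => vE (u s)) t Hp
  (Hd Cz) (Hd Cw) (Hd CY) (Hd CV) (Hd CE)).
Qed.

(** [Phi] is only known to coincide with [field] along the step, which is enough for [field2] to be
    the second derivative of [u] there. *)
Lemma taylor_step (m : R) (Phi : vec R -> vec R) (u : R -> vec R) (s h : R)
  (glo ghi : coord -> R) :
  follows Phi u -> 0 <= h ->
  (forall t, s <= t <= s + h -> 0 < rho2 (u t) /\ Phi (u t) = field m (u t)) ->
  (forall t, s <= t <= s + h -> forall c, glo c <= get c (field2 m (u t)) <= ghi c) ->
  forall c, glo c * h ^ 2 / 2 <= get c (u (s + h)) - get c (u s) - get c (field m (u s)) * h
    <= ghi c * h ^ 2 / 2.
Proof.
intros Hu Hh Hp Hg c.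
assert (H : glo c * (s + h - s) ^ 2 / 2 <= get c (u (s + h)) - get c (u s)
  - get c (field m (u s)) * (s + h - s) <= ghi c * (s + h - s) ^ 2 / 2);
  [|replace (s + h - s) with h in H by ring; exact H].
apply (derive2_bounds (fun t => get c (u t)) (fun t => get c (field m (u t)))
  (fun t => get c (field2 m (u t)))); [lra| | |].
- intros t Ht. rewrite <- (proj2 (Hp t Ht)). apply Hu.
- intros t Ht. apply field_derive; [apply Hp, Ht|]. intros c'. rewrite <- (proj2 (Hp t Ht)). apply Hu.
- intros t Ht. apply Hg, Ht.
Qed.

(** * Interval arithmetic with denominator 2^30 *)

Definition itv : Set := (Z * Z)%type.

Definition prec : Z := 30.
Definition two30 : Z := Z.shiftl 1 prec.

(** Integer endpoints keep the computation within [Z], where [vm_compute] evaluates it. Operations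
    that are not exact round outward. *)
Definition mem (x : R) (i : itv) : Prop := IZR (fst i) <= x * IZR two30 <= IZR (snd i).

Definition rdn (a : Z) : Z := Z.shiftr a prec.
Definition rup (a : Z) : Z := (- Z.shiftr (- a) prec)%Z.

Definition iadd (i j : itv) : itv := (fst i + fst j, snd i + snd j)%Z.
Definition ineg (i : itv) : itv := (- snd i, - fst i)%Z.
Definition iscale (k : Z) (i : itv) : itv := (k * fst i, k * snd i)%Z.
Definition ihalf (i : itv) : itv := (Z.shiftr (fst i) 1, - Z.shiftr (- snd i) 1)%Z.
Definition imul (i j : itv) : itv :=
  let '(a, b) := i in let '(c, d) := j in
  let p := (a * c)%Z in let q := (a * d)%Z in
  let r := (b * c)%Z in let s := (b * d)%Z in
  (rdn (Z.min (Z.min p q) (Z.min r s)), rup (Z.max (Z.max p q) (Z.max r s))).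
(** Separate from [imul], which would give a negative lower end for an interval containing 0 in its
    interior. *)
Definition isqr (i : itv) : itv :=
  let '(a, b) := i in
  let p := (a * a)%Z in let q := (b * b)%Z in
  ((if andb (a <? 0)%Z (0 <? b)%Z then 0%Z else rdn (Z.min p q)), rup (Z.max p q)).
(** For positive intervals. The reciprocal of [a / 2^30] is [2^60 / a] over the denominator 2^30;
    likewise the root of [a / 2^30] is that of [a * 2^30] in [isqrt]. *)
Definition iinv (i : itv) : itv :=
  let '(a, b) := i in ((two30 * two30) / b, - ((- (two30 * two30)) / a))%Z.
Definition isqrt (i : itv) : itv :=
  let '(a, b) := i in (Z.sqrt (a * two30), Z.sqrt (b * two30) + 1)%Z.

Lemma two30_pos : 0 < IZR two30.
Proof. apply IZR_lt. reflexivity. Qed.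

Lemma shiftr_bounds (a n : Z) : (0 <= n)%Z ->
  IZR (Z.shiftr a n) * IZR (2 ^ n) <= IZR a.
Proof.
intros Hn. rewrite Z.shiftr_div_pow2 by exact Hn. rewrite <- mult_IZR. apply IZR_le.
rewrite Z.mul_comm. apply Z.mul_div_le. apply Z.pow_pos_nonneg; lia.
Qed.

Lemma rdn_le (a : Z) : IZR (rdn a) * IZR two30 <= IZR a.
Proof. apply (shiftr_bounds a prec). discriminate. Qed.

Lemma rup_ge (a : Z) : IZR a <= IZR (rup a) * IZR two30.
Proof.
unfold rup. pose proof (shiftr_bounds (- a) prec) as H.
rewrite opp_IZR in H |- *. change (2 ^ prec)%Z with two30 in H.
assert (0 <= prec)%Z by discriminate. specialize (H H0). lra.
Qed.

Lemma mem_add x y i j : mem x i -> mem y j -> mem (x + y) (iadd i j).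
Proof. unfold mem, iadd; cbn. rewrite !plus_IZR. lra. Qed.

Lemma mem_neg x i : mem x i -> mem (- x) (ineg i).
Proof. unfold mem, ineg; cbn. rewrite !opp_IZR. lra. Qed.

Lemma mem_scale k x i : (0 <= k)%Z -> mem x i -> mem (IZR k * x) (iscale k i).
Proof.
unfold mem, iscale; cbn. intros Hk. apply IZR_le in Hk. rewrite !mult_IZR. nra.
Qed.

Lemma mem_half x i : mem x i -> mem (x / 2) (ihalf i).
Proof.
unfold mem, ihalf; cbn [fst snd]. intros H. rewrite opp_IZR.
pose proof (shiftr_bounds (fst i) 1 ltac:(lia)) as H1.
pose proof (shiftr_bounds (- snd i) 1 ltac:(lia)) as H2.
rewrite opp_IZR in H2. change (IZR (2 ^ 1)) with 2 in *. lra.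
Qed.

(** A bilinear function on a rectangle is extremal at a corner; one variable is moved at a time. *)
Lemma product_bounds a b c d x y :
  a <= x <= b -> c <= y <= d ->
  Rmin (Rmin (a * c) (a * d)) (Rmin (b * c) (b * d)) <= x * y
  <= Rmax (Rmax (a * c) (a * d)) (Rmax (b * c) (b * d)).
Proof.
intros Hx Hy.
assert (Hxy : (Rmin (a * y) (b * y) <= x * y <= Rmax (a * y) (b * y))).
{ unfold Rmin, Rmax. destruct (Rle_lt_dec 0 y); destruct Rle_dec; split; nra. }
assert (Hc : forall e, Rmin (e * c) (e * d) <= e * y <= Rmax (e * c) (e * d)).
{ intros e. unfold Rmin, Rmax. destruct (Rle_lt_dec 0 e); destruct Rle_dec; split; nra. }
pose proof (Hc a) as Ha. pose proof (Hc b) as Hb.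
split.
- apply Rle_trans with (2 := proj1 Hxy). apply Rmin_glb.
  + apply Rle_trans with (1 := Rmin_l _ _), Ha.
  + apply Rle_trans with (1 := Rmin_r _ _), Hb.
- apply Rle_trans with (1 := proj2 Hxy). apply Rmax_lub.
  + apply Rle_trans with (2 := Rmax_l _ _), Ha.
  + apply Rle_trans with (2 := Rmax_r _ _), Hb.
Qed.

Lemma IZR_min a b : IZR (Z.min a b) = Rmin (IZR a) (IZR b).
Proof.
unfold Rmin. destruct Rle_dec as [H|H].
- apply le_IZR in H. rewrite Z.min_l; auto.
- rewrite Z.min_r; auto. apply Rnot_le_lt, lt_IZR in H. lia.
Qed.

Lemma IZR_max a b : IZR (Z.max a b) = Rmax (IZR a) (IZR b).
Proof.
unfold Rmax. destruct Rle_dec as [H|H].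
- apply le_IZR in H. rewrite Z.max_r; auto.
- rewrite Z.max_l; auto. apply Rnot_le_lt, lt_IZR in H. lia.
Qed.

Lemma mem_mul x y i j : mem x i -> mem y j -> mem (x * y) (imul i j).
Proof.
destruct i as [a b], j as [c d]. unfold mem, imul; cbn [fst snd]. intros Hx Hy.
pose proof (product_bounds _ _ _ _ _ _ Hx Hy) as H.
rewrite <- !mult_IZR, <- !IZR_min, <- !IZR_max in H.
pose proof two30_pos as H1.
pose proof (rdn_le (Z.min (Z.min (a * c) (a * d)) (Z.min (b * c) (b * d)))) as Hd.
pose proof (rup_ge (Z.max (Z.max (a * c) (a * d)) (Z.max (b * c) (b * d)))) as Hu.
split; apply Rmult_le_reg_r with (1 := H1); lra.
Qed.

Lemma mem_sqr x i : mem x i -> mem (x ^ 2) (isqr i).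
Proof.
destruct i as [a b]. unfold mem, isqr; cbn [fst snd]. intros Hx.
pose proof two30_pos as H1.
assert (Hsq : IZR a * IZR a <= x * IZR two30 * (x * IZR two30)
   \/ IZR b * IZR b <= x * IZR two30 * (x * IZR two30) \/ (IZR a < 0 /\ 0 < IZR b)).
{ destruct (Rle_lt_dec 0 (IZR a)); [left; nra|].
  destruct (Rle_lt_dec (IZR b) 0); [right; left; nra|]. right; right; split; lra. }
split.
- destruct (andb (a <? 0)%Z (0 <? b)%Z) eqn:Hc.
  + nra.
  + pose proof (rdn_le (Z.min (a * a) (b * b))) as Hd.
    rewrite IZR_min, !mult_IZR in Hd.
    assert (Rmin (IZR a * IZR a) (IZR b * IZR b) <= x * IZR two30 * (x * IZR two30)).
    { destruct Hsq as [H|[H|[Ha Hb]]].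
      - apply Rle_trans with (2 := H), Rmin_l.
      - apply Rle_trans with (2 := H), Rmin_r.
      - apply lt_IZR in Ha. apply lt_IZR in Hb. apply Bool.andb_false_iff in Hc.
        destruct Hc as [Hc|Hc]; apply Z.ltb_ge in Hc; lia. }
    apply Rmult_le_reg_r with (1 := H1). lra.
- pose proof (rup_ge (Z.max (a * a) (b * b))) as Hu.
  rewrite IZR_max, !mult_IZR in Hu.
  assert (x * IZR two30 * (x * IZR two30) <= Rmax (IZR a * IZR a) (IZR b * IZR b)).
  { destruct (Rle_lt_dec 0 (x * IZR two30)).
    - apply Rle_trans with (2 := Rmax_r _ _). nra.
    - apply Rle_trans with (2 := Rmax_l _ _). nra. }
  apply Rmult_le_reg_r with (1 := H1). lra.
Qed.

Lemma mem_inv x i : (0 < fst i)%Z -> mem x i -> 0 < x /\ mem (/ x) (iinv i).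
Proof.
destruct i as [a b]. unfold mem, iinv; cbn [fst snd]. intros Ha Hx.
pose proof two30_pos as H1. apply IZR_lt in Ha.
assert (Hx0 : 0 < x) by nra. split; [exact Hx0|].
assert (Hb : 0 < IZR b) by lra.
assert (Hix : 0 < / x) by (apply Rinv_0_lt_compat; exact Hx0).
split.
- assert (H : IZR (two30 * two30 / b) * IZR b <= IZR two30 * IZR two30).
  { rewrite <- !mult_IZR. apply IZR_le. rewrite Z.mul_comm. apply Z.mul_div_le.
    apply lt_IZR; exact Hb. }
  apply Rmult_le_reg_r with (1 := Hb). apply Rle_trans with (1 := H).
  apply Rmult_le_reg_r with (1 := Hx0).
  replace (/ x * IZR two30 * IZR b * x) with (IZR two30 * IZR b) by (field; lra). nra.
- rewrite opp_IZR.
  assert (H : IZR (- (two30 * two30) / a) * IZR a <= - (IZR two30 * IZR two30)).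
  { rewrite <- !mult_IZR, <- opp_IZR, Z.mul_comm. apply IZR_le. apply Z.mul_div_le.
    apply lt_IZR; exact Ha. }
  apply Rmult_le_reg_r with (1 := Ha). apply Rle_trans with (IZR two30 * IZR two30); [|lra].
  apply Rmult_le_reg_r with (1 := Hx0).
  replace (/ x * IZR two30 * IZR a * x) with (IZR two30 * IZR a) by (field; lra). nra.
Qed.

Lemma mem_sqrt x i : (0 < fst i)%Z -> mem x i -> mem (sqrt x) (isqrt i).
Proof.
destruct i as [a b]. unfold mem, isqrt; cbn [fst snd]. intros Ha Hx.
pose proof two30_pos as H1. pose proof Ha as Ha'. apply IZR_lt in Ha.
assert (Hx0 : 0 < x) by nra.
assert (Hone : (0 < two30)%Z) by reflexivity.
assert (Hb : (0 < b)%Z) by (apply lt_IZR; lra).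
pose proof (sqrt_lt_R0 x Hx0) as Hs. pose proof (sqrt_sqrt x (Rlt_le _ _ Hx0)) as Hss.
destruct (Z.sqrt_spec (a * two30)) as [H2 _]; [lia|].
destruct (Z.sqrt_spec (b * two30)) as [_ H3]; [lia|].
pose proof (Z.sqrt_nonneg (a * two30)) as H4. pose proof (Z.sqrt_nonneg (b * two30)) as H5.
unfold Z.succ in H3.
apply IZR_le in H2. apply IZR_lt in H3. apply IZR_le in H4. apply IZR_le in H5.
rewrite !mult_IZR in *. rewrite plus_IZR in *.
assert (Hxx : sqrt x * IZR two30 * (sqrt x * IZR two30) = x * IZR two30 * IZR two30).
{ rewrite <- Hss at 3. ring. }
assert (0 < sqrt x * IZR two30) by nra.
split; apply Rnot_lt_le; intros Hlt; nra.
Qed.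

(** * Interval versions of the field and of the integration step *)

Definition vmem (x : vec R) (U : vec itv) : Prop := forall c, mem (get c x) (get c U).

Definition irho2 (U : vec itv) : itv := iadd (isqr (vY U)) (ihalf (ihalf (isqr (isqr (vz U))))).
Definition itwo : itv := (2 * two30, 2 * two30)%Z.

(** Sums are factored, as in [z * (2 E - m z^4 g)], because interval multiplication is only
    subdistributive and factored forms are tighter. *)
Definition ifield (m : itv) (U : vec itv) : vec itv :=
  let '(Vec z w Y V E) := U in
  let z2 := isqr z in
  let r := iinv (isqrt (irho2 U)) in
  let g := imul r (isqr r) in
  Vec (ihalf w)
      (imul z (iadd (iscale 2 E) (ineg (imul (imul m (isqr z2)) g))))
      (imul z2 V)
      (ineg (imul (iadd m itwo) (imul z2 (imul Y g))))
      (ineg (imul (imul (ihalf m) z2) (imul z (imul w g)))).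

(** Field and second derivative come from one evaluation, which shares the inverse root and the
    common products. *)
Definition ifield12 (m : itv) (U : vec itv) : vec itv * vec itv :=
  let '(Vec z w Y V E) := U in
  let z2 := isqr z in
  let r := iinv (isqrt (irho2 U)) in
  let r2 := isqr r in
  let g := imul r r2 in
  let mz4 := imul m (isqr z2) in
  let Yg := imul Y g in
  let wg := imul w g in
  let hmz2 := imul (ihalf m) z2 in
  let m2 := iadd m itwo in
  let dz := ihalf w in
  let dw := imul z (iadd (iscale 2 E) (ineg (imul mz4 g))) in
  let dY := imul z2 V in
  let dV := ineg (imul m2 (imul z2 Yg)) in
  let dE := ineg (imul hmz2 (imul z wg)) in
  let dg := ineg (iscale 3 (imul (imul g r2)
              (iadd (imul Y dY) (ihalf (imul (imul z z2) dz))))) in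
  let dzg := imul dz g in
  let zdg := imul z dg in
  (Vec dz dw dY dV dE,
   Vec (ihalf dw)
     (iadd (iscale 2 (iadd (imul dz E) (imul z dE)))
           (ineg (imul mz4 (iadd (iscale 5 dzg) zdg))))
     (iadd (iscale 2 (imul (imul z dz) V)) (imul z2 dV))
     (ineg (imul (imul m2 z) (iadd (iscale 2 (imul dz Yg))
        (iadd (imul z (imul dY g)) (imul Y zdg)))))
     (ineg (imul hmz2 (iadd (iscale 3 (imul dz wg))
        (iadd (imul z (imul dw g)) (imul w zdg)))))).

Definition vmap2 {A B C : Type} (f : A -> B -> C) (x : vec A) (y : vec B) : vec C :=
  Vec (f (vz x) (vz y)) (f (vw x) (vw y)) (f (vY x) (vY y)) (f (vV x) (vV y)) (f (vE x) (vE y)).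

Definition vforall (p : coord -> bool) : bool :=
  andb (p Cz) (andb (p Cw) (andb (p CY) (andb (p CV) (p CE)))).

Definition imag (i : itv) : Z := Z.max (- fst i) (snd i).

(* A guess for the rough enclosure over a step of length [h]: the Euler
   segment, lengthened by a quarter and widened by [k * h^2 * |field|]. *)
Definition guess (k h : Z) (U f : vec itv) : vec itv :=
  let size := (imag (vz f) + imag (vw f) + imag (vY f) + imag (vV f) + imag (vE f))%Z in
  let pad := (4 + k * rup (h * rup (h * size)))%Z in
  vmap2 (fun i j =>
    let lo := Z.min 0 (rup (h * fst j)) in
    let hi := Z.max 0 (rup (h * snd j)) in
    (fst i + lo + Z.shiftr lo 2 - pad, snd i + hi + Z.shiftr hi 2 + pad)%Z) U f.

(** Boxes within these limits lie where every field subject to [agrees] is the true one; 16 and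
    1/256 reappear there. *)
Definition box_bound : Z := 16 * two30.
Definition rho2_min : Z := Z.shiftr two30 8.

(** The guess is accepted only after the hypotheses of [rough_enclosure] have been checked on it.
    The new state is the Euler step from [U] plus [h^2 / 2] times the second derivative over the
    whole box; the box is returned as well, for sign conditions during the step. *)
Definition step (m : itv) (k h : Z) (U : vec itv) : option (vec itv * vec itv) :=
  let C := guess k h U (ifield m U) in
  if andb (Z.ltb rho2_min (fst (irho2 U))) (Z.ltb rho2_min (fst (irho2 C))) then
  let '(f, g) := ifield12 m C in
  if vforall (fun c => andb
      (andb (Z.ltb (- box_bound) (fst (get c C))) (Z.ltb (snd (get c C)) box_bound))
      (andb (Z.ltb (fst (get c C)) (fst (get c U) + Z.min 0 (rdn (h * fst (get c f)))))
            (Z.ltb (snd (get c U) + Z.max 0 (rup (h * snd (get c f)))) (snd (get c C)))))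
  then
    let H := (h, h) in
    let H2 := ihalf (isqr H) in
    Some (vmap2 (fun i fg => iadd i (iadd (imul H (fst fg)) (imul H2 (snd fg))))
            U (vmap2 pair (ifield m U) g), C)
  else None
  else None.

Fixpoint repeat_steps (m : itv) (ok : vec itv -> bool) (n : nat) (k h : Z) (U : vec itv)
  : option (vec itv) :=
  match n with
  | O => Some U
  | S n' => match step m k h U with
            | Some (U', C) => if ok C then repeat_steps m ok n' k h U' else None
            | None => None
            end
  end.

(* The step lengths of the schedule are in units of 2^-10. *)
Fixpoint run (m : itv) (ok : vec itv -> bool) (l : list (nat * (Z * N))) (U : vec itv)
  : option (vec itv) :=
  match l with
  | nil => Some U
  | cons (n, (k, h)) l' =>
      match repeat_steps m ok n k (Z.shiftl (Z.of_N h) 20) U with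
      | Some U' => run m ok l' U'
      | None => None
      end
  end.

(** Radius 2^-16 around 1. The mass enters the runs as an interval, so that one computation covers
    all these masses and provides the open set of the theorem. *)
Definition masses : itv := (two30 - Z.shiftl 1 14, two30 + Z.shiftl 1 14)%Z.
Definition start (th : Z) : vec itv :=
  Vec (two30, two30) (0, 0)%Z (th, th) (0, 0)%Z (- two30, - two30)%Z.

(** Since [w] starts at 0, the first boxes cannot show [w < 0]. The sign of [w] is therefore
    certified only where [z > 0] is not; while [z > 0] it follows from
    [w_negative_before_collision]. *)
Definition okA (C : vec itv) : bool := orb (Z.ltb 0 (fst (vz C))) (Z.ltb (snd (vw C)) 0).
Definition okB (C : vec itv) : bool := Z.ltb 0 (fst (vY C)).

(** Pure data: soundness holds for any schedule, and only the success of the runs depends on the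
    choice. The two lists amount to 2112/1024 and 2848/1024 units of fictitious time. *)
Definition schedA : list (nat * (Z * N)) :=
  ((165, (3%Z, 6%N)) :: (78, (3%Z, 5%N)) :: (26, (3%Z, 6%N)) :: (22, (3%Z, 5%N)) ::
   (42, (3%Z, 4%N)) :: (50, (3%Z, 3%N)) :: (59, (3%Z, 2%N)) :: (11, (50%Z, 2%N)) ::
   (4, (3%Z, 2%N)) :: nil)%nat.
Definition schedB : list (nat * (Z * N)) :=
  ((21, (3%Z, 18%N)) :: (96, (3%Z, 17%N)) :: (12, (3%Z, 16%N)) :: (12, (3%Z, 15%N)) ::
   (10, (3%Z, 14%N)) :: (9, (3%Z, 13%N)) :: (7, (3%Z, 12%N)) :: (5, (3%Z, 11%N)) ::
   (7, (3%Z, 10%N)) :: nil)%nat.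

(** * Soundness of the interval field and of one step *)

Lemma mem_irho2 x U : vmem x U -> mem (rho2 x) (irho2 U).
Proof.
intros H. unfold rho2, irho2.
replace (vz x ^ 4 / 4) with ((vz x ^ 2) ^ 2 / 2 / 2) by field.
apply mem_add; [apply mem_sqr, (H CY)|apply mem_half, mem_half, mem_sqr, mem_sqr, (H Cz)].
Qed.

Lemma mem_pos x i : (0 < fst i)%Z -> mem x i -> 0 < x.
Proof. intros Hi [H _]. apply IZR_lt in Hi. pose proof two30_pos. nra. Qed.

Lemma mem_inv_sqrt x i : (0 < fst i)%Z -> mem x i -> mem (/ sqrt x) (iinv (isqrt i)).
Proof.
intros Hi Hx. apply mem_inv; [|apply mem_sqrt; assumption].
destruct i as [a b]; cbn [isqrt fst] in *. apply Z.sqrt_pos.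
assert (0 < two30)%Z by reflexivity. lia.
Qed.

Lemma irho3_sqrt r2 : 0 < r2 -> irho3 r2 = / sqrt r2 * (/ sqrt r2) ^ 2.
Proof.
intros H. unfold irho3. assert (Hs : 0 < sqrt r2) by (apply sqrt_lt_R0; exact H).
rewrite <- (sqrt_sqrt r2) at 1 by lra. field. lra.
Qed.

Lemma mem_two : mem 2 itwo.
Proof. unfold mem, itwo; cbn [fst snd]. rewrite mult_IZR. lra. Qed.

#[local] Hint Resolve mem_add mem_neg mem_half mem_mul mem_sqr mem_two : itv.
#[local] Hint Extern 1 (mem (IZR _ * _) (iscale _ _)) => apply mem_scale; [discriminate|] : itv.

Lemma mem_ifield m x mi U : mem m mi -> vmem x U -> (0 < fst (irho2 U))%Z ->
  vmem (field m x) (ifield mi U).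
Proof.
intros Hm Hx Hp c.
pose proof (mem_irho2 x U Hx) as Hr.
pose proof (mem_pos _ _ Hp Hr) as Hr0.
pose proof (mem_inv_sqrt _ _ Hp Hr) as Hs.
pose proof (Hx Cz) as Mz. pose proof (Hx Cw) as Mw. pose proof (Hx CY) as MY.
pose proof (Hx CV) as MV. pose proof (Hx CE) as ME.
unfold field. rewrite (irho3_sqrt _ Hr0).
unfold ifield. set (ri := iinv (isqrt (irho2 U))) in *. set (r := / sqrt (rho2 x)) in *.
clearbody ri r.
destruct U as [zi wi Yi Vi Ei], x as [z w Y V E]; cbn [get vz vw vY vV vE] in *.
destruct c; cbn [get vz vw vY vV vE].
- auto with itv.
- replace (2 * z * E - m * z ^ 5 * (r * r ^ 2))
    with (z * (2 * E + - (m * (z ^ 2) ^ 2 * (r * r ^ 2)))) by ring.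
  auto 10 with itv.
- auto with itv.
- replace (- ((2 + m) * z ^ 2 * Y * (r * r ^ 2)))
    with (- ((m + 2) * (z ^ 2 * (Y * (r * r ^ 2))))) by ring.
  auto 10 with itv.
- replace (- (m / 2 * z ^ 3 * w * (r * r ^ 2)))
    with (- (m / 2 * z ^ 2 * (z * (w * (r * r ^ 2))))) by ring.
  auto 10 with itv.
Qed.

Lemma mem_ifield12 m x mi U : mem m mi -> vmem x U -> (0 < fst (irho2 U))%Z ->
  vmem (field m x) (fst (ifield12 mi U)) /\ vmem (field2 m x) (snd (ifield12 mi U)).
Proof.
intros Hm Hx Hp.
pose proof (mem_ifield m x mi U Hm Hx Hp) as Hf.
assert (Heq : fst (ifield12 mi U) = ifield mi U) by (destruct U; reflexivity).
rewrite Heq. split; [exact Hf|]. clear Heq.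
pose proof (mem_irho2 x U Hx) as Hr.
pose proof (mem_pos _ _ Hp Hr) as Hr0.
pose proof (mem_inv_sqrt _ _ Hp Hr) as Hs.
pose proof (Hx Cz) as Mz. pose proof (Hx Cw) as Mw. pose proof (Hx CY) as MY.
pose proof (Hx CV) as MV. pose proof (Hx CE) as ME.
pose proof (Hf Cz) as Dz. pose proof (Hf Cw) as Dw. pose proof (Hf CY) as DY.
pose proof (Hf CV) as DV. pose proof (Hf CE) as DE.
assert (Hi : / rho2 x = (/ sqrt (rho2 x)) ^ 2).
{ rewrite <- (sqrt_sqrt (rho2 x)) at 1 by lra. field.
  apply Rgt_not_eq, sqrt_lt_R0, Hr0. }
unfold field2. rewrite (irho3_sqrt _ Hr0), Hi.
set (d := field m x) in *.
unfold ifield in *. unfold ifield12.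
set (ri := iinv (isqrt (irho2 U))) in *. set (r := / sqrt (rho2 x)) in *.
clearbody ri r d. clear Hf.
destruct U as [zi wi Yi Vi Ei], x as [z w Y V E], d as [dz dw dY dV dE];
  cbn [get vz vw vY vV vE fst snd] in *.
assert (Mg : mem (r * r ^ 2) (imul ri (isqr ri))) by auto with itv.
set (g := r * r ^ 2) in *. set (gi := imul ri (isqr ri)) in *.
set (dzi := ihalf wi) in *.
set (dwi := imul zi _) in *. set (dYi := imul (isqr zi) Vi) in *.
set (dVi := ineg (imul (iadd mi itwo) _)) in *. set (dEi := ineg (imul (imul (ihalf mi) _) _)) in *.
assert (Mdg : mem (- (3 * (g * r ^ 2 * (Y * dY + z ^ 3 * dz / 2))))
   (ineg (iscale 3 (imul (imul gi (isqr ri)) (iadd (imul Yi dYi) (ihalf (imul (imul zi (isqr zi)) dzi))))))).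
{ replace (z ^ 3 * dz / 2) with (z * z ^ 2 * dz / 2) by field. auto 12 with itv. }
set (dg := - (3 * _)) in *. set (dgi := ineg (iscale 3 _)) in *.
clearbody g gi dzi dwi dYi dVi dEi dg dgi.
intros c. destruct c; cbn [get vz vw vY vV vE].
- auto with itv.
- replace (2 * (dz * E + z * dE) - m * z ^ 4 * (5 * (dz * g) + z * dg))
   with (2 * (dz * E + z * dE) + - (m * (z ^ 2) ^ 2 * (5 * (dz * g) + z * dg))) by ring.
  auto 12 with itv.
- auto 12 with itv.
- rewrite (Rplus_comm 2 m). auto 14 with itv.
- auto 14 with itv.
Qed.

Lemma vforall_spec p : vforall p = true -> forall c, p c = true.
Proof.
unfold vforall. intros H c. repeat (apply andb_prop in H; destruct H as [? H]).
destruct c; assumption.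
Qed.

Lemma get_vmap2 {A B D} (f : A -> B -> D) x y c :
  get c (vmap2 f x y) = f (get c x) (get c y).
Proof. destruct c; reflexivity. Qed.

Lemma Some_pair_inj {A B : Type} (a c : A) (b d : B) :
  Some (a, b) = Some (c, d) -> a = c /\ b = d.
Proof. intros H. injection H. auto. Qed.

(** All that the integrator needs to know of the cut field, so that the huge cut-off constants never
    enter the computation. *)
Definition agrees (m : R) (Phi : vec R -> vec R) : Prop :=
  forall x, (forall c, Rabs (get c x) <= 16) -> / 256 <= rho2 x -> Phi x = field m x.

Lemma box_bound_R : IZR box_bound = 16 * IZR two30.
Proof. unfold box_bound. apply mult_IZR. Qed.

Lemma rho2_min_R : IZR rho2_min = / 256 * IZR two30.
Proof.
assert (H : two30 = (256 * rho2_min)%Z) by reflexivity. rewrite H, mult_IZR. field.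
Qed.

(** The checks on the box are the hypotheses of [rough_enclosure]; on the box the second derivative
    lies in [g], and [taylor_step] encloses the end point. What holds throughout the step is kept
    for the sign arguments. *)
Lemma step_sound m mi Phi u s k h U U' C :
  mem m mi -> agrees m Phi -> follows Phi u -> (0 <= h)%Z ->
  step mi k h U = Some (U', C) -> vmem (u s) U ->
  vmem (u (s + IZR h / IZR two30)) U' /\
  forall t, s <= t <= s + IZR h / IZR two30 ->
    vmem (u t) C /\ 0 < rho2 (u t) /\ Phi (u t) = field m (u t).
Proof.
intros Hm HPhi Hu Hh Hstep HU.
pose proof two30_pos as H1.
unfold step in Hstep. set (C0 := guess k h U (ifield mi U)) in *. clearbody C0.
destruct (andb _ _) eqn:Hrho in Hstep; [|discriminate].
apply andb_prop in Hrho. destruct Hrho as [HrU HrC].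
apply Z.ltb_lt in HrU, HrC.
assert (Hrm : (0 < rho2_min)%Z) by reflexivity.
destruct (ifield12 mi C0) as [f g] eqn:Hfg.
destruct (vforall _) eqn:Hall in Hstep; [|discriminate].
apply Some_pair_inj in Hstep. destruct Hstep as [HU' HC0].
pose proof (vforall_spec _ Hall) as Hc. clear Hall. cbv beta in Hc.
assert (Hb : forall c, (- box_bound < fst (get c C0))%Z /\ (snd (get c C0) < box_bound)%Z /\
  (fst (get c C0) < fst (get c U) + Z.min 0 (rdn (h * fst (get c f))))%Z /\
  (snd (get c U) + Z.max 0 (rup (h * snd (get c f))) < snd (get c C0))%Z).
{ intros c. specialize (Hc c). repeat rewrite Bool.andb_true_iff in Hc.
  repeat rewrite Z.ltb_lt in Hc. tauto. }
clear Hc.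
set (hR := IZR h / IZR two30).
assert (HhR : 0 <= hR).
{ apply IZR_le in Hh. unfold hR. apply Rmult_le_pos; [exact Hh|].
  apply Rlt_le, Rinv_0_lt_compat, H1. }
assert (HhR' : hR * IZR two30 = IZR h) by (unfold hR; field; lra).
assert (Hagree : forall x, vmem x C0 -> 0 < rho2 x /\ Phi x = field m x).
{ intros x Hx. pose proof (mem_irho2 _ _ Hx) as Hr.
  split; [apply (mem_pos _ (irho2 C0)); [lia|exact Hr]|].
  apply HPhi.
  - intros c. specialize (Hx c). specialize (Hb c). destruct Hx as [Hx1 Hx2].
    destruct Hb as [Hb1 [Hb2 _]]. apply IZR_lt in Hb1, Hb2.
    rewrite opp_IZR, box_bound_R in *. apply Rabs_le. split; nra.
  - destruct Hr as [Hr _]. apply IZR_lt in HrC. rewrite rho2_min_R in HrC. nra. }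
assert (HfC : forall x, vmem x C0 -> vmem (field m x) f /\ vmem (field2 m x) g).
{ intros x Hx. pose proof (mem_ifield12 m x mi C0 Hm Hx) as H.
  rewrite Hfg in H. apply H. lia. }
assert (Hin : forall t, s <= t <= s + hR -> vmem (u t) C0).
{ intros t Ht c.
  destruct (rough_enclosure Phi u s hR (fun c => IZR (fst (get c f)) / IZR two30)
    (fun c => IZR (snd (get c f)) / IZR two30) (fun c => IZR (fst (get c C0)) / IZR two30)
    (fun c => IZR (snd (get c C0)) / IZR two30) Hu HhR) with (t := t) (c := c) as [Ha Hb'].
  - intros x Hx.
    assert (Hx' : vmem x C0).
    { intros c'. specialize (Hx c'). destruct Hx as [Hx1 Hx2].
      apply (Rmult_le_compat_r (IZR two30)) in Hx1; [|lra].
      apply (Rmult_le_compat_r (IZR two30)) in Hx2; [|lra].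
      unfold Rdiv in *. rewrite Rmult_assoc, Rinv_l, Rmult_1_r in Hx1, Hx2 by lra.
      split; assumption. }
    intros c'. rewrite (proj2 (Hagree x Hx')).
    destruct (proj1 (HfC x Hx') c') as [Hf1 Hf2].
    split; apply Rmult_le_reg_r with (1 := H1); unfold Rdiv;
      rewrite Rmult_assoc, Rinv_l, Rmult_1_r by lra; assumption.
  - intros c'. destruct (Hb c') as [_ [_ [Hb3 _]]]. destruct (HU c') as [HU1 _].
    apply IZR_lt in Hb3. rewrite plus_IZR, IZR_min in Hb3.
    pose proof (rdn_le (h * fst (get c' f))) as Hd. rewrite mult_IZR in Hd.
    apply Rmult_lt_reg_r with (1 := H1). unfold Rdiv at 1.
    rewrite Rmult_assoc, Rinv_l, Rmult_1_r by lra.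
    apply Rlt_le_trans with (1 := Hb3). rewrite Rmult_plus_distr_r.
    apply Rplus_le_compat; [exact HU1|].
    replace (hR * (IZR (fst (get c' f)) / IZR two30)) with (IZR h * IZR (fst (get c' f)) / (IZR two30 * IZR two30))
      by (unfold hR; field; lra).
    assert (IZR (rdn (h * fst (get c' f))) <= IZR h * IZR (fst (get c' f)) / (IZR two30 * IZR two30) * IZR two30).
    { apply Rmult_le_reg_r with (1 := H1). apply Rle_trans with (1 := Hd). right. field. lra. }
    unfold Rmin at 2. destruct Rle_dec as [Hr|Hr].
    + apply Rle_trans with (1 := Rmin_l _ _). lra.
    + apply Rle_trans with (1 := Rmin_r _ _). assumption.
  - intros c'. destruct (Hb c') as [_ [_ [_ Hb4]]]. destruct (HU c') as [_ HU2].
    apply IZR_lt in Hb4. rewrite plus_IZR, IZR_max in Hb4.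
    pose proof (rup_ge (h * snd (get c' f))) as Hd. rewrite mult_IZR in Hd.
    apply Rmult_lt_reg_r with (1 := H1). unfold Rdiv at 2.
    rewrite Rmult_assoc, Rinv_l, Rmult_1_r by lra.
    apply Rle_lt_trans with (2 := Hb4). rewrite Rmult_plus_distr_r.
    apply Rplus_le_compat; [exact HU2|].
    replace (hR * (IZR (snd (get c' f)) / IZR two30)) with (IZR h * IZR (snd (get c' f)) / (IZR two30 * IZR two30))
      by (unfold hR; field; lra).
    assert (IZR h * IZR (snd (get c' f)) / (IZR two30 * IZR two30) * IZR two30 <= IZR (rup (h * snd (get c' f)))).
    { apply Rmult_le_reg_r with (1 := H1). apply Rle_trans with (2 := Hd). right. field. lra. }
    unfold Rmax at 1. destruct Rle_dec as [Hr|Hr].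
    + apply Rle_trans with (2 := Rmax_r _ _). assumption.
    + apply Rle_trans with (2 := Rmax_l _ _). lra.
  - exact Ht.
  - split.
    + apply Rmult_le_reg_r with (/ IZR two30); [apply Rinv_0_lt_compat, H1|].
      rewrite (Rmult_assoc (get c (u t))), Rinv_r, Rmult_1_r by lra. exact Ha.
    + apply Rmult_le_reg_r with (/ IZR two30); [apply Rinv_0_lt_compat, H1|].
      rewrite (Rmult_assoc (get c (u t))), Rinv_r, Rmult_1_r by lra. exact Hb'. }
rewrite <- HC0. split; [|intros t Ht; split; [|apply Hagree]; apply Hin, Ht].
rewrite <- HU'. intros c. rewrite !get_vmap2. cbn [fst snd].
pose proof (taylor_step m Phi u s hR (fun c => IZR (fst (get c g)) / IZR two30)
  (fun c => IZR (snd (get c g)) / IZR two30) Hu HhR) as HT.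
assert (Hc : mem ((get c (u (s + hR)) - get c (u s) - get c (field m (u s)) * hR))
   (imul (ihalf (isqr (h, h))) (get c g))).
(* The remainder is written as [hR^2 / 2] times a number in the interval for the second derivative.
   This divides by [hR^2 / 2], so a step of length 0 is treated apart. *)
{ destruct (Req_dec hR 0) as [Hz|Hz].
  - assert (Hh0 : h = 0%Z) by (apply eq_IZR; rewrite <- HhR', Hz; lra).
    rewrite Hz, Rplus_0_r. replace (get c (u s) - get c (u s) - get c (field m (u s)) * 0) with (0 ^ 2 / 2 * (get c (field2 m (u s)))) by field.
    apply mem_mul; [apply mem_half, mem_sqr|].
    + subst h. unfold mem; cbn [fst snd]. lra.
    + apply HfC, Hin. lra.
  - replace (get c (u (s + hR)) - get c (u s) - get c (field m (u s)) * hR)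
      with (hR ^ 2 / 2 * ((get c (u (s + hR)) - get c (u s) - get c (field m (u s)) * hR) / (hR ^ 2 / 2)))
      by (field; lra).
    assert (Hh2 : 0 < hR ^ 2 / 2) by nra.
    apply mem_mul; [apply mem_half, mem_sqr|].
    + unfold mem; cbn [fst snd]. rewrite HhR'. lra.
    + destruct (HT (fun t Ht => Hagree _ (Hin t Ht))) with (c := c) as [HT1 HT2].
      { intros t Ht c'. destruct (proj2 (HfC _ (Hin t Ht)) c') as [Hg1 Hg2].
        split; apply Rmult_le_reg_r with (1 := H1); unfold Rdiv;
        rewrite Rmult_assoc, Rinv_l, Rmult_1_r by lra; assumption. }
      set (X := get c (u (s + hR)) - _ - _) in *.
      split.
      * apply Rmult_le_reg_r with (hR ^ 2 / 2 / IZR two30).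
        { apply Rdiv_lt_0_compat; assumption. }
        replace (X / (hR ^ 2 / 2) * IZR two30 * (hR ^ 2 / 2 / IZR two30)) with X by (field; lra).
        apply Rle_trans with (2 := HT1). right. field. lra.
      * apply Rmult_le_reg_r with (hR ^ 2 / 2 / IZR two30).
        { apply Rdiv_lt_0_compat; assumption. }
        replace (X / (hR ^ 2 / 2) * IZR two30 * (hR ^ 2 / 2 / IZR two30)) with X by (field; lra).
        apply Rle_trans with (1 := HT2). right. field. lra. }
replace (get c (u (s + hR))) with (get c (u s) + (hR * get c (field m (u s))
  + (get c (u (s + hR)) - get c (u s) - get c (field m (u s)) * hR))) by ring.
apply mem_add; [apply HU|]. apply mem_add; [|exact Hc].
apply mem_mul.
- unfold mem; cbn [fst snd]. rewrite HhR'. lra.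
- apply mem_ifield; [exact Hm|exact HU|lia].
Qed.

(** * Two shots *)

(** The half-open range [s <= t < T] lets consecutive pieces be glued, and is void when no step is
    made. *)
Lemma repeat_steps_sound m mi ok Phi u n k h :
  mem m mi -> agrees m Phi -> follows Phi u -> (0 <= h)%Z ->
  forall s U U', repeat_steps mi ok n k h U = Some U' -> vmem (u s) U ->
  exists T, s <= T /\ vmem (u T) U' /\
    forall t, s <= t < T -> 0 < rho2 (u t) /\ Phi (u t) = field m (u t) /\
      exists C, ok C = true /\ vmem (u t) C.
Proof.
intros Hm HPhi Hu Hh. induction n as [|n IH]; intros s U U' Hrun HU.
- cbn [repeat_steps] in Hrun.
  assert (HUU : U = U') by (inversion Hrun; reflexivity). subst U'.
  exists s. split; [lra|]. split; [exact HU|]. intros; lra.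
- cbn [repeat_steps] in Hrun.
  destruct (step mi k h U) as [[U1 C]|] eqn:Hstep; [|discriminate].
  destruct (ok C) eqn:Hok; [|discriminate].
  destruct (step_sound m mi Phi u s k h U U1 C Hm HPhi Hu Hh Hstep HU) as [HU1 HC].
  destruct (IH _ _ _ Hrun HU1) as [T [HT [HUT Hin]]].
  assert (0 <= IZR h / IZR two30).
  { apply IZR_le in Hh. apply Rmult_le_pos; [exact Hh|].
    apply Rlt_le, Rinv_0_lt_compat, two30_pos. }
  exists T. split; [lra|]. split; [exact HUT|].
  intros t Ht. destruct (Rle_lt_dec t (s + IZR h / IZR two30)).
  + destruct (HC t ltac:(lra)) as [HtC [Hr Hf]].
    split; [exact Hr|]. split; [exact Hf|]. exists C. split; assumption.
  + apply Hin. lra.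
Qed.

Lemma run_sound m mi ok Phi u :
  mem m mi -> agrees m Phi -> follows Phi u ->
  forall l s U U', run mi ok l U = Some U' -> vmem (u s) U ->
  exists T, s <= T /\ vmem (u T) U' /\
    forall t, s <= t < T -> 0 < rho2 (u t) /\ Phi (u t) = field m (u t) /\
      exists C, ok C = true /\ vmem (u t) C.
Proof.
intros Hm HPhi Hu. induction l as [|[n [k h]] l IH]; intros s U U' Hrun HU.
- cbn [run] in Hrun.
  assert (HUU : U = U') by (inversion Hrun; reflexivity). subst U'.
  exists s. split; [lra|]. split; [exact HU|]. intros; lra.
- cbn [run] in Hrun.
  destruct (repeat_steps _ _ _ _ _ _) as [U1|] eqn:Hrep in Hrun; [|discriminate].
  assert (Hh : (0 <= Z.shiftl (Z.of_N h) 20)%Z) by (apply Z.shiftl_nonneg; lia).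
  destruct (repeat_steps_sound m mi ok Phi u n k _ Hm HPhi Hu Hh s U U1 Hrep HU)
    as [T1 [HT1 [HU1 Hin1]]].
  destruct (IH _ _ _ Hrun HU1) as [T [HT [HUT Hin]]].
  exists T. split; [lra|]. split; [exact HUT|].
  intros t Ht. destruct (Rlt_le_dec t T1); [apply Hin1|apply Hin]; lra.
Qed.

(** The rigorous integrator is evaluated here: 457 steps from the height 65/64, and 179 steps from
    3/2 in [high_run]. *)
Lemma low_run : match run masses okA schedA (start (Z.shiftl 65 24)) with
  | Some U => andb (Z.ltb (snd (vY U)) 0) (Z.ltb (snd (vw U)) 0)
  | None => false end = true.
Proof. vm_compute. reflexivity. Qed.

Lemma high_run : match run masses okB schedB (start (Z.shiftl 3 29)) with
  | Some U => andb (Z.ltb 0 (fst (vY U))) (Z.ltb 0 (fst (vw U)))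
  | None => false end = true.
Proof. vm_compute. reflexivity. Qed.

Lemma mem_positive x i : (0 <? fst i)%Z = true -> mem x i -> 0 < x.
Proof. intros H. apply mem_pos, Z.ltb_lt, H. Qed.

Lemma mem_negative x i : (snd i <? 0)%Z = true -> mem x i -> x < 0.
Proof.
intros H [_ Hx]. apply Z.ltb_lt, IZR_lt in H. pose proof two30_pos. nra.
Qed.

(** [E = -1] is the value of [(w^2 / 4 - 1) / z^2] at [z = 1], [w = 0]. The distance 1 of the twins
    is a normalization by scaling. *)
Definition brake_state (th : R) : vec R := Vec 1 0 th 0 (-1).

Lemma vmem_start th i : th * IZR two30 = IZR i -> vmem (brake_state th) (start i).
Proof.
intros H c. unfold mem.
destruct c; cbn [get brake_state start vz vw vY vV vE fst snd]; rewrite ?opp_IZR; lra.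
Qed.

(** The disjunction is left unresolved, since deducing [w < 0] from [z > 0] takes the differential
    equation over the whole past; see [syzygy_first_low]. *)
Lemma low_shot m Phi u :
  mem m masses -> agrees m Phi -> follows Phi u -> u 0 = brake_state (65 / 64) ->
  exists s, 0 <= s /\ vY (u s) < 0 /\ vw (u s) < 0 /\
    forall t, 0 <= t < s -> 0 < rho2 (u t) /\ Phi (u t) = field m (u t) /\
      (0 < vz (u t) \/ vw (u t) < 0).
Proof.
intros Hm HPhi Hu H0. pose proof low_run as Hrun.
destruct (run masses okA schedA (start (Z.shiftl 65 24))) as [U|] eqn:HU; [|discriminate].
destruct (run_sound m masses okA Phi u Hm HPhi Hu _ 0 _ _ HU) as [T [HT [HUT Hin]]].
{ rewrite H0. apply vmem_start.
  assert (H : Z.shiftl 65 24 = (65 * 2 ^ 24)%Z) by reflexivity. rewrite H.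
  assert (H' : two30 = (64 * 2 ^ 24)%Z) by reflexivity. rewrite H', !mult_IZR. field. }
apply andb_prop in Hrun. destruct Hrun as [H1 H2].
exists T. split; [exact HT|].
split; [apply (mem_negative _ _ H1), (HUT CY)|].
split; [apply (mem_negative _ _ H2), (HUT Cw)|].
intros t Ht. destruct (Hin t Ht) as [Hr [Hf [C [HC HtC]]]].
split; [exact Hr|]. split; [exact Hf|].
apply Bool.orb_true_iff in HC. destruct HC as [HC|HC]; [left|right].
- apply (mem_positive _ _ HC), (HtC Cz).
- apply (mem_negative _ _ HC), (HtC Cw).
Qed.

Lemma high_shot m Phi u :
  mem m masses -> agrees m Phi -> follows Phi u -> u 0 = brake_state (3 / 2) ->
  exists s, 0 <= s /\ 0 < vw (u s) /\ forall t, 0 <= t <= s -> 0 < vY (u t).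
Proof.
intros Hm HPhi Hu H0. pose proof high_run as Hrun.
destruct (run masses okB schedB (start (Z.shiftl 3 29))) as [U|] eqn:HU; [|discriminate].
destruct (run_sound m masses okB Phi u Hm HPhi Hu _ 0 _ _ HU) as [T [HT [HUT Hin]]].
{ rewrite H0. apply vmem_start.
  assert (H : Z.shiftl 3 29 = (3 * 2 ^ 29)%Z) by reflexivity. rewrite H.
  assert (H' : two30 = (2 * 2 ^ 29)%Z) by reflexivity. rewrite H', !mult_IZR. field. }
apply andb_prop in Hrun. destruct Hrun as [H1 H2].
exists T. split; [exact HT|].
split; [apply (mem_positive _ _ H2), (HUT Cw)|].
intros t Ht. destruct (Req_dec t T) as [->|Hne].
- apply (mem_positive _ _ H1), (HUT CY).
- destruct (Hin t ltac:(lra)) as [_ [_ [C [HC HtC]]]]. apply (mem_positive _ _ HC), (HtC CY).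
Qed.

(** * Flows of bounded Lipschitz fields *)

Definition vbuild {A : Type} (f : coord -> A) : vec A := Vec (f Cz) (f Cw) (f CY) (f CV) (f CE).

Lemma get_vbuild {A : Type} (f : coord -> A) c : get c (vbuild f) = f c.
Proof. destruct c; reflexivity. Qed.

Lemma vec_ext {A : Type} (x y : vec A) : (forall c, get c x = get c y) -> x = y.
Proof.
intros H. destruct x as [a b c d e], y as [a' b' c' d' e'].
pose proof (H Cz); pose proof (H Cw); pose proof (H CY); pose proof (H CV);
  pose proof (H CE); cbn [get vz vw vY vV vE] in *; congruence.
Qed.

Definition vdist (x y : vec R) : R :=
  Rabs (vz x - vz y) + Rabs (vw x - vw y) + Rabs (vY x - vY y) + Rabs (vV x - vV y)
  + Rabs (vE x - vE y).

Lemma vdist_le x y e : (forall c, Rabs (get c x - get c y) <= e) -> vdist x y <= 5 * e.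
Proof.
intros H. unfold vdist.
pose proof (H Cz); pose proof (H Cw); pose proof (H CY); pose proof (H CV);
  pose proof (H CE); cbn [get vz vw vY vV vE] in *. lra.
Qed.

Definition vlipschitz (L : R) (Phi : vec R -> vec R) : Prop :=
  forall x y c, Rabs (get c (Phi x) - get c (Phi y)) <= L * vdist x y.

Lemma lipschitz_continuous (f : R -> R) (K : R) :
  (forall s t, Rabs (f s - f t) <= K * Rabs (s - t)) -> forall t, continuous f t.
Proof.
intros Hf t. apply continuity_pt_filterlim. intros e He.
assert (HK : 0 <= K).
{ specialize (Hf 1 0). rewrite Rminus_0_r, Rabs_R1 in Hf.
  pose proof (Rabs_pos (f 1 - f 0)). lra. }
exists (e / (K + 1)). split; [apply Rdiv_lt_0_compat; lra|].
intros s [_ Hs]. simpl in *. unfold R_dist in *.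
apply Rle_lt_trans with (1 := Hf s t).
apply Rle_lt_trans with ((K + 1) * Rabs (s - t)); [pose proof (Rabs_pos (s - t)); nra|].
apply Rmult_lt_reg_l with (/ (K + 1)); [apply Rinv_0_lt_compat; lra|].
rewrite <- Rmult_assoc, Rinv_l, Rmult_1_l by lra. unfold Rdiv in Hs. lra.
Qed.

Lemma is_derive_primitive (f : R -> R) (t : R) :
  (forall s, continuous f s) -> is_derive (fun t => RInt f 0 t) t (f t).
Proof.
intros Hf. apply (is_derive_RInt f (fun t => RInt f 0 t) 0); [|apply Hf].
exists (mkposreal 1 Rlt_0_1). intros y _. apply (RInt_correct (V := R_CompleteNormedModule) f 0 y).
apply (ex_RInt_continuous (V := R_CompleteNormedModule)). intros z _. apply Hf.
Qed.

Lemma derive_abs_bound (f df : R -> R) (B : R) :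
  (forall t, is_derive f t (df t)) -> (forall t, Rabs (df t) <= B) ->
  forall s t, Rabs (f s - f t) <= B * Rabs (s - t).
Proof.
intros Hf HB.
assert (H : forall s t, s <= t -> Rabs (f s - f t) <= B * Rabs (s - t)).
{ intros s t Hst.
  destruct (derive_bounds f df s t (- B) B Hst) as [H1 H2].
  - intros; apply Hf.
  - intros r _. apply Rabs_le_between, HB.
  - rewrite (Rabs_minus_sym s t), (Rabs_right (t - s)) by lra.
    rewrite Rabs_minus_sym. apply Rabs_le. lra. }
intros s t. destruct (Rle_lt_dec s t); [auto|].
rewrite Rabs_minus_sym, (Rabs_minus_sym s). apply H. lra.
Qed.

(** The weight [e^(l |t|)], as in Bielecki's norm, makes the Picard operator a contraction on the
    whole line, so that no local solutions have to be patched together. *)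
Lemma derive_exp_bound (f df : R -> R) (K l : R) :
  0 <= K -> 0 < l ->
  f 0 = 0 -> (forall t, is_derive f t (df t)) ->
  (forall t, Rabs (df t) <= K * l * exp (l * Rabs t)) ->
  forall t, Rabs (f t) <= K * exp (l * Rabs t).
Proof.
intros HK Hl H0 Hf Hdf.
assert (Hpos : forall (g dg : R -> R), g 0 = 0 -> (forall t, is_derive g t (dg t)) ->
  (forall t, Rabs (dg t) <= K * l * exp (l * Rabs t)) ->
  forall t, 0 <= t -> g t <= K * exp (l * t)).
{ intros g dg Hg0 Hg Hdg t Ht.
  (* Only the upper bound 0 of the derivative is used; the lower one is crude. *)
  destruct (derive_bounds (fun r => - K * exp (l * r) + g r)
    (fun r => - K * (l * exp (l * r)) + dg r) 0 t
    (- K * l * exp (l * t) - K * l * exp (l * t)) 0 Ht) as [_ H2].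
  - intros r _. specialize (Hg r). auto_derive; [exists (dg r); exact Hg|].
    replace (Derive _ r) with (dg r) by (symmetry; apply is_derive_unique; exact Hg). ring.
  - intros r Hr. specialize (Hdg r). rewrite (Rabs_right r) in Hdg by lra.
    apply Rabs_le_between in Hdg. split; [|lra].
    assert (exp (l * r) <= exp (l * t)).
    { apply Rlt_le, exp_increasing. nra. }
    assert (0 <= K * l) by nra. nra.
  - rewrite Hg0, Rmult_0_r, exp_0 in H2. lra. }
intros t. destruct (Rle_lt_dec 0 t) as [Ht|Ht].
- rewrite (Rabs_right t) by lra. apply Rabs_le. split; [|apply (Hpos f df); auto].
  apply Ropp_le_cancel. rewrite Ropp_involutive.
  apply (Hpos (fun r => - f r) (fun r => - df r)); [lra| | |exact Ht].
  + intros r. apply (is_derive_opp (V := R_NormedModule) f r (df r)), Hf.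
  + intros r. rewrite Rabs_Ropp. apply Hdf.
- rewrite (Rabs_left t Ht).
  assert (Hrev : forall r, is_derive (fun x => f (- x)) r (- df (- r))).
  { intros r. specialize (Hf (- r)). auto_derive; [exists (df (- r)); exact Hf|].
    replace (Derive _ (- r)) with (df (- r)) by (symmetry; apply is_derive_unique; exact Hf).
    ring. }
  apply Rabs_le. split.
  + apply Ropp_le_cancel. rewrite Ropp_involutive.
    replace (f t) with (f (- - t)) by (f_equal; ring).
    apply (Hpos (fun r => - f (- r)) (fun r => - - df (- r))); [|intros r|intros r|lra].
    * rewrite Ropp_0, H0. lra.
    * apply (is_derive_opp (V := R_NormedModule) (fun x => f (- x)) r (- df (- r))), Hrev.
    * rewrite Ropp_involutive. rewrite <- (Rabs_Ropp r). apply Hdf.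
  + replace (f t) with (f (- - t)) by (f_equal; ring).
    apply (Hpos (fun r => f (- r)) (fun r => - df (- r))); [|exact Hrev|intros r|lra].
    * rewrite Ropp_0, H0. reflexivity.
    * rewrite Rabs_Ropp. rewrite <- (Rabs_Ropp r). apply Hdf.
Qed.

(** * Global solutions by Picard iteration *)

Fixpoint picard (Phi : vec R -> vec R) (x0 : vec R) (n : nat) (t : R) : vec R :=
  match n with
  | O => x0
  | S n' => vbuild (fun c => get c x0 + RInt (fun s => get c (Phi (picard Phi x0 n' s))) 0 t)
  end.

Section Flow.

Variables (Phi : vec R -> vec R) (L B : R).
Hypothesis HL : 0 < L.
Hypothesis HB : 0 <= B.
Hypothesis Hlip : vlipschitz L Phi.
Hypothesis Hbnd : forall x c, Rabs (get c (Phi x)) <= B.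

Lemma continuous_along (u : R -> vec R) :
  (forall s t c, Rabs (get c (u s) - get c (u t)) <= B * Rabs (s - t)) ->
  forall c t, continuous (fun s => get c (Phi (u s))) t.
Proof.
intros Hu c. apply lipschitz_continuous with (L * (5 * B)). intros s t.
apply Rle_trans with (1 := Hlip _ _ c). rewrite Rmult_assoc.
apply Rmult_le_compat_l; [lra|]. rewrite Rmult_assoc. apply vdist_le. intros c'. apply Hu.
Qed.

Lemma integral_lipschitz (x0 : vec R) (u v : R -> vec R) :
  (forall s t c, Rabs (get c (u s) - get c (u t)) <= B * Rabs (s - t)) ->
  (forall t c, get c (v t) = get c x0 + RInt (fun s => get c (Phi (u s))) 0 t) ->
  (forall t c, is_derive (fun s => get c (v s)) t (get c (Phi (u t)))) /\
  (forall s t c, Rabs (get c (v s) - get c (v t)) <= B * Rabs (s - t)).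
Proof.
intros Hu Hv.
assert (Hd : forall t c, is_derive (fun s => get c (v s)) t (get c (Phi (u t)))).
{ intros t c. apply is_derive_ext with (fun t => get c x0 + RInt (fun s => get c (Phi (u s))) 0 t).
  { intros r. symmetry. apply Hv. }
  rewrite <- (Rplus_0_l (get c (Phi (u t)))).
  apply (is_derive_plus (V := R_NormedModule) (fun _ => get c x0));
    [exact (is_derive_const (V := R_NormedModule) (get c x0) t)|].
  apply is_derive_primitive. apply continuous_along, Hu. }
split; [exact Hd|]. intros s t c.
apply (derive_abs_bound (fun s => get c (v s)) (fun s => get c (Phi (u s)))).
- intros r. apply Hd.
- intros r. apply Hbnd.
Qed.

Variable x0 : vec R.

Lemma picard_S n t c :
  get c (picard Phi x0 (S n) t) = get c x0 + RInt (fun s => get c (Phi (picard Phi x0 n s))) 0 t.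
Proof. exact (get_vbuild (fun c => get c x0 + RInt (fun s => get c (Phi (picard Phi x0 n s))) 0 t) c). Qed.

Lemma picard_lipschitz n s t c :
  Rabs (get c (picard Phi x0 n s) - get c (picard Phi x0 n t)) <= B * Rabs (s - t).
Proof.
revert s t c. induction n as [|n IH].
- intros s t c. cbn [picard]. rewrite Rminus_diag, Rabs_R0.
  apply Rmult_le_pos; [exact HB|apply Rabs_pos].
- apply (integral_lipschitz x0 (picard Phi x0 n)); [exact IH|]. intros; apply picard_S.
Qed.

Lemma picard_derive n t c :
  is_derive (fun s => get c (picard Phi x0 (S n) s)) t (get c (Phi (picard Phi x0 n t))).
Proof.
apply (integral_lipschitz x0 (picard Phi x0 n)); [apply picard_lipschitz|].
intros; apply picard_S.
Qed.

(** As [vdist] sums five coordinates, the contraction factor is [5 L / l = 1/2]. [K] is chosen so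
    that the first increment, at most [B |t|], is below [K e^(l |t|)]. *)
Let l := 10 * L.
Let K := B / l.

Lemma l_pos : 0 < l. Proof. unfold l. lra. Qed.
Lemma K_pos : 0 <= K. Proof. apply Rmult_le_pos; [exact HB|]. left. apply Rinv_0_lt_compat, l_pos. Qed.

Lemma integral_contraction (u v U V : R -> vec R) (e : R) :
  0 <= e ->
  (forall t c, is_derive (fun s => get c (U s)) t (get c (Phi (u t)))) ->
  (forall t c, is_derive (fun s => get c (V s)) t (get c (Phi (v t)))) ->
  (forall c, get c (U 0) = get c (V 0)) ->
  (forall t c, Rabs (get c (u t) - get c (v t)) <= e * exp (l * Rabs t)) ->
  forall t c, Rabs (get c (U t) - get c (V t)) <= e / 2 * exp (l * Rabs t).
Proof.
intros He HU HV H0 Huv t c.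
apply (derive_exp_bound (fun t => get c (U t) - get c (V t))
  (fun t => get c (Phi (u t)) - get c (Phi (v t)))).
- lra.
- apply l_pos.
- rewrite H0. ring.
- intros r. apply (is_derive_minus (V := R_NormedModule) (fun s => get c (U s)) (fun s => get c (V s))); auto.
- intros r. apply Rle_trans with (1 := Hlip _ _ c).
  apply Rle_trans with (L * (5 * (e * exp (l * Rabs r)))).
  + apply Rmult_le_compat_l; [lra|]. apply vdist_le. intros c'. apply Huv.
  + right. unfold l. field.
Qed.

Lemma picard_step n t c :
  Rabs (get c (picard Phi x0 (S n) t) - get c (picard Phi x0 n t)) <=
  K * (/ 2) ^ n * exp (l * Rabs t).
Proof.
pose proof l_pos as Hl. pose proof K_pos as HK.
assert (Hz : forall n c, get c (picard Phi x0 n 0) = get c x0).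
{ intros [|k] c'; [reflexivity|]. rewrite picard_S, RInt_point. apply Rplus_0_r. }
revert t c. induction n as [|n IH]; intros t c.
- rewrite picard_S. replace (get c x0 + _ - _) with
    (get c x0 + RInt (fun s => get c (Phi (picard Phi x0 0 s))) 0 t - get c x0) by reflexivity.
  rewrite <- picard_S, <- (Hz 1%nat c).
  apply Rle_trans with (1 := picard_lipschitz 1 t 0 c).
  rewrite Rminus_0_r. simpl pow. rewrite Rmult_1_r.
  replace (B * Rabs t) with (K * (l * Rabs t)) by (unfold K; field; lra).
  apply Rmult_le_compat_l; [exact HK|].
  pose proof (exp_ineq1_le (l * Rabs t)). lra.
- replace (K * (/ 2) ^ S n) with (K * (/ 2) ^ n / 2) by (simpl pow; field).
  apply (integral_contraction (picard Phi x0 (S n)) (picard Phi x0 n)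
     (picard Phi x0 (S (S n))) (picard Phi x0 (S n))).
  + apply Rmult_le_pos; [exact HK|]. apply pow_le. lra.
  + intros; apply picard_derive.
  + intros; apply picard_derive.
  + intros c'. rewrite !Hz. reflexivity.
  + exact IH.
Qed.

Lemma picard_gap n k t c :
  Rabs (get c (picard Phi x0 (n + k) t) - get c (picard Phi x0 n t)) <=
  2 * K * (/ 2) ^ n * exp (l * Rabs t).
Proof.
pose proof K_pos as HK.
assert (He : 0 < exp (l * Rabs t)) by apply exp_pos.
(* The exact sum of the geometric series is what the induction on [k] can carry. *)
assert (H : Rabs (get c (picard Phi x0 (n + k) t) - get c (picard Phi x0 n t)) <=
  2 * K * ((/ 2) ^ n - (/ 2) ^ (n + k)) * exp (l * Rabs t)).
{ induction k as [|k IH].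
  - rewrite Nat.add_0_r, Rminus_diag, Rabs_R0. right. ring.
  - rewrite Nat.add_succ_r.
    replace (get c (picard Phi x0 (S (n + k)) t) - get c (picard Phi x0 n t)) with
     ((get c (picard Phi x0 (S (n + k)) t) - get c (picard Phi x0 (n + k) t)) +
      (get c (picard Phi x0 (n + k) t) - get c (picard Phi x0 n t))) by ring.
    apply Rle_trans with (1 := Rabs_triang _ _).
    pose proof (picard_step (n + k) t c). simpl pow. nra. }
apply Rle_trans with (1 := H). apply Rmult_le_compat_r; [lra|].
assert (0 < (/ 2) ^ (n + k)) by (apply pow_lt; lra). nra.
Qed.

Definition picard_limit (t : R) : vec R :=
  vbuild (fun c => real (Lim_seq (fun n => get c (picard Phi x0 n t)))).

Lemma geometric_vanishes (a : R) : is_lim_seq (fun n => a * (/ 2) ^ n) 0.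
Proof.
replace (Finite 0) with (Rbar_mult a 0) by (simpl; f_equal; ring).
apply is_lim_seq_scal_l, is_lim_seq_geom. rewrite Rabs_right; lra.
Qed.

Lemma picard_converges t c :
  is_lim_seq (fun n => get c (picard Phi x0 n t)) (get c (picard_limit t)).
Proof.
unfold picard_limit. rewrite get_vbuild. apply Lim_seq_correct'.
apply ex_lim_seq_cauchy_corr. intros e.
pose proof (geometric_vanishes (4 * K * exp (l * Rabs t))) as Hg.
apply is_lim_seq_spec in Hg. destruct (Hg e) as [N HN].
exists N. intros n k Hn Hk. specialize (HN N (Nat.le_refl N)).
rewrite Rminus_0_r in HN. apply Rle_lt_trans with (2 := Rle_lt_trans _ _ _ (Rle_abs _) HN).
replace n with (N + (n - N))%nat by lia. replace k with (N + (k - N))%nat by lia.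
pose proof (picard_gap N (n - N) t c). pose proof (picard_gap N (k - N) t c).
replace (get c (picard Phi x0 (N + (n - N)) t) - get c (picard Phi x0 (N + (k - N)) t)) with
 ((get c (picard Phi x0 (N + (n - N)) t) - get c (picard Phi x0 N t)) -
  (get c (picard Phi x0 (N + (k - N)) t) - get c (picard Phi x0 N t))) by ring.
apply Rle_trans with (1 := Rabs_triang _ _). rewrite Rabs_Ropp. lra.
Qed.

Lemma picard_limit_gap n t c :
  Rabs (get c (picard_limit t) - get c (picard Phi x0 n t)) <=
  2 * K * (/ 2) ^ n * exp (l * Rabs t).
Proof.
apply (is_lim_seq_le (fun k => Rabs (get c (picard Phi x0 (k + n) t) - get c (picard Phi x0 n t)))
  (fun _ => 2 * K * (/ 2) ^ n * exp (l * Rabs t))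
  (Rabs (get c (picard_limit t) - get c (picard Phi x0 n t)))
  (2 * K * (/ 2) ^ n * exp (l * Rabs t))).
- intros k. rewrite Nat.add_comm. apply picard_gap.
- apply (is_lim_seq_abs _ (get c (picard_limit t) - get c (picard Phi x0 n t))).
  apply is_lim_seq_minus'; [|apply is_lim_seq_const].
  apply (is_lim_seq_incr_n (fun k => get c (picard Phi x0 k t)) n), picard_converges.
- apply is_lim_seq_const.
Qed.

Lemma picard_limit_lipschitz s t c :
  Rabs (get c (picard_limit s) - get c (picard_limit t)) <= B * Rabs (s - t).
Proof.
apply (is_lim_seq_le (fun n => Rabs (get c (picard Phi x0 n s) - get c (picard Phi x0 n t)))
  (fun _ => B * Rabs (s - t)) (Rabs (get c (picard_limit s) - get c (picard_limit t)))
  (B * Rabs (s - t))).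
- intros n. apply picard_lipschitz.
- apply (is_lim_seq_abs _ (get c (picard_limit s) - get c (picard_limit t))).
  apply is_lim_seq_minus'; apply picard_converges.
- apply is_lim_seq_const.
Qed.

(** [J] is the Picard operator applied to the limit. By contraction the shifted iterates converge to
    [J], and they also converge to the limit itself. *)
Lemma picard_limit_integral t c :
  get c (picard_limit t) = get c x0 + RInt (fun s => get c (Phi (picard_limit s))) 0 t.
Proof.
set (J := fun t => vbuild (fun c => get c x0 + RInt (fun s => get c (Phi (picard_limit s))) 0 t)).
assert (HJ : forall t c, get c (J t) = get c x0 + RInt (fun s => get c (Phi (picard_limit s))) 0 t).
{ intros r c'. exact (get_vbuild (fun c => get c x0 + RInt (fun s => get c (Phi (picard_limit s))) 0 r) c'). }
rewrite <- HJ.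
destruct (integral_lipschitz x0 picard_limit J picard_limit_lipschitz HJ) as [HdJ _].
assert (Hgap : forall n, Rabs (get c (picard Phi x0 (S n) t) - get c (J t)) <=
   K * exp (l * Rabs t) * (/ 2) ^ n).
{ intros n. replace (K * exp (l * Rabs t) * (/ 2) ^ n) with
    (2 * K * (/ 2) ^ n / 2 * exp (l * Rabs t)) by field.
  apply (integral_contraction (picard Phi x0 n) picard_limit (picard Phi x0 (S n)) J).
  - apply Rmult_le_pos; [pose proof K_pos; lra|]. apply pow_le. lra.
  - intros; apply picard_derive.
  - exact HdJ.
  - intros c'. rewrite HJ, picard_S, !RInt_point. reflexivity.
  - intros r c'. rewrite Rabs_minus_sym. apply picard_limit_gap. }
assert (H1 : is_lim_seq (fun n => get c (picard Phi x0 (S n) t) - get c (J t)) 0).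
{ apply is_lim_seq_abs_0.
  apply is_lim_seq_le_le with (fun _ => 0) (fun n => K * exp (l * Rabs t) * (/ 2) ^ n).
  - intros n. split; [apply Rabs_pos|apply Hgap].
  - apply is_lim_seq_const.
  - apply geometric_vanishes. }
assert (H2 : is_lim_seq (fun n => get c (picard Phi x0 (S n) t) - get c (J t))
  (get c (picard_limit t) - get c (J t))).
{ apply is_lim_seq_minus'; [|apply is_lim_seq_const].
  apply (is_lim_seq_incr_1 (fun n => get c (picard Phi x0 n t))), picard_converges. }
apply is_lim_seq_unique in H1. apply is_lim_seq_unique in H2.
rewrite H1 in H2. injection H2 as H2. lra.
Qed.

End Flow.

Lemma picard_limit_follows (Phi : vec R -> vec R) (L B : R) (x0 : vec R) :
  0 < L -> 0 <= B -> vlipschitz L Phi -> (forall x c, Rabs (get c (Phi x)) <= B) ->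
  picard_limit Phi x0 0 = x0 /\ follows Phi (picard_limit Phi x0).
Proof.
intros HL HB Hlip Hbnd.
assert (Hint := picard_limit_integral Phi L B HL HB Hlip Hbnd x0).
split.
- apply vec_ext. intros c. rewrite Hint, RInt_point. apply Rplus_0_r.
- assert (Hu : forall s t c, Rabs (get c (picard_limit Phi x0 s) - get c (picard_limit Phi x0 t))
    <= B * Rabs (s - t)).
  { intros s t c. apply (picard_limit_lipschitz Phi L B); assumption. }
  assert (H := integral_lipschitz Phi L B). 
  edestruct H as [H1 _]; [.. | exact H1]; eassumption.
Qed.

(** * Uniqueness and dependence on the initial state *)

Definition vdist2 (x y : vec R) : R :=
  (vz x - vz y) ^ 2 + (vw x - vw y) ^ 2 + (vY x - vY y) ^ 2 + (vV x - vV y) ^ 2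
  + (vE x - vE y) ^ 2.

(** [f t * e^(-k t)] does not increase for positive [t], and [f t * e^(k t)] does not decrease for
    negative [t]. *)
Lemma gronwall (f df : R -> R) (k : R) :
  (forall t, is_derive f t (df t)) -> (forall t, Rabs (df t) <= k * f t) ->
  forall t, f t <= f 0 * exp (k * Rabs t).
Proof.
intros Hf Hdf t.
assert (Hd : forall a t, is_derive (fun t => f t * exp (a * t)) t
   ((df t + a * f t) * exp (a * t))).
{ intros a r. specialize (Hf r). auto_derive; [exists (df r); exact Hf|].
  replace (Derive _ r) with (df r) by (symmetry; apply is_derive_unique; exact Hf). ring. }
assert (He : forall x, exp x * exp (- x) = 1).
{ intros x. rewrite <- exp_plus, Rplus_opp_r. apply exp_0. }
destruct (Rle_lt_dec 0 t) as [Ht|Ht].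
- rewrite (Rabs_right t) by lra.
  destruct (Req_dec t 0) as [->|Hne]; [rewrite Rmult_0_r, exp_0; lra|].
  destruct (MVT_cor2 (fun t => f t * exp (- k * t)) (fun t => (df t + - k * f t) * exp (- k * t)) 0 t)
    as [c [Hc _]]; [lra| |].
  { intros c _. apply is_derive_Reals, Hd. }
  specialize (Hdf c). apply Rabs_le_between in Hdf.
  assert (0 < exp (- k * c)) by apply exp_pos.
  assert (H1 : f t * exp (- k * t) <= f 0).
  { rewrite Rmult_0_r, exp_0 in Hc.
    assert ((df c + - k * f c) * exp (- k * c) * (t - 0) <= 0); [|lra].
    assert ((df c + - k * f c) * exp (- k * c) <= 0) by nra. nra. }
  assert (0 < exp (k * t)) by apply exp_pos. specialize (He (k * t)).
  replace (- (k * t)) with (- k * t) in He by ring.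
  replace (f t) with (f t * exp (- k * t) * exp (k * t)) by (rewrite Rmult_assoc, (Rmult_comm (exp (- k * t))), He; ring).
  apply Rmult_le_compat_r; lra.
- rewrite (Rabs_left t) by lra.
  destruct (MVT_cor2 (fun t => f t * exp (k * t)) (fun t => (df t + k * f t) * exp (k * t)) t 0)
    as [c [Hc _]]; [lra| |].
  { intros c _. apply is_derive_Reals, Hd. }
  specialize (Hdf c). apply Rabs_le_between in Hdf.
  assert (0 < exp (k * c)) by apply exp_pos.
  assert (H1 : f t * exp (k * t) <= f 0).
  { rewrite Rmult_0_r, exp_0 in Hc.
    assert (0 <= (df c + k * f c) * exp (k * c) * (0 - t)); [|lra].
    assert (0 <= (df c + k * f c) * exp (k * c)) by nra. nra. }
  assert (0 < exp (k * - t)) by apply exp_pos. specialize (He (k * t)).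
  replace (- (k * t)) with (k * - t) in He by ring.
  replace (f t) with (f t * exp (k * t) * exp (k * - t)) by (rewrite Rmult_assoc, He; ring).
  apply Rmult_le_compat_r; lra.
Qed.

(** The squared Euclidean distance is used because it is differentiable; Cauchy-Schwarz over five
    coordinates turns [2 L vdist^2] into [10 L vdist2]. *)
Lemma flow_dependence (Phi : vec R -> vec R) (L : R) (u v : R -> vec R) :
  0 < L -> vlipschitz L Phi -> follows Phi u -> follows Phi v ->
  forall t, vdist2 (u t) (v t) <= vdist2 (u 0) (v 0) * exp (10 * L * Rabs t).
Proof.
intros HL Hlip Hu Hv.
pose (d := fun c t => get c (u t) - get c (v t)).
pose (g := fun c t => get c (Phi (u t)) - get c (Phi (v t))).
assert (Hd : forall c t, is_derive (d c) t (g c t)).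
{ intros c t. apply (is_derive_minus (V := R_NormedModule) (fun s => get c (u s)) (fun s => get c (v s))); auto. }
apply (gronwall (fun t => vdist2 (u t) (v t))
  (fun t => 2 * (d Cz t * g Cz t + d Cw t * g Cw t + d CY t * g CY t + d CV t * g CV t
     + d CE t * g CE t))).
- intros t. change (is_derive (fun t => d Cz t ^ 2 + d Cw t ^ 2 + d CY t ^ 2 + d CV t ^ 2
     + d CE t ^ 2) t (2 * (d Cz t * g Cz t + d Cw t * g Cw t + d CY t * g CY t + d CV t * g CV t
     + d CE t * g CE t))).
  pose proof (Hd Cz t) as H1. pose proof (Hd Cw t) as H2. pose proof (Hd CY t) as H3.
  pose proof (Hd CV t) as H4. pose proof (Hd CE t) as H5.
  set (d1 := d Cz) in *. set (d2 := d Cw) in *. set (d3 := d CY) in *.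
  set (d4 := d CV) in *. set (d5 := d CE) in *. clearbody d1 d2 d3 d4 d5.
  auto_derive; [repeat split; eexists; eassumption|].
  replace (Derive (fun x => d1 x) t) with (g Cz t) by (symmetry; apply is_derive_unique; exact H1).
  replace (Derive (fun x => d2 x) t) with (g Cw t) by (symmetry; apply is_derive_unique; exact H2).
  replace (Derive (fun x => d3 x) t) with (g CY t) by (symmetry; apply is_derive_unique; exact H3).
  replace (Derive (fun x => d4 x) t) with (g CV t) by (symmetry; apply is_derive_unique; exact H4).
  replace (Derive (fun x => d5 x) t) with (g CE t) by (symmetry; apply is_derive_unique; exact H5).
  ring.
- intros t.
  assert (Hg : forall c, Rabs (d c t * g c t) <= Rabs (d c t) * (L * vdist (u t) (v t))).
  { intros c. rewrite Rabs_mult. apply Rmult_le_compat_l; [apply Rabs_pos|]. apply Hlip. }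
  pose proof (Hg Cz) as H1. pose proof (Hg Cw) as H2. pose proof (Hg CY) as H3.
  pose proof (Hg CV) as H4. pose proof (Hg CE) as H5.
  assert (Hsum : Rabs (d Cz t * g Cz t + d Cw t * g Cw t + d CY t * g CY t + d CV t * g CV t
     + d CE t * g CE t) <= L * (vdist (u t) (v t) * vdist (u t) (v t))).
  { assert (Hv' : vdist (u t) (v t) = Rabs (d Cz t) + Rabs (d Cw t) + Rabs (d CY t)
       + Rabs (d CV t) + Rabs (d CE t)) by reflexivity.
    repeat (apply Rle_trans with (1 := Rabs_triang _ _)).
    pose proof (Rabs_triang (d Cz t * g Cz t + d Cw t * g Cw t + d CY t * g CY t) (d CV t * g CV t)).
    pose proof (Rabs_triang (d Cz t * g Cz t + d Cw t * g Cw t) (d CY t * g CY t)).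
    pose proof (Rabs_triang (d Cz t * g Cz t) (d Cw t * g Cw t)).
    replace (L * (vdist (u t) (v t) * vdist (u t) (v t))) with
      ((Rabs (d Cz t) + Rabs (d Cw t) + Rabs (d CY t) + Rabs (d CV t) + Rabs (d CE t))
       * (L * vdist (u t) (v t))) by (rewrite Hv'; ring).
    lra. }
  assert (Hcs : vdist (u t) (v t) * vdist (u t) (v t) <= 5 * vdist2 (u t) (v t)).
  { unfold vdist, vdist2.
    rewrite <- (pow2_abs (vz (u t) - vz (v t))), <- (pow2_abs (vw (u t) - vw (v t))),
     <- (pow2_abs (vY (u t) - vY (v t))), <- (pow2_abs (vV (u t) - vV (v t))),
     <- (pow2_abs (vE (u t) - vE (v t))).
    generalize (Rabs (vz (u t) - vz (v t))) (Rabs (vw (u t) - vw (v t)))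
      (Rabs (vY (u t) - vY (v t))) (Rabs (vV (u t) - vV (v t))) (Rabs (vE (u t) - vE (v t))).
    intros a b c e f.
    assert (0 <= (a-b)^2 + (a-c)^2 + (a-e)^2 + (a-f)^2 + (b-c)^2 + (b-e)^2 + (b-f)^2
      + (c-e)^2 + (c-f)^2 + (e-f)^2) by (repeat apply Rplus_le_le_0_compat; apply pow2_ge_0).
    nra. }
  rewrite Rabs_mult, (Rabs_right 2) by lra. nra.
Qed.

Lemma flow_unique (Phi : vec R -> vec R) (L : R) (u v : R -> vec R) :
  0 < L -> vlipschitz L Phi -> follows Phi u -> follows Phi v -> u 0 = v 0 ->
  forall t, u t = v t.
Proof.
intros HL Hlip Hu Hv H0 t.
pose proof (flow_dependence Phi L u v HL Hlip Hu Hv t) as H.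
rewrite H0 in H.
replace (vdist2 (v 0) (v 0)) with 0 in H by (unfold vdist2; ring).
rewrite Rmult_0_l in H. unfold vdist2 in H.
pose proof (pow2_ge_0 (vz (u t) - vz (v t))). pose proof (pow2_ge_0 (vw (u t) - vw (v t))).
pose proof (pow2_ge_0 (vY (u t) - vY (v t))). pose proof (pow2_ge_0 (vV (u t) - vV (v t))).
pose proof (pow2_ge_0 (vE (u t) - vE (v t))).
assert (Hsq : forall a b, (a - b) ^ 2 <= 0 -> a = b).
{ intros a b Hab. assert (a - b = 0); [|lra]. pose proof (pow2_ge_0 (a - b)).
  destruct (Req_dec (a - b) 0) as [|Hne]; [assumption|]. pose proof (pow2_gt_0 _ Hne). lra. }
apply vec_ext. intros c; destruct c; apply Hsq; cbn [get]; lra.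
Qed.

(** * Cutting the field off to a bounded Lipschitz one *)

Definition clamp (K x : R) : R := Rmax (- K) (Rmin K x).

Lemma clamp_id K x : Rabs x <= K -> clamp K x = x.
Proof.
intros H. apply Rabs_le_between in H. unfold clamp, Rmax, Rmin.
destruct (Rle_dec K x); destruct Rle_dec; lra.
Qed.

Lemma clamp_bound K x : 0 <= K -> Rabs (clamp K x) <= K.
Proof.
intros H. apply Rabs_le. unfold clamp, Rmax, Rmin.
destruct (Rle_dec K x); destruct Rle_dec; lra.
Qed.

Lemma clamp_opp K x : 0 <= K -> clamp K (- x) = - clamp K x.
Proof.
intros H. unfold clamp, Rmax, Rmin.
destruct (Rle_dec K x); destruct (Rle_dec K (- x)); repeat destruct Rle_dec; lra.
Qed.

Lemma clamp_lipschitz K x y : 0 <= K -> Rabs (clamp K x - clamp K y) <= Rabs (x - y).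
Proof.
intros H. unfold clamp, Rmax, Rmin.
destruct (Rle_dec K x); destruct (Rle_dec K y); repeat destruct Rle_dec;
  unfold Rabs; repeat destruct Rcase_abs; lra.
Qed.

Definition vclamp (K : R) (x : vec R) : vec R :=
  Vec (clamp K (vz x)) (clamp K (vw x)) (clamp K (vY x)) (clamp K (vV x)) (clamp K (vE x)).

Definition field_g (m g : R) (x : vec R) : vec R :=
  Vec (vw x / 2)
      (2 * vz x * vE x - m * vz x ^ 5 * g)
      (vz x ^ 2 * vV x)
      (- ((2 + m) * vz x ^ 2 * vY x * g))
      (- (m / 2 * vz x ^ 3 * vw x * g)).

(** The clamp bounds the polynomial factors, and the floor [d] keeps [rho2] away from 0, its value
    at triple collision. The clamp being odd, both symmetries of [field] survive. *)
Definition cut_field (m K d : R) (x : vec R) : vec R :=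
  field_g m (irho3 (Rmax d (rho2 (vclamp K x)))) (vclamp K x).

Definition in_region (K d : R) (x : vec R) : Prop :=
  (forall c, Rabs (get c x) <= K) /\ d <= rho2 x.

Lemma cut_field_eq m K d x : in_region K d x -> cut_field m K d x = field m x.
Proof.
intros [H Hd]. unfold cut_field.
assert (Hx : vclamp K x = x).
{ apply vec_ext. intros c.
  destruct c; cbn [get vclamp vz vw vY vV vE]; apply clamp_id;
  [apply (H Cz)|apply (H Cw)|apply (H CY)|apply (H CV)|apply (H CE)]. }
rewrite Hx, Rmax_right by exact Hd. reflexivity.
Qed.

Lemma cut_field_agrees m K d : 16 <= K -> d <= / 256 -> agrees m (cut_field m K d).
Proof.
intros HK Hd x H Hr. apply cut_field_eq. split.
- intros c. pose proof (H c). lra.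
- lra.
Qed.

(** Boundedness is included so that the class is closed under products. *)
Definition tame (f : vec R -> R) : Prop :=
  exists M L, 0 <= M /\ 0 <= L /\ (forall x, Rabs (f x) <= M) /\
    forall x y, Rabs (f x - f y) <= L * vdist x y.

Lemma vdist_pos x y : 0 <= vdist x y.
Proof. unfold vdist. repeat apply Rplus_le_le_0_compat; apply Rabs_pos. Qed.

Lemma tame_const a : tame (fun _ => a).
Proof.
exists (Rabs a), 0. split; [apply Rabs_pos|]. split; [lra|]. split; [intros; lra|].
intros x y. rewrite Rminus_diag, Rabs_R0. lra.
Qed.

Lemma tame_clamp K c : 0 <= K -> tame (fun x => clamp K (get c x)).
Proof.
intros HK. exists K, 1. split; [exact HK|]. split; [lra|]. split.
- intros x. apply clamp_bound, HK.
- intros x y. apply Rle_trans with (1 := clamp_lipschitz K _ _ HK).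
  rewrite Rmult_1_l. unfold vdist.
  pose proof (Rabs_pos (vz x - vz y)). pose proof (Rabs_pos (vw x - vw y)).
  pose proof (Rabs_pos (vY x - vY y)). pose proof (Rabs_pos (vV x - vV y)).
  pose proof (Rabs_pos (vE x - vE y)).
  destruct c; cbn [get]; lra.
Qed.

Lemma tame_plus f g : tame f -> tame g -> tame (fun x => f x + g x).
Proof.
intros [M [L [HM [HL [H1 H2]]]]] [M' [L' [HM' [HL' [H1' H2']]]]].
exists (M + M'), (L + L'). split; [lra|]. split; [lra|]. split.
- intros x. apply Rle_trans with (1 := Rabs_triang _ _). apply Rplus_le_compat; auto.
- intros x y. replace (f x + g x - (f y + g y)) with ((f x - f y) + (g x - g y)) by ring.
  apply Rle_trans with (1 := Rabs_triang _ _). rewrite Rmult_plus_distr_r.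
  apply Rplus_le_compat; auto.
Qed.

Lemma tame_opp f : tame f -> tame (fun x => - f x).
Proof.
intros [M [L [HM [HL [H1 H2]]]]]. exists M, L. split; [exact HM|]. split; [exact HL|]. split.
- intros x. rewrite Rabs_Ropp. apply H1.
- intros x y. replace (- f x - - f y) with (- (f x - f y)) by ring. rewrite Rabs_Ropp. apply H2.
Qed.

Lemma tame_mult f g : tame f -> tame g -> tame (fun x => f x * g x).
Proof.
intros [M [L [HM [HL [H1 H2]]]]] [M' [L' [HM' [HL' [H1' H2']]]]].
exists (M * M'), (M * L' + M' * L). split; [nra|]. split; [nra|]. split.
- intros x. rewrite Rabs_mult. apply Rmult_le_compat; auto; apply Rabs_pos.
- intros x y. replace (f x * g x - f y * g y) with (f x * (g x - g y) + g y * (f x - f y)) by ring.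
  apply Rle_trans with (1 := Rabs_triang _ _). rewrite !Rabs_mult.
  rewrite Rmult_plus_distr_r, !Rmult_assoc.
  apply Rplus_le_compat; apply Rmult_le_compat; auto; apply Rabs_pos.
Qed.

Lemma tame_pow f n : tame f -> tame (fun x => f x ^ n).
Proof.
intros Hf. induction n as [|n IH]; [exact (tame_const 1)|].
apply (tame_mult f (fun x => f x ^ n)); assumption.
Qed.

Lemma irho3_pos r : 0 < r -> 0 < irho3 r.
Proof.
intros H. unfold irho3. apply Rinv_0_lt_compat, Rmult_lt_0_compat; [exact H|].
apply sqrt_lt_R0, H.
Qed.

Lemma irho3_decr a b : 0 < a -> a <= b -> irho3 b <= irho3 a.
Proof.
intros Ha Hab. unfold irho3. apply Rinv_le_contravar.
- apply Rmult_lt_0_compat; [exact Ha|apply sqrt_lt_R0, Ha].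
- apply Rmult_le_compat; [lra|apply sqrt_pos|exact Hab|apply sqrt_le_1; lra].
Qed.

Lemma irho3_lipschitz d a b : 0 < d -> d <= a -> d <= b ->
  Rabs (irho3 a - irho3 b) <= 3 / 2 * (irho3 d * / d) * Rabs (a - b).
Proof.
intros Hd.
assert (H : forall a b, d <= a -> a <= b ->
   Rabs (irho3 a - irho3 b) <= 3 / 2 * (irho3 d * / d) * Rabs (a - b)).
{ intros x y Hx Hxy.
  destruct (derive_bounds irho3 (fun r => - (3 / 2 * (irho3 r * / r * 1))) x y
    (- (3 / 2 * (irho3 d * / d))) 0 Hxy) as [H1 H2].
  - intros t Ht. apply (is_derive_irho3 (fun r => r)); [lra|exact (is_derive_id (K := R_AbsRing) t)].
  - intros t Ht.
    assert (0 < irho3 t) by (apply irho3_pos; lra).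
    assert (irho3 t <= irho3 d) by (apply irho3_decr; lra).
    assert (0 < / t) by (apply Rinv_0_lt_compat; lra).
    assert (/ t <= / d) by (apply Rinv_le_contravar; lra).
    assert (irho3 t * / t <= irho3 d * / d) by (apply Rmult_le_compat; lra).
    assert (0 < irho3 t * / t) by (apply Rmult_lt_0_compat; lra).
    lra.
  - rewrite (Rabs_minus_sym x y), (Rabs_right (y - x)) by lra.
    rewrite Rabs_minus_sym. apply Rabs_le. lra. }
intros Ha Hb. destruct (Rle_lt_dec a b); [auto|].
rewrite Rabs_minus_sym, (Rabs_minus_sym a). apply H; lra.
Qed.

Lemma tame_irho3 d f : 0 < d -> tame f -> tame (fun x => irho3 (Rmax d (f x))).
Proof.
intros Hd [M [L [HM [HL [H1 H2]]]]].
assert (Hi : 0 < irho3 d) by (apply irho3_pos, Hd).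
assert (Hid : 0 < irho3 d * / d) by (apply Rmult_lt_0_compat; [exact Hi|apply Rinv_0_lt_compat, Hd]).
exists (irho3 d), (3 / 2 * (irho3 d * / d) * L). split; [lra|]. split; [nra|]. split.
- intros x. rewrite Rabs_right.
  + apply irho3_decr; [exact Hd|apply Rmax_l].
  + apply Rle_ge, Rlt_le, irho3_pos. apply Rlt_le_trans with (1 := Hd), Rmax_l.
- intros x y.
  apply Rle_trans with (1 := irho3_lipschitz d _ _ Hd (Rmax_l _ _) (Rmax_l _ _)).
  rewrite (Rmult_assoc _ L). apply Rmult_le_compat_l; [lra|].
  apply Rle_trans with (2 := H2 x y).
  unfold Rmax. repeat destruct Rle_dec; unfold Rabs; repeat destruct Rcase_abs; lra.
Qed.

Lemma cut_field_tame m K d c : 0 <= K -> 0 < d -> tame (fun x => get c (cut_field m K d x)).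
Proof.
intros HK Hd.
pose proof (tame_clamp K Cz HK) as Tz. pose proof (tame_clamp K Cw HK) as Tw.
pose proof (tame_clamp K CY HK) as TY. pose proof (tame_clamp K CV HK) as TV.
pose proof (tame_clamp K CE HK) as TE. cbn [get] in *.
assert (Tg : tame (fun x => irho3 (Rmax d (rho2 (vclamp K x))))).
{ apply tame_irho3; [exact Hd|].
  apply (tame_plus (fun x => clamp K (vY x) ^ 2) (fun x => clamp K (vz x) ^ 4 / 4)).
  - apply (tame_pow _ 2), TY.
  - apply (tame_mult (fun x => clamp K (vz x) ^ 4)); [apply (tame_pow _ 4), Tz|apply tame_const]. }
unfold cut_field.
set (g := fun x => irho3 (Rmax d (rho2 (vclamp K x)))) in *.
destruct c; cbn [get field_g vclamp vz vw vY vV vE].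
- apply (tame_mult (fun x => clamp K (vw x))); [exact Tw|apply tame_const].
- apply (tame_plus (fun x => 2 * clamp K (vz x) * clamp K (vE x))
    (fun x => - (m * clamp K (vz x) ^ 5 * g x))).
  + apply (tame_mult (fun x => 2 * clamp K (vz x))); [|exact TE].
    apply (tame_mult (fun _ => 2)); [apply tame_const|exact Tz].
  + apply tame_opp. apply (tame_mult (fun x => m * clamp K (vz x) ^ 5)); [|exact Tg].
    apply (tame_mult (fun _ => m)); [apply tame_const|apply (tame_pow _ 5), Tz].
- apply (tame_mult (fun x => clamp K (vz x) ^ 2)); [apply (tame_pow _ 2), Tz|exact TV].
- apply tame_opp. apply (tame_mult (fun x => (2 + m) * clamp K (vz x) ^ 2 * clamp K (vY x))); [|exact Tg].
  apply (tame_mult (fun x => (2 + m) * clamp K (vz x) ^ 2)); [|exact TY].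
  apply (tame_mult (fun _ => 2 + m)); [apply tame_const|apply (tame_pow _ 2), Tz].
- apply tame_opp. apply (tame_mult (fun x => m / 2 * clamp K (vz x) ^ 3 * clamp K (vw x))); [|exact Tg].
  apply (tame_mult (fun x => m / 2 * clamp K (vz x) ^ 3)); [|exact Tw].
  apply (tame_mult (fun _ => m / 2)); [apply tame_const|apply (tame_pow _ 3), Tz].
Qed.

Lemma cut_field_lipschitz m K d : 0 <= K -> 0 < d ->
  exists L B, 0 < L /\ 0 <= B /\ vlipschitz L (cut_field m K d) /\
    forall x c, Rabs (get c (cut_field m K d x)) <= B.
Proof.
intros HK Hd.
destruct (cut_field_tame m K d Cz HK Hd) as [M1 [L1 [HM1 [HL1 [H1 H1']]]]].
destruct (cut_field_tame m K d Cw HK Hd) as [M2 [L2 [HM2 [HL2 [H2 H2']]]]].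
destruct (cut_field_tame m K d CY HK Hd) as [M3 [L3 [HM3 [HL3 [H3 H3']]]]].
destruct (cut_field_tame m K d CV HK Hd) as [M4 [L4 [HM4 [HL4 [H4 H4']]]]].
destruct (cut_field_tame m K d CE HK Hd) as [M5 [L5 [HM5 [HL5 [H5 H5']]]]].
exists (L1 + L2 + L3 + L4 + L5 + 1), (M1 + M2 + M3 + M4 + M5).
split; [lra|]. split; [lra|]. split.
- intros x y c. pose proof (vdist_pos x y) as Hv.
  destruct c; [eapply Rle_trans; [apply H1'|]|eapply Rle_trans; [apply H2'|]|
   eapply Rle_trans; [apply H3'|]|eapply Rle_trans; [apply H4'|]|eapply Rle_trans; [apply H5'|]];
   apply Rmult_le_compat_r; lra.
- intros x c.
  destruct c; [eapply Rle_trans; [apply H1|]|eapply Rle_trans; [apply H2|]|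
   eapply Rle_trans; [apply H3|]|eapply Rle_trans; [apply H4|]|eapply Rle_trans; [apply H5|]]; lra.
Qed.

(** * Time reversal and reflection of body 3 *)

Definition reverse (x : vec R) : vec R := Vec (vz x) (- vw x) (vY x) (- vV x) (vE x).
Definition flip (x : vec R) : vec R := Vec (vz x) (vw x) (- vY x) (- vV x) (vE x).

Lemma cut_field_reverse m K d x c : 0 <= K ->
  get c (cut_field m K d (reverse x)) = - get c (reverse (cut_field m K d x)).
Proof.
intros HK. unfold cut_field, rho2, reverse.
destruct c; cbn [get field_g vclamp vz vw vY vV vE]; rewrite ?clamp_opp by exact HK; field.
Qed.

Lemma cut_field_flip m K d x : 0 <= K ->
  cut_field m K d (flip x) = flip (cut_field m K d x).
Proof.
intros HK. unfold cut_field, rho2, flip; cbn [vclamp vz vw vY vV vE].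
rewrite !clamp_opp by exact HK.
replace ((- clamp K (vY x)) ^ 2) with (clamp K (vY x) ^ 2) by ring.
apply vec_ext. intros c; destruct c; cbn [get field_g vclamp vz vw vY vV vE]; rewrite ?clamp_opp by exact HK; ring.
Qed.

Lemma follows_flip m K d u : 0 <= K ->
  follows (cut_field m K d) u -> follows (cut_field m K d) (fun s => flip (u s)).
Proof.
intros HK Hu t c. rewrite cut_field_flip by exact HK.
destruct c; [apply (Hu t Cz)|apply (Hu t Cw)| | |apply (Hu t CE)].
- apply (is_derive_opp (V := R_NormedModule) (fun s => vY (u s))), (Hu t CY).
- apply (is_derive_opp (V := R_NormedModule) (fun s => vV (u s))), (Hu t CV).
Qed.

Lemma is_derive_reflect (f : R -> R) (a t l : R) :
  is_derive f (a - t) l -> is_derive (fun s => f (a - s)) t (- l).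
Proof.
intros Hf. auto_derive; [exists l; exact Hf|].
replace (Derive _ _) with l by (symmetry; apply is_derive_unique; exact Hf). ring.
Qed.

(** Reversal about the instant [a / 2]. It is applied with [a = 0], the brake instant, and with
    [a = 2 S], where [S] is the orthogonal syzygy. *)
Lemma follows_reverse m K d u a : 0 <= K ->
  follows (cut_field m K d) u ->
  follows (cut_field m K d) (fun s => reverse (u (a - s))).
Proof.
intros HK Hu t c. rewrite cut_field_reverse by exact HK.
destruct c.
- apply (is_derive_reflect (fun s => vz (u s))), (Hu (a - t) Cz).
- apply (is_derive_opp (V := R_NormedModule) (fun s => vw (u (a - s)))).
  apply (is_derive_reflect (fun s => vw (u s))), (Hu (a - t) Cw).
- apply (is_derive_reflect (fun s => vY (u s))), (Hu (a - t) CY).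
- apply (is_derive_opp (V := R_NormedModule) (fun s => vV (u (a - s)))).
  apply (is_derive_reflect (fun s => vV (u s))), (Hu (a - t) CV).
- apply (is_derive_reflect (fun s => vE (u s))), (Hu (a - t) CE).
Qed.

(** * A priori estimates up to the first turning point or syzygy *)

(** About the true field and a finite time only: the estimates must not mention the cut that they
    are to justify. *)
Definition follows_on (m : R) (u : R -> vec R) (T : R) : Prop :=
  forall t, 0 <= t <= T -> 0 < rho2 (u t) /\
    forall c, is_derive (fun s => get c (u s)) t (get c (field m (u t))).

Lemma derive_le (f df : R -> R) (a b : R) :
  a <= b -> (forall t, a <= t <= b -> is_derive f t (df t)) ->
  (forall t, a < t < b -> 0 <= df t) -> f a <= f b.
Proof.
intros Hab Hf Hdf. destruct (Req_dec a b) as [<-|Hne]; [lra|].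
destruct (MVT_cor2 f df a b) as [c [Hc1 Hc2]]; [lra| |].
{ intros c Hc. apply is_derive_Reals, Hf, Hc. }
specialize (Hdf c Hc2). nra.
Qed.

Lemma derive_lt (f df : R -> R) (a b : R) :
  a < b -> (forall t, a <= t <= b -> is_derive f t (df t)) ->
  (forall t, a < t < b -> 0 < df t) -> f a < f b.
Proof.
intros Hab Hf Hdf.
destruct (MVT_cor2 f df a b) as [c [Hc1 Hc2]]; [lra| |].
{ intros c Hc. apply is_derive_Reals, Hf, Hc. }
specialize (Hdf c Hc2). nra.
Qed.

Lemma derive_const (f df : R -> R) (a b : R) :
  a <= b -> (forall t, a <= t <= b -> is_derive f t (df t)) ->
  (forall t, a < t < b -> df t = 0) -> f b = f a.
Proof.
intros Hab Hf Hdf. destruct (derive_bounds f df a b 0 0 Hab Hf); [|lra].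
intros t Ht. rewrite Hdf by exact Ht. lra.
Qed.

Lemma is_derive_inv_sqrt (f : R -> R) (t df : R) :
  0 < f t -> is_derive f t df ->
  is_derive (fun s => / sqrt (f s)) t (- (1 / 2 * (irho3 (f t) * df))).
Proof.
intros Hp Hf. unfold irho3.
assert (Hs : 0 < sqrt (f t)) by (apply sqrt_lt_R0; exact Hp).
auto_derive.
- repeat split; try (exists df; exact Hf); try exact Hp. lra.
- replace (Derive _ t) with df by (symmetry; apply is_derive_unique; exact Hf).
  assert (Hq : f t = sqrt (f t) * sqrt (f t)) by (symmetry; apply sqrt_sqrt; lra).
  set (r := sqrt (f t)) in *. rewrite Hq. field. lra.
Qed.

Lemma is_derive_rho2 (u : R -> vec R) (t dz dY : R) :
  is_derive (fun s => vz (u s)) t dz -> is_derive (fun s => vY (u s)) t dY ->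
  is_derive (fun s => rho2 (u s)) t (2 * vY (u t) * dY + vz (u t) ^ 3 * dz).
Proof.
intros Hz HY. unfold rho2.
pose (z := fun s => vz (u s)). pose (Y := fun s => vY (u s)).
change (is_derive z t dz) in Hz. change (is_derive Y t dY) in HY.
change (is_derive (fun s => Y s ^ 2 + z s ^ 4 / 4) t (2 * Y t * dY + z t ^ 3 * dz)).
clearbody z Y. derivative. field.
Qed.

(** The reduced mass of body 3 against the pair. In [energy], the coordinate [vE] is the Kepler
    energy of the relative motion of the pair, so the sum is the total energy. *)
Definition mu (m : R) : R := 2 * m / (2 + m).
Definition energy (m : R) (x : vec R) : R :=
  vE x + mu m * vV x ^ 2 / 2 - 2 * m * / sqrt (rho2 x).

Lemma limit_nonneg (f : R -> R) (t l : R) :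
  0 < t -> is_derive f t l -> (forall s, 0 < s < t -> 0 <= f s) -> 0 <= f t.
Proof.
intros Ht Hf Hs. apply Rnot_lt_le. intros Hneg.
destruct (is_derive_near f t l (- f t) Hf) as [d [Hd H]]; [lra|].
set (s := Rmax (t - d / 2) (t / 2)).
assert (Hst : 0 < s < t /\ t - d < s).
{ unfold s, Rmax. destruct Rle_dec; lra. }
assert (Hs' : Rabs (s - t) < d) by (apply Rabs_def1; lra).
specialize (H s Hs'). apply Rabs_def2 in H. specialize (Hs s). lra.
Qed.

(** More than twice the duration 37500 of [Y_drop], with room for the crossing of [z = 0]. The other
    constants are crude bounds over that time: [z_max] from [z_lower], [V_max] from the derivative
    of [V], [K_max] from the energy relations with 1 to spare. *)
Definition horizon : R := 80000.
Definition z_max : R := 3 * exp (4 * horizon).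
Definition V_max : R := 5 * z_max ^ 2 * irho3 (1 / 40000) * horizon.
Definition K_max : R := 20 + 7 * z_max + V_max + V_max ^ 2.

Section Apriori.

Variables (m th T : R) (u : R -> vec R).
Hypothesis Hm : 9 / 10 <= m <= 11 / 10.
Hypothesis Hth : 65 / 64 <= th <= 3 / 2.
Hypothesis HT : 0 <= T.
Hypothesis Hu : follows_on m u T.
Hypothesis H0 : u 0 = brake_state th.

Let z t := vz (u t).
Let w t := vw (u t).
Let Y t := vY (u t).
Let V t := vV (u t).
Let E t := vE (u t).
Let g t := irho3 (rho2 (u t)).

Lemma start_values : z 0 = 1 /\ w 0 = 0 /\ Y 0 = th /\ V 0 = 0 /\ E 0 = -1.
Proof. unfold z, w, Y, V, E. rewrite H0. cbn. repeat split; reflexivity. Qed.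

Lemma g_pos t : 0 <= t <= T -> 0 < g t.
Proof. intros Ht. apply irho3_pos, Hu, Ht. Qed.

Lemma z_derive t : 0 <= t <= T -> is_derive z t (w t / 2).
Proof. intros Ht. apply (proj2 (Hu t Ht) Cz). Qed.
Lemma w_derive t : 0 <= t <= T -> is_derive w t (2 * z t * E t - m * z t ^ 5 * g t).
Proof. intros Ht. apply (proj2 (Hu t Ht) Cw). Qed.
Lemma Y_derive t : 0 <= t <= T -> is_derive Y t (z t ^ 2 * V t).
Proof. intros Ht. apply (proj2 (Hu t Ht) CY). Qed.
Lemma V_derive t : 0 <= t <= T -> is_derive V t (- ((2 + m) * z t ^ 2 * Y t * g t)).
Proof. intros Ht. apply (proj2 (Hu t Ht) CV). Qed.
Lemma E_derive t : 0 <= t <= T -> is_derive E t (- (m / 2 * z t ^ 3 * w t * g t)).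
Proof. intros Ht. apply (proj2 (Hu t Ht) CE). Qed.

(** The relation that defines [E] is preserved by the flow. At [z = 0] it forces [w^2 = 4]: a
    collision is crossed with nonzero speed. *)
Lemma level_zero t : 0 <= t <= T -> w t ^ 2 / 4 = 1 + z t ^ 2 * E t.
Proof.
intros Ht.
assert (H : w t ^ 2 / 4 - 1 - z t ^ 2 * E t = w 0 ^ 2 / 4 - 1 - z 0 ^ 2 * E 0).
{ apply (derive_const (fun t => w t ^ 2 / 4 - 1 - z t ^ 2 * E t) (fun _ => 0)); [lra| |auto].
  intros r Hr. assert (Hr' : 0 <= r <= T) by lra.
  pose proof (z_derive r Hr') as Dz. pose proof (w_derive r Hr') as Dw.
  pose proof (E_derive r Hr') as DE. clearbody z w E g. derivative. field. }
destruct start_values as [Hz [Hw [_ [_ HE]]]]. rewrite Hz, Hw, HE in H. lra.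
Qed.

Lemma energy_constant t : 0 <= t <= T -> energy m (u t) = -1 - 2 * m * / sqrt (th ^ 2 + 1 / 4).
Proof.
intros Ht.
assert (H : energy m (u t) = energy m (u 0)).
{ apply (derive_const (fun t => energy m (u t)) (fun _ => 0)); [lra| |auto].
  intros r Hr. assert (Hr' : 0 <= r <= T) by lra.
  pose proof (z_derive r Hr') as Dz. pose proof (V_derive r Hr') as DV.
  pose proof (E_derive r Hr') as DE. pose proof (Y_derive r Hr') as DY.
  pose (i := fun s => / sqrt (rho2 (u s))).
  assert (Di : is_derive i r (- (1 / 2 * (g r * (2 * Y r * (z r ^ 2 * V r) + z r ^ 3 * (w r / 2)))))).
  { exact (is_derive_inv_sqrt _ _ _ (proj1 (Hu r Hr')) (is_derive_rho2 u r _ _ Dz DY)). }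
  change (is_derive (fun s => E s + mu m * V s ^ 2 / 2 - 2 * m * i s) r 0).
  unfold mu. clearbody z w Y V E g i. derivative. field. lra. }
rewrite H, H0. unfold energy, brake_state, rho2; cbn [vz vw vY vV vE].
replace (th ^ 2 + 1 ^ 4 / 4) with (th ^ 2 + 1 / 4) by field. field.
apply Rgt_not_eq, sqrt_lt_R0. nra.
Qed.

(** Both follow from the conserved total energy, which lies between -4 and -1 because [2 m / r] is
    between 0 and 22/10 at the start. *)
Lemma inv_rho_bounds t : 0 <= t <= T ->
  E t <= 2 * m * / sqrt (rho2 (u t)) - 1 - mu m * V t ^ 2 / 2 /\
  -4 - V t ^ 2 / 2 <= E t.
Proof.
intros Ht. pose proof (energy_constant t Ht) as He.
unfold energy in He. fold (E t) (V t) in He.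
assert (Hs : 1 <= sqrt (th ^ 2 + 1 / 4)).
{ apply Rle_trans with (sqrt 1); [right; symmetry; apply sqrt_1|]. apply sqrt_le_1; nra. }
assert (Hi : 0 < / sqrt (th ^ 2 + 1 / 4)) by (apply Rinv_0_lt_compat; lra).
assert (Hi' : / sqrt (th ^ 2 + 1 / 4) <= 1) by (apply Rle_trans with (/ 1); [apply Rinv_le_contravar; lra|lra]).
assert (Hj : 0 < / sqrt (rho2 (u t))) by (apply Rinv_0_lt_compat, sqrt_lt_R0, Hu, Ht).
assert (Hmu : 0 < mu m <= 1).
{ unfold mu. split; [apply Rdiv_lt_0_compat; lra|].
  apply Rmult_le_reg_r with (2 + m); [lra|]. field_simplify; lra. }
pose proof (pow2_ge_0 (V t)).
set (i := / sqrt (th ^ 2 + 1 / 4)) in *. set (j := / sqrt (rho2 (u t))) in *. clearbody i j.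
assert (0 < m * i) by nra. assert (m * i <= 11 / 10) by nra. assert (0 < m * j) by nra.
assert (mu m * V t ^ 2 <= V t ^ 2) by nra. split; lra.
Qed.

(** [w / z] is dX/dt, so this is Newton's equation for [X] multiplied by dt/ds; [level_zero]
    eliminates [w^2]. *)
Lemma w_over_z_derive t : 0 <= t <= T -> z t <> 0 ->
  is_derive (fun s => w s / z s) t (- (2 / z t ^ 2 + m * z t ^ 4 * g t)).
Proof.
intros Ht Hz. pose proof (z_derive t Ht) as Dz. pose proof (w_derive t Ht) as Dw.
pose proof (level_zero t Ht) as HL. clearbody z w E g.
derivative; [exact Hz|].
replace (w t / 2) with (w t * / 2) by reflexivity.
assert (Hw2 : w t * w t = 4 + 4 * (z t ^ 2 * E t)) by nra.
field_simplify; [|exact Hz|exact Hz].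
replace (w t ^ 2) with (4 + 4 * (z t ^ 2 * E t)) by (rewrite <- Hw2; ring).
field. exact Hz.
Qed.

(* The velocity w/z of X = z^2 decreases as long as bodies 1 and 2 have not collided. *)
Lemma w_negative_before_collision t : 0 < t <= T -> (forall s, 0 <= s <= t -> 0 < z s) -> w t < 0.
Proof.
intros Ht Hz.
assert (H : - (w 0 / z 0) < - (w t / z t)).
{ apply (derive_lt (fun s => - (w s / z s)) (fun s => 2 / z s ^ 2 + m * z s ^ 4 * g s)); [lra| |].
  - intros s Hs. rewrite <- (Ropp_involutive (2 / z s ^ 2 + m * z s ^ 4 * g s)).
    apply (is_derive_opp (V := R_NormedModule) (fun s => w s / z s)), w_over_z_derive; [lra|].
    apply Rgt_not_eq, Hz. exact Hs.
  - intros s Hs. pose proof (Hz s ltac:(lra)) as Hzs. pose proof (g_pos s ltac:(lra)).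
    assert (0 < 2 / z s ^ 2) by (apply Rdiv_lt_0_compat; [lra|apply pow_lt, Hzs]).
    assert (0 < z s ^ 4) by (apply pow_lt, Hzs).
    assert (0 < m * z s ^ 4 * g s); [|lra].
    repeat apply Rmult_lt_0_compat; lra. }
destruct start_values as [Hz0 [Hw0 _]]. rewrite Hz0, Hw0 in H.
pose proof (Hz t ltac:(lra)) as Hzt.
apply Rnot_le_lt. intros Hw.
assert (0 <= w t / z t) by (apply Rmult_le_pos; [lra|left; apply Rinv_0_lt_compat, Hzt]).
lra.
Qed.

(** * Estimates as long as [w < 0] and [Y > 0] *)

Hypothesis Hw : forall t, 0 < t < T -> w t < 0.
Hypothesis HY : forall t, 0 < t < T -> 0 < Y t.

Lemma z_decr s t : 0 <= s <= t -> t <= T -> z t <= z s.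
Proof.
intros Hs Ht. apply Ropp_le_cancel.
apply (derive_le (fun r => - z r) (fun r => - (w r / 2))); [lra| |].
- intros r Hr. apply (is_derive_opp (V := R_NormedModule) z), z_derive. lra.
- intros r Hr. specialize (Hw r). lra.
Qed.

Lemma z_strict s t : 0 <= s < t -> t <= T -> z t < z s.
Proof.
intros Hs Ht. apply Ropp_lt_cancel.
apply (derive_lt (fun r => - z r) (fun r => - (w r / 2))); [lra| |].
- intros r Hr. apply (is_derive_opp (V := R_NormedModule) z), z_derive. lra.
- intros r Hr. specialize (Hw r). lra.
Qed.

Lemma V_decr s t : 0 <= s <= t -> t <= T -> V t <= V s.
Proof.
intros Hs Ht. apply Ropp_le_cancel.
apply (derive_le (fun r => - V r) (fun r => - - ((2 + m) * z r ^ 2 * Y r * g r))); [lra| |].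
- intros r Hr. apply (is_derive_opp (V := R_NormedModule) V), V_derive. lra.
- intros r Hr. pose proof (HY r ltac:(lra)). pose proof (g_pos r ltac:(lra)).
  rewrite Ropp_involutive. pose proof (pow2_ge_0 (z r)).
  apply Rmult_le_pos; [apply Rmult_le_pos; [apply Rmult_le_pos|]|]; lra.
Qed.

Lemma V_nonpos t : 0 <= t <= T -> V t <= 0.
Proof.
intros Ht. destruct start_values as [_ [_ [_ [HV _]]]]. rewrite <- HV. apply V_decr; lra.
Qed.

Lemma Y_decr s t : 0 <= s <= t -> t <= T -> Y t <= Y s.
Proof.
intros Hs Ht. apply Ropp_le_cancel.
apply (derive_le (fun r => - Y r) (fun r => - (z r ^ 2 * V r))); [lra| |].
- intros r Hr. apply (is_derive_opp (V := R_NormedModule) Y), Y_derive. lra.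
- intros r Hr. pose proof (V_nonpos r ltac:(lra)). pose proof (pow2_ge_0 (z r)). nra.
Qed.

Lemma z_le_1 t : 0 <= t <= T -> z t <= 1.
Proof.
intros Ht. destruct start_values as [Hz _]. rewrite <- Hz. apply z_decr; lra.
Qed.

Lemma Y_le_th t : 0 <= t <= T -> Y t <= th.
Proof.
intros Ht. destruct start_values as [_ [_ [HY0 _]]]. rewrite <- HY0. apply Y_decr; lra.
Qed.

Lemma continuous_near (f : R -> R) (t l a : R) :
  is_derive f t l -> a < f t -> exists e, 0 < e /\ forall s, t < s < t + e -> a < f s.
Proof.
intros Hf Ha. destruct (is_derive_near f t l (f t - a) Hf) as [d [Hd H]]; [lra|].
exists d. split; [exact Hd|]. intros s Hs.
assert (Hs' : Rabs (s - t) < d) by (apply Rabs_def1; lra).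
specialize (H s Hs'). apply Rabs_def2 in H. lra.
Qed.

(* With k = 4/5, (Y - k X)'' is nonnegative in physical time as long as Y >= X. *)
Lemma phase1_convexity X Yr r2 : 0 < X -> X <= Yr -> r2 = Yr ^ 2 + X ^ 2 / 4 ->
  (2 + m) * X * Yr * irho3 r2 <= 4 / 5 * (2 / X + m * X ^ 2 * irho3 r2).
Proof.
intros HX HXY Hr2.
assert (Hr : 0 < r2) by (rewrite Hr2; nra).
rewrite irho3_sqrt by exact Hr.
set (r := sqrt r2).
assert (Hs : 0 < r) by (apply sqrt_lt_R0, Hr).
assert (Hss : r * r = r2) by (apply sqrt_sqrt; lra).
(* Cauchy-Schwarz against the vector (1, 1/2), with 1119/1000 just above half the root of 5. It is
   sharp in the boundary case [Yr = X], and replaces [r^3] by a polynomial. *)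
assert (Hlow : Yr + X / 4 <= 1119 / 1000 * r).
{ apply Rnot_lt_le. intros Hc.
  assert ((1119 / 1000 * r) * (1119 / 1000 * r) < (Yr + X / 4) * (Yr + X / 4)) by nra. nra. }
assert (Hcube : (Yr ^ 2 + X ^ 2 / 4) * (Yr + X / 4) <= 1119 / 1000 * r ^ 3).
{ replace (r ^ 3) with (r2 * r) by (rewrite <- Hss; ring). rewrite <- Hr2. nra. }
assert (Hmain : (2 + m) * X ^ 2 * Yr <= 4 / 5 * (2 * r ^ 3 + m * X ^ 3)).
{ assert (Hq : (2 + m) * X ^ 2 * Yr <= 4 / 5 * (2 * ((Yr ^ 2 + X ^ 2 / 4) * (Yr + X / 4) * (1000 / 1119)) + m * X ^ 3)); [|nra].
  (* In [X] and [d] this is a cubic form with nonnegative coefficients for [m <= 11/10]. That of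
     [X^3] is barely so, which makes 4/5 nearly the smallest slope possible here; a small slope is
     wanted because the height left at the collision is [th - 4/5]. *)
  replace Yr with (X + (Yr - X)) by ring. set (d := Yr - X). assert (Hd : 0 <= d) by (unfold d; lra).
  clearbody d. assert (0 <= X ^ 3) by (apply pow_le; lra). assert (0 <= d ^ 3) by (apply pow_le; lra).
  assert (0 <= X ^ 2 * d) by (apply Rmult_le_pos; [apply pow2_ge_0|exact Hd]).
  assert (0 <= X * d ^ 2) by (apply Rmult_le_pos; [lra|apply pow2_ge_0]).
  assert (m * X ^ 3 <= 11 / 10 * X ^ 3) by nra.
  assert (m * (X ^ 2 * d) <= 11 / 10 * (X ^ 2 * d)) by nra.
  nra. }
apply Rmult_le_reg_r with (X * r ^ 3).
{ apply Rmult_lt_0_compat; [exact HX|apply pow_lt, Hs]. }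
replace ((2 + m) * X * Yr * (/ r * (/ r) ^ 2) * (X * r ^ 3)) with ((2 + m) * X ^ 2 * Yr)
  by (field; lra).
replace (4 / 5 * (2 / X + m * X ^ 2 * (/ r * (/ r) ^ 2)) * (X * r ^ 3))
  with (4 / 5 * (2 * r ^ 3 + m * X ^ 3)) by (field; lra).
exact Hmain.
Qed.

(** Bootstrap on [Y >= X]: while it holds, convexity and the start at rest give [V >= 4/5 dX/dt],
    hence the linear bound; and as [th > 1 >= X], the linear bound returns [Y > X] strictly. *)
Lemma phase1_linear_bound t : 0 <= t <= T -> (forall s, 0 <= s < t -> 0 < z s) ->
  th - 4 / 5 + 4 / 5 * z t ^ 2 <= Y t.
Proof.
intros Ht Hz.
destruct start_values as [Hz0 [Hw0 [HY0 [HV0 _]]]].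
assert (Hstep : forall r, 0 <= r <= t -> (forall s, 0 <= s < r -> z s ^ 2 <= Y s) ->
  th - 4 / 5 + 4 / 5 * z r ^ 2 <= Y r).
{ intros r Hr Hprev.
  assert (HD : forall s, 0 <= s < r -> 0 <= V s - 4 / 5 * (w s / z s)).
  { intros s Hs.
    assert (H : V 0 - 4 / 5 * (w 0 / z 0) <= V s - 4 / 5 * (w s / z s)).
    { apply (derive_le (fun s => V s - 4 / 5 * (w s / z s))
       (fun s => - ((2 + m) * z s ^ 2 * Y s * g s)
           - 4 / 5 * - (2 / z s ^ 2 + m * z s ^ 4 * g s))); [lra| |].
      - intros a Ha. assert (Hza : 0 < z a) by (apply Hz; lra).
        apply (is_derive_minus (V := R_NormedModule) V (fun s => 4 / 5 * (w s / z s)));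
          [apply V_derive; lra|].
        apply (is_derive_scal (fun s => w s / z s)), w_over_z_derive; lra.
      - intros a Ha. assert (Hza : 0 < z a) by (apply Hz; lra).
        assert (HX : 0 < z a ^ 2) by (apply pow_lt, Hza).
        pose proof (phase1_convexity (z a ^ 2) (Y a) (rho2 (u a)) HX (Hprev a ltac:(lra))) as H.
        fold (g a) in H.
        assert (Hr2 : rho2 (u a) = Y a ^ 2 + (z a ^ 2) ^ 2 / 4).
        { unfold rho2. fold (z a) (Y a). field. }
        specialize (H Hr2). replace ((z a ^ 2) ^ 2) with (z a ^ 4) in H by ring. lra. }
    rewrite Hz0, Hw0, HV0 in H. lra. }
  assert (H : Y 0 - 4 / 5 * z 0 ^ 2 <= Y r - 4 / 5 * z r ^ 2).
  { apply (derive_le (fun s => Y s - 4 / 5 * z s ^ 2)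
      (fun s => z s ^ 2 * (V s - 4 / 5 * (w s / z s)))); [lra| |].
    - intros s Hs.
      pose proof (z_derive s ltac:(lra)) as Dz. pose proof (Y_derive s ltac:(lra)) as DY.
      destruct (Req_dec s r) as [Hsr|Hsr].
      + assert (Hd : is_derive (fun s => Y s - 4 / 5 * z s ^ 2) s
          (z s ^ 2 * V s - 4 / 5 * z s * w s)).
        { clear - Dz DY. clearbody z w Y V. derivative. field. }
        (* At the collision itself [w / z] has no meaning, but it is multiplied by [z^2 = 0] and the
           derivative is right all the same. *)
        destruct (Req_dec (z s) 0) as [Hzs|Hzs].
        * replace (z s ^ 2 * (V s - 4 / 5 * (w s / z s))) with (z s ^ 2 * V s - 4 / 5 * z s * w s)
            by (rewrite Hzs; ring). exact Hd.
        * replace (z s ^ 2 * (V s - 4 / 5 * (w s / z s))) with (z s ^ 2 * V s - 4 / 5 * z s * w s)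
            by (field; exact Hzs). exact Hd.
      + assert (Hzs : 0 < z s) by (apply Hz; lra).
        clear - Dz DY Hzs. clearbody z w Y V. derivative. field. lra.
    - intros s Hs. apply Rmult_le_pos; [apply pow2_ge_0|apply HD; lra]. }
  rewrite HY0, Hz0 in H. lra. }
apply Hstep; [lra|]. intros s Hs.
apply (real_induction (fun s => z s ^ 2 <= Y s) 0 s); [|lra].
intros r Hr Hprev. pose proof (Hstep r ltac:(lra) Hprev) as H.
pose proof (z_le_1 r ltac:(lra)). pose proof (Hz r ltac:(lra)).
assert (Hlt : z r ^ 2 < Y r) by nra.
split; [lra|].
pose proof (z_derive r ltac:(lra)) as Dz. pose proof (Y_derive r ltac:(lra)) as DY.
destruct (continuous_near (fun s => Y s - z s ^ 2) r (z r ^ 2 * V r - z r * w r) 0)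
  as [e [He H']]; [|lra|].
- clear - Dz DY. clearbody z w Y V. derivative. field.
- exists e. split; [exact He|]. intros a Ha _. specialize (H' a Ha). lra.
Qed.

Lemma z_pos_before t s : 0 <= z t -> 0 <= s < t -> t <= T -> 0 < z s.
Proof. intros Hz Hs Ht. pose proof (z_strict s t Hs Ht). lra. Qed.

Lemma inv_rho_le t y : 0 <= t <= T -> 0 < y -> y <= Y t ->
  0 < / sqrt (rho2 (u t)) <= / y.
Proof.
intros Ht Hy Hle.
assert (H : y <= sqrt (rho2 (u t))).
{ rewrite <- (sqrt_square y) by lra. apply sqrt_le_1; [nra|left; apply Hu, Ht|].
  unfold rho2. fold (z t) (Y t). pose proof (pow2_ge_0 (z t ^ 2)).
  replace (z t ^ 4) with ((z t ^ 2) ^ 2) by ring. nra. }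
split; [apply Rinv_0_lt_compat; lra|apply Rinv_le_contravar; lra].
Qed.

(** While [z > 0 > w] the pair gains energy, so [E >= -1]. The height is at least 65/64 - 4/5 =
    69/320, which caps the attraction of body 3 and with it, by conservation of energy, both [E] and
    [V^2]. *)
Lemma phase1_bounds t : 0 <= t <= T -> 0 <= z t ->
  -1 <= E t <= 10 /\ -6 <= V t /\ 21 / 100 <= Y t.
Proof.
intros Ht Hz.
assert (HE : -1 <= E t).
{ destruct start_values as [_ [_ [_ [_ HE]]]]. rewrite <- HE.
  apply (derive_le E (fun r => - (m / 2 * z r ^ 3 * w r * g r))); [lra| |].
  - intros r Hr. apply E_derive. lra.
  - intros r Hr. pose proof (z_pos_before t r Hz ltac:(lra) ltac:(lra)) as Hzr.
    pose proof (Hw r ltac:(lra)). pose proof (g_pos r ltac:(lra)).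
    assert (0 < z r ^ 3) by (apply pow_lt, Hzr).
    replace (- (m / 2 * z r ^ 3 * w r * g r)) with (m / 2 * z r ^ 3 * - w r * g r) by ring.
    apply Rmult_le_pos; [apply Rmult_le_pos; [apply Rmult_le_pos|]|]; lra. }
assert (Hlin : th - 4 / 5 + 4 / 5 * z t ^ 2 <= Y t).
{ apply phase1_linear_bound; [exact Ht|]. intros s Hs. apply (z_pos_before t); lra. }
pose proof (pow2_ge_0 (z t)).
destruct (inv_rho_le t (69 / 320) Ht) as [Hi1 Hi2]; [lra|lra|].
destruct (inv_rho_bounds t Ht) as [HE1 _].
set (i := / sqrt (rho2 (u t))) in *. clearbody i.
replace (/ (69 / 320)) with (320 / 69) in Hi2 by field.
assert (Hmi : m * i <= 11 / 10 * (320 / 69)) by nra.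
assert (Hmu : mu m * V t ^ 2 / 2 <= 2 * m * i) by lra.
pose proof (pow2_ge_0 (V t)).
assert (HV2 : V t ^ 2 <= 2 * (2 + m) * i).
{ unfold mu in Hmu.
  apply Rmult_le_reg_l with (m / (2 + m)); [apply Rdiv_lt_0_compat; lra|].
  replace (m / (2 + m) * V t ^ 2) with (2 * m / (2 + m) * V t ^ 2 / 2) by (field; lra).
  replace (m / (2 + m) * (2 * (2 + m) * i)) with (2 * m * i) by (field; lra). exact Hmu. }
assert (0 <= mu m * V t ^ 2 / 2).
{ assert (0 < mu m) by (unfold mu; apply Rdiv_lt_0_compat; lra). nra. }
split; [lra|]. split; [|lra].
assert (2 * (2 + m) * i <= 29) by nra. nra.
Qed.

Lemma collision_time t : 0 <= t <= T -> z t < 0 -> exists s, 0 < s < t /\ z s = 0.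
Proof.
intros Ht Hz. destruct start_values as [Hz0 _].
assert (H0t : 0 < t) by (destruct (Req_dec t 0) as [->|]; lra).
destruct (IVT_interv (fun s => - z s) 0 t) as [s [Hs Hzs]].
- intros a Ha. apply continuity_pt_filterlim.
  apply (ex_derive_continuous (fun s => - z s) a). exists (- (w a / 2)).
  apply (is_derive_opp (V := R_NormedModule) z), z_derive. lra.
- exact H0t.
- lra.
- lra.
- exists s. destruct (Req_dec s 0) as [->|]; [lra|].
  destruct (Req_dec s t) as [->|]; lra.
Qed.

(** Near the binary collision the pair moves almost at collision speed: in [w^2 = 4 (1 + z^2 E)] the
    last term is at least -3/10. *)
Lemma w_le t : 0 <= t <= T -> w t <= 0 -> -1 / 10 <= z t <= 1 / 10 -> -7 <= V t <= 0 ->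
  w t <= - 8 / 5.
Proof.
intros Ht Hwt Hz HV. destruct (inv_rho_bounds t Ht) as [_ HE].
pose proof (level_zero t Ht) as HL.
assert (z t ^ 2 <= 1 / 100) by nra. assert (V t ^ 2 <= 49) by nra.
pose proof (pow2_ge_0 (z t)). assert (-30 <= E t) by lra.
assert (- 3 / 10 <= z t ^ 2 * E t) by nra. nra.
Qed.

(** [V - 4 z] and [Y - z] do not decrease while [z] runs from 0 to -1/10, since [w <= -8/5]
    outweighs the pull on body 3. From -6 and 21/100 at the collision, [V] stays above -64/10 and
    [Y] above 11/100, which leaves the strict room that the induction needs. *)
Lemma after_collision s1 t : 0 <= s1 <= t -> t <= T -> z s1 = 0 -> -1 / 10 <= z t ->
  1 / 10 <= Y t /\ -7 <= V t.
Proof.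
intros Hs1 Ht Hz1 Hzt.
destruct (phase1_bounds s1 ltac:(lra) ltac:(lra)) as [_ [HV1 HY1]].
apply (real_induction (fun r => -1 / 10 <= z r -> 1 / 10 <= Y r /\ -7 <= V r) s1 t);
  [|lra|exact Hzt].
intros r Hr Hprev.
(* Beyond [z = -1/10] the claim is void and remains so for a while. *)
destruct (Rlt_le_dec (z r) (-1 / 10)) as [Hzr|Hzr].
{ split; [lra|].
  destruct (continuous_near (fun s => - z s) r (- (w r / 2)) (1 / 10)) as [e [He H]]; [|lra|].
  - apply (is_derive_opp (V := R_NormedModule) z), z_derive. lra.
  - exists e. split; [exact He|]. intros s Hs _. specialize (H s Hs). lra. }
assert (Hin : forall s, s1 < s < r -> w s <= - 8 / 5 /\ -1 / 10 <= z s <= 0 /\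
   1 / 10 <= Y s /\ -7 <= V s <= 0).
{ intros s Hs. pose proof (z_decr s r ltac:(lra) ltac:(lra)).
  pose proof (z_decr s1 s ltac:(lra) ltac:(lra)).
  destruct (Hprev s ltac:(lra) ltac:(lra)).
  pose proof (V_nonpos s ltac:(lra)). pose proof (Hw s ltac:(lra)).
  split; [apply w_le; lra|]. split; [lra|]. split; lra. }
assert (H1 : V s1 - 4 * z s1 <= V r - 4 * z r).
{ apply (derive_le (fun s => V s - 4 * z s)
    (fun s => - ((2 + m) * z s ^ 2 * Y s * g s) - 4 * (w s / 2))); [lra| |].
  - intros s Hs. apply (is_derive_minus (V := R_NormedModule) V (fun s => 4 * z s)).
    + apply V_derive; lra.
    + apply (is_derive_scal z), z_derive; lra.
  - intros s Hs. destruct (Hin s Hs) as [Hws [Hzs [HYs _]]].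
    destruct (inv_rho_le s (Y s) ltac:(lra) ltac:(lra) ltac:(lra)) as [Hi1 Hi2].
    assert (Hg : g s = / sqrt (rho2 (u s)) * (/ sqrt (rho2 (u s))) ^ 2).
    { apply irho3_sqrt, Hu. lra. }
    set (i := / sqrt (rho2 (u s))) in *. clearbody i.
    assert (HYi : Y s * i <= 1).
    { apply Rmult_le_reg_r with (/ Y s); [lra|].
      replace (Y s * i * / Y s) with i by (field; lra). lra. }
    assert (Hi10 : i <= 10).
    { apply Rle_trans with (1 := Hi2). apply Rle_trans with (/ (1 / 10)); [|lra].
      apply Rinv_le_contravar; lra. }
    assert (HYg : Y s * g s <= 100).
    { rewrite Hg. replace (Y s * (i * i ^ 2)) with (Y s * i * i ^ 2) by ring.
      assert (i ^ 2 <= 100) by nra. nra. }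
    assert (Hz2 : z s ^ 2 <= 1 / 100) by nra. pose proof (pow2_ge_0 (z s)).
    assert (0 <= Y s * g s).
    { apply Rmult_le_pos; [lra|]. left. apply g_pos. lra. }
    assert (z s ^ 2 * (Y s * g s) <= 1) by nra.
    replace ((2 + m) * z s ^ 2 * Y s * g s) with ((2 + m) * (z s ^ 2 * (Y s * g s))) by ring.
    nra. }
assert (H2 : Y s1 - z s1 <= Y r - z r).
{ apply (derive_le (fun s => Y s - z s) (fun s => z s ^ 2 * V s - w s / 2)); [lra| |].
  - intros s Hs. apply (is_derive_minus (V := R_NormedModule) Y z);
      [apply Y_derive|apply z_derive]; lra.
  - intros s Hs. destruct (Hin s Hs) as [Hws [Hzs [_ HVs]]].
    assert (z s ^ 2 <= 1 / 100) by nra. pose proof (pow2_ge_0 (z s)).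
    assert (z s ^ 2 * -7 <= z s ^ 2 * V s) by (apply Rmult_le_compat_l; lra). lra. }
split; [intros _; lra|].
destruct (continuous_near Y r _ (1 / 10) (Y_derive r ltac:(lra))) as [e1 [He1 Hn1]]; [lra|].
destruct (continuous_near V r _ (-7) (V_derive r ltac:(lra))) as [e2 [He2 Hn2]]; [lra|].
exists (Rmin e1 e2). split; [apply Rmin_glb_lt; assumption|].
intros s Hs _ _. pose proof (Rmin_l e1 e2). pose proof (Rmin_r e1 e2).
split; left; [apply Hn1|apply Hn2]; lra.
Qed.

Lemma slow_zone t : 0 < t < T -> -1 / 10 <= z t <= 1 / 10 -> w t <= - 8 / 5.
Proof.
intros Ht Hz. pose proof (Hw t Ht). pose proof (V_nonpos t ltac:(lra)).
apply w_le; try lra. split; [|lra].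
destruct (Rle_lt_dec 0 (z t)) as [Hzt|Hzt].
- destruct (phase1_bounds t ltac:(lra) Hzt). lra.
- destruct (collision_time t ltac:(lra) Hzt) as [s1 [Hs1 Hz1]].
  apply (after_collision s1 t); lra.
Qed.

(** After the collision [z] and [w] are both negative, [E] does not increase, and its bound at the
    collision persists. *)
Lemma E_le_10 t : 0 <= t <= T -> E t <= 10.
Proof.
intros Ht. destruct (Rle_lt_dec 0 (z t)) as [Hzt|Hzt].
- apply phase1_bounds; assumption.
- destruct (collision_time t Ht Hzt) as [s1 [Hs1 Hz1]].
  apply Rle_trans with (E s1); [|apply phase1_bounds; lra].
  apply Ropp_le_cancel.
  apply (derive_le (fun r => - E r) (fun r => - - (m / 2 * z r ^ 3 * w r * g r))); [lra| |].
  + intros r Hr. apply (is_derive_opp (V := R_NormedModule) E), E_derive. lra.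
  + intros r Hr. pose proof (z_decr s1 r ltac:(lra) ltac:(lra)).
    pose proof (Hw r ltac:(lra)). pose proof (g_pos r ltac:(lra)).
    replace (- - (m / 2 * z r ^ 3 * w r * g r)) with (m / 2 * (z r ^ 2 * (- z r * - w r)) * g r) by ring.
    pose proof (pow2_ge_0 (z r)).
    assert (0 <= - z r * - w r) by (apply Rmult_le_pos; lra).
    assert (0 <= z r ^ 2 * (- z r * - w r)) by (apply Rmult_le_pos; lra).
    apply Rmult_le_pos; [|lra]. apply Rmult_le_pos; lra.
Qed.

(** Triple collision is excluded in two regimes: until [z = -1/10] the height is at least 1/10, and
    from there on the pair is wide, with [z^4 / 4 >= 1/40000]. *)
Lemma rho2_lower t : 0 <= t <= T -> 1 / 40000 <= rho2 (u t).
Proof.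
intros Ht. unfold rho2. fold (z t) (Y t).
assert (H : 1 / 10 <= Y t \/ z t <= -1 / 10).
{ destruct (Rle_lt_dec (z t) (-1 / 10)) as [|Hz]; [right; lra|left].
  destruct (Rle_lt_dec 0 (z t)) as [Hzt|Hzt].
  - destruct (phase1_bounds t Ht Hzt). lra.
  - destruct (collision_time t Ht Hzt) as [s1 [Hs1 Hz1]].
    apply (after_collision s1 t); lra. }
replace (z t ^ 4) with ((z t ^ 2) ^ 2) by ring.
pose proof (pow2_ge_0 (z t ^ 2)). pose proof (pow2_ge_0 (Y t)).
destruct H as [H|H]; [nra|]. assert (1 / 100 <= z t ^ 2) by nra. nra.
Qed.

Lemma w_lower t : 0 <= t <= T -> - w t <= 2 + 7 * Rabs (z t).
Proof.
intros Ht. pose proof (level_zero t Ht) as HL. pose proof (E_le_10 t Ht) as HE.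
rewrite <- (pow2_abs (z t)) in HL. pose proof (Rabs_pos (z t)) as Ha.
set (a := Rabs (z t)) in *. clearbody a.
assert (a ^ 2 * E t <= 10 * a ^ 2) by (pose proof (pow2_ge_0 a); nra). nra.
Qed.

(** Comparison for the linear inequality [z' >= -1 - 7/2 |z|]; the rate 4 and the shift 3 are
    generous. *)
Lemma z_lower t : 0 <= t <= T -> 3 - 3 * exp (4 * t) <= z t.
Proof.
intros Ht. destruct start_values as [Hz0 _].
assert (H : (z 0 - 3) * exp (- 4 * 0) <= (z t - 3) * exp (- 4 * t)).
{ apply (derive_le (fun s => (z s - 3) * exp (- 4 * s))
    (fun s => (w s / 2 - 4 * (z s - 3)) * exp (- 4 * s))); [lra| |].
  - intros s Hs. pose proof (z_derive s ltac:(lra)) as Dz. clear - Dz. clearbody z w.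
    derivative. field.
  - intros s Hs. pose proof (w_lower s ltac:(lra)) as Hws. pose proof (z_le_1 s ltac:(lra)).
    apply Rmult_le_pos; [|left; apply exp_pos].
    revert Hws. unfold Rabs. destruct Rcase_abs; lra. }
rewrite Hz0, Rmult_0_r, exp_0 in H.
assert (He : exp (- 4 * t) * exp (4 * t) = 1).
{ rewrite <- exp_plus. replace (- 4 * t + 4 * t) with 0 by ring. apply exp_0. }
assert (Hp : 0 < exp (4 * t)) by apply exp_pos.
apply (Rmult_le_compat_r (exp (4 * t))) in H; [|lra].
rewrite (Rmult_assoc (z t - 3)), He in H. lra.
Qed.

Lemma V_negative t : 0 < t <= T -> V t < 0.
Proof.
intros Ht. destruct start_values as [Hz0 [_ [_ [HV0 _]]]].
destruct (continuous_near z 0 _ (1 / 2) (z_derive 0 ltac:(lra))) as [e [He Hz]]; [lra|].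
set (a := Rmin (e / 2) t).
assert (Ha : 0 < a <= t /\ a < e).
{ unfold a, Rmin. destruct Rle_dec; lra. }
apply Rle_lt_trans with (V a); [apply V_decr; lra|].
assert (H : - V 0 < - V a); [|lra].
apply (derive_lt (fun r => - V r) (fun r => - - ((2 + m) * z r ^ 2 * Y r * g r))); [lra| |].
- intros r Hr. apply (is_derive_opp (V := R_NormedModule) V), V_derive. lra.
- intros r Hr. pose proof (HY r ltac:(lra)). pose proof (g_pos r ltac:(lra)).
  pose proof (Hz r ltac:(lra)). assert (0 < z r ^ 2) by (apply pow_lt; lra).
  rewrite Ropp_involutive.
  apply Rmult_lt_0_compat; [apply Rmult_lt_0_compat; [apply Rmult_lt_0_compat|]|]; lra.
Qed.

Lemma Y_nonneg t : 0 <= t <= T -> 0 <= Y t.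
Proof.
intros Ht. destruct start_values as [_ [_ [HY0 _]]].
destruct (Req_dec t 0) as [->|Hne]; [lra|].
apply (limit_nonneg Y t _ ltac:(lra) (Y_derive t Ht)).
intros s Hs. left. apply HY. lra.
Qed.

Lemma w_nonpos t : 0 <= t <= T -> w t <= 0.
Proof.
intros Ht. destruct start_values as [_ [Hw0 _]].
destruct (Req_dec t 0) as [->|Hne]; [lra|].
assert (H : 0 <= - w t); [|lra].
apply (limit_nonneg (fun s => - w s) t (- (2 * z t * E t - m * z t ^ 5 * g t))); [lra| |].
- apply (is_derive_opp (V := R_NormedModule) w), w_derive, Ht.
- intros s Hs. specialize (Hw s). lra.
Qed.

(** [w] cannot vanish at [z = 0] by [level_zero], nor at [z > 0], where dX/dt has been decreasing
    strictly from 0. *)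
Lemma before_turning t : 0 < t <= T -> w t = 0 -> z t < 0.
Proof.
intros Ht Hwt. apply Rnot_le_lt. intros Hz.
destruct (Req_dec (z t) 0) as [Hz0|Hz0].
- pose proof (level_zero t ltac:(lra)) as HL. rewrite Hwt, Hz0 in HL. lra.
- assert (H : w t < 0); [|lra]. apply w_negative_before_collision; [lra|].
  intros s Hs. destruct (Req_dec s t) as [->|]; [lra|].
  apply (z_pos_before t); lra.
Qed.

Lemma before_syzygy t : 0 <= t <= T -> Y t = 0 -> z t < 0.
Proof.
intros Ht HYt. apply Rnot_le_lt. intros Hz. destruct (phase1_bounds t Ht Hz). lra.
Qed.

(** The margin 1 below [K_max] is the slack with which [descent_in_region] continues past [t]. *)
Lemma region_bound t : T <= horizon -> 0 <= t <= T ->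
  forall c, Rabs (get c (u t)) <= K_max - 1.
Proof.
intros HTh Ht.
assert (Hexp : forall s, s <= T -> exp (4 * s) <= exp (4 * horizon)).
{ intros s Hs. destruct (Req_dec s horizon) as [->|]; [lra|].
  left. apply exp_increasing. lra. }
assert (HZ1 : 3 <= z_max).
{ unfold z_max. assert (1 <= exp (4 * horizon)); [|lra].
  rewrite <- exp_0. left. apply exp_increasing. unfold horizon. lra. }
assert (Hz : forall s, 0 <= s <= T -> Rabs (z s) <= z_max).
{ intros s Hs. pose proof (z_le_1 s Hs). pose proof (z_lower s Hs).
  pose proof (Hexp s ltac:(lra)). apply Rabs_le. unfold z_max in *. lra. }
assert (HG : 0 < irho3 (1 / 40000)) by (apply irho3_pos; lra).
assert (HV0 : 0 <= V_max).
{ unfold V_max. pose proof (pow2_ge_0 z_max).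
  apply Rmult_le_pos; [apply Rmult_le_pos; [apply Rmult_le_pos|]|]; unfold horizon; lra. }
assert (HV : - V_max <= V t <= 0).
{ split; [|apply V_nonpos, Ht].
  destruct start_values as [_ [_ [_ [HVs _]]]].
  destruct (derive_bounds V (fun r => - ((2 + m) * z r ^ 2 * Y r * g r)) 0 t
    (- (5 * z_max ^ 2 * irho3 (1 / 40000))) 0) as [HV1 _]; [lra| | |].
  - intros r Hr. apply V_derive. lra.
  - intros r Hr.
    assert (H1 : 0 <= z r ^ 2 <= z_max ^ 2).
    { split; [apply pow2_ge_0|]. rewrite <- (pow2_abs (z r)).
      apply pow_incr. split; [apply Rabs_pos|apply Hz; lra]. }
    assert (H2 : 0 <= Y r <= 3 / 2).
    { split; [apply Y_nonneg; lra|]. pose proof (Y_le_th r ltac:(lra)). lra. }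
    assert (H3 : 0 <= g r <= irho3 (1 / 40000)).
    { split; [left; apply g_pos; lra|]. apply irho3_decr; [lra|]. apply rho2_lower. lra. }
    assert (H4 : 0 <= z r ^ 2 * g r <= z_max ^ 2 * irho3 (1 / 40000)).
    { split; [apply Rmult_le_pos; lra|]. apply Rmult_le_compat; lra. }
    assert (H5 : 0 <= (2 + m) * Y r <= 5) by nra.
    replace ((2 + m) * z r ^ 2 * Y r * g r) with ((2 + m) * Y r * (z r ^ 2 * g r)) by ring.
    assert (0 <= (2 + m) * Y r * (z r ^ 2 * g r) <= 5 * (z_max ^ 2 * irho3 (1 / 40000))).
    { split; [apply Rmult_le_pos; lra|]. apply Rmult_le_compat; lra. }
    lra.
  - rewrite HVs in HV1. unfold V_max.
    set (a := 5 * z_max ^ 2 * irho3 (1 / 40000)) in *.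
    assert (Ha : 0 <= a).
    { unfold a. pose proof (pow2_ge_0 z_max). apply Rmult_le_pos; [apply Rmult_le_pos|]; lra. }
    nra. }
pose proof (pow2_ge_0 V_max) as HV2.
assert (HVV : V t ^ 2 <= V_max ^ 2) by nra.
unfold K_max. intros c; destruct c; cbn [get];
  [change (vz (u t)) with (z t)|change (vw (u t)) with (w t)|change (vY (u t)) with (Y t)
  |change (vV (u t)) with (V t)|change (vE (u t)) with (E t)].
- pose proof (Hz t Ht). lra.
- pose proof (w_lower t Ht). pose proof (w_nonpos t Ht). pose proof (Hz t Ht).
  rewrite Rabs_left1; lra.
- pose proof (Y_nonneg t Ht). pose proof (Y_le_th t Ht). rewrite Rabs_right; lra.
- rewrite Rabs_left1; lra.
- pose proof (E_le_10 t Ht). destruct (inv_rho_bounds t Ht) as [_ HE]. apply Rabs_le. lra.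
Qed.

(** During the first 1/8 of time [w / 2 >= -9/2] keeps [z] above 2/5; then [Y] and [g] are bounded
    below and [V] falls at rate at least 4/125. Afterwards [V] does not increase. *)
Lemma V_early t : 1 / 8 <= t <= T -> V t <= - 1 / 250.
Proof.
intros Ht. destruct start_values as [Hz0 [_ [_ [HV0 _]]]].
apply Rle_trans with (V (1 / 8)); [apply V_decr; lra|].
assert (Hz : forall s, 0 <= s <= 1 / 8 -> 2 / 5 <= z s).
{ intros s Hs.
  apply (real_induction (fun s => 2 / 5 <= z s) 0 (1 / 8)); [|exact Hs].
  intros r Hr Hprev.
  destruct (derive_bounds z (fun s => w s / 2) 0 r (- 9 / 2) 0) as [H1 _]; [lra| | |].
  - intros a Ha. apply z_derive. lra.
  - intros a Ha. pose proof (w_lower a ltac:(lra)) as Hwa. pose proof (w_nonpos a ltac:(lra)).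
    pose proof (z_le_1 a ltac:(lra)). pose proof (Hprev a ltac:(lra)).
    rewrite Rabs_right in Hwa by lra. lra.
  - rewrite Hz0 in H1. split; [lra|].
    destruct (continuous_near z r _ (2 / 5) (z_derive r ltac:(lra))) as [e [He H]]; [lra|].
    exists e. split; [exact He|]. intros a Ha _. left. apply H, Ha. }
destruct (derive_bounds V (fun r => - ((2 + m) * z r ^ 2 * Y r * g r)) 0 (1 / 8)
   (- ((2 + m) * 1 * (3 / 2) * irho3 (1 / 40000))) (- 4 / 125)) as [_ H2]; [lra| | |].
- intros r Hr. apply V_derive. lra.
- intros r Hr. pose proof (Hz r ltac:(lra)) as Hzr. pose proof (z_le_1 r ltac:(lra)).
  assert (HYr : th - 4 / 5 + 4 / 5 * z r ^ 2 <= Y r).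
  { apply phase1_linear_bound; [lra|]. intros s Hs. pose proof (Hz s ltac:(lra)). lra. }
  pose proof (Y_le_th r ltac:(lra)).
  assert (Hz2 : 4 / 25 <= z r ^ 2 <= 1) by nra.
  assert (Hr2 : rho2 (u r) <= 5 / 2).
  { unfold rho2. fold (z r) (Y r). replace (z r ^ 4) with ((z r ^ 2) ^ 2) by ring. nra. }
  assert (Hg : 1 / 4 <= g r).
  { apply Rle_trans with (irho3 (5 / 2)); [|apply irho3_decr; [apply Hu; lra|exact Hr2]].
    unfold irho3.
    assert (Hs : sqrt (5 / 2) <= 8 / 5).
    { rewrite <- (sqrt_square (8 / 5)) by lra. apply sqrt_le_1; lra. }
    assert (Hs0 : 0 < sqrt (5 / 2)) by (apply sqrt_lt_R0; lra).
    replace (1 / 4) with (/ 4) by field. apply Rinv_le_contravar; nra. }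
  assert (Hg' : g r <= irho3 (1 / 40000)).
  { apply irho3_decr; [lra|]. apply rho2_lower. lra. }
  split.
  + apply Ropp_le_contravar.
    assert (0 <= z r ^ 2 * Y r <= 1 * (3 / 2)) by nra.
    replace ((2 + m) * z r ^ 2 * Y r * g r) with ((2 + m) * (z r ^ 2 * Y r) * g r) by ring.
    replace ((2 + m) * 1 * (3 / 2) * irho3 (1 / 40000))
      with ((2 + m) * (1 * (3 / 2)) * irho3 (1 / 40000)) by ring.
    apply Rmult_le_compat; [nra|lra|nra|lra].
  + assert (3 / 10 <= Y r) by lra.
    assert (12 / 250 <= z r ^ 2 * Y r) by nra.
    assert (12 / 100 <= (2 + m) * (z r ^ 2 * Y r)) by nra.
    replace ((2 + m) * z r ^ 2 * Y r * g r) with ((2 + m) * (z r ^ 2 * Y r) * g r) by ring.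
    nra.
- rewrite HV0 in H2. lra.
Qed.

(** Here [Y' = z^2 V <= -(1/100) (1/250)], while [Y] has at most 3/2 to fall. *)
Lemma Y_drop a b : 1 / 8 <= a <= b -> b <= T ->
  (forall s, a <= s <= b -> 1 / 100 <= z s ^ 2) -> b - a <= 37500.
Proof.
intros Ha Hb Hz.
assert (H : - Y a - 1 / 25000 * (a - a) <= - Y b - 1 / 25000 * (b - a)).
{ apply (derive_le (fun s => - Y s - 1 / 25000 * (s - a))
    (fun s => - (z s ^ 2 * V s) - 1 / 25000)); [lra| |].
  - intros s Hs. pose proof (Y_derive s ltac:(lra)) as DY. clear - DY. clearbody z Y V.
    derivative. field.
  - intros s Hs. pose proof (Hz s ltac:(lra)). pose proof (V_early s ltac:(lra)). nra. }
pose proof (Y_nonneg b ltac:(lra)). pose proof (Y_le_th a ltac:(lra)). lra.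
Qed.

(** Otherwise [z] is at least 1/10 for too long, or at most -1/10 for too long, or within these
    limits from 40000 to 40001 although it falls there at rate at least 4/5. *)
Lemma horizon_not_reached : T < horizon.
Proof.
unfold horizon. apply Rnot_le_lt. intros HT'.
destruct (Rle_lt_dec (1 / 10) (z 40000)) as [Hz1|Hz1].
- pose proof (Y_drop 1 40000 ltac:(lra) ltac:(lra)) as H.
  assert (40000 - 1 <= 37500); [|lra]. apply H. intros s Hs.
  pose proof (z_decr s 40000 ltac:(lra) ltac:(lra)). nra.
- destruct (Rle_lt_dec (z 40001) (-1 / 10)) as [Hz2|Hz2].
  + pose proof (Y_drop 40001 80000 ltac:(lra) ltac:(lra)) as H.
    assert (80000 - 40001 <= 37500); [|lra]. apply H. intros s Hs.
    pose proof (z_decr 40001 s ltac:(lra) ltac:(lra)). nra.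
  + assert (H : - z 40000 - 4 / 5 * (40000 - 40000) <= - z 40001 - 4 / 5 * (40001 - 40000)).
    { apply (derive_le (fun s => - z s - 4 / 5 * (s - 40000))
        (fun s => - (w s / 2) - 4 / 5)); [lra| |].
      - intros s Hs. pose proof (z_derive s ltac:(lra)) as Dz. clear - Dz. clearbody z w.
        derivative. field.
      - intros s Hs. pose proof (z_decr 40000 s ltac:(lra) ltac:(lra)).
        pose proof (z_decr s 40001 ltac:(lra) ltac:(lra)).
        pose proof (slow_zone s ltac:(lra) ltac:(lra)). lra. }
    lra.
Qed.

End Apriori.

(** * The orthogonal shot *)

(** If [A] and [B] covered the interval, openness of [B] would pass [A] on to limits from the left
    and openness of [A] would extend it to the right, so that [A] would reach [b]. *)
Lemma interval_connected (A B : R -> Prop) (a b : R) :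
  a <= b -> A a -> B b -> (forall x, ~ (A x /\ B x)) ->
  (forall x, a <= x <= b -> A x ->
     exists e, 0 < e /\ forall y, a <= y <= b -> Rabs (y - x) < e -> A y) ->
  (forall x, a <= x <= b -> B x ->
     exists e, 0 < e /\ forall y, a <= y <= b -> Rabs (y - x) < e -> B y) ->
  exists x, a <= x <= b /\ ~ A x /\ ~ B x.
Proof.
intros Hab HA HB Hdis HAo HBo. apply NNPP. intros Hno.
assert (Hall : forall x, a <= x <= b -> A x \/ B x).
{ intros x Hx. apply NNPP. intros Hn. apply Hno. exists x. tauto. }
apply (Hdis b). split; [|exact HB].
apply (real_induction A a b); [|lra].
intros t Ht Hprev.
assert (HAt : A t).
{ destruct (Hall t Ht) as [|HBt]; [assumption|exfalso].
  destruct (Req_dec t a) as [->|Hne]; [apply (Hdis a); auto|].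
  destruct (HBo t Ht HBt) as [e [He H]].
  set (s := Rmax a (t - e / 2)).
  assert (Hs : a <= s < t /\ t - e < s) by (unfold s, Rmax; destruct Rle_dec; lra).
  apply (Hdis s). split; [apply Hprev; lra|]. apply H; [lra|]. apply Rabs_def1; lra. }
split; [exact HAt|].
destruct (HAo t Ht HAt) as [e [He H]]. exists e. split; [exact He|].
intros s Hs Hsb. apply H; [lra|]. apply Rabs_def1; lra.
Qed.

Lemma derive_pos_right (f : R -> R) (t l : R) :
  is_derive f t l -> f t = 0 -> 0 < l -> exists e, 0 < e /\ forall s, t < s < t + e -> 0 < f s.
Proof.
intros Hf H0 Hl. apply is_derive_Reals in Hf. destruct (Hf l Hl) as [d Hd].
exists d. split; [apply cond_pos|]. intros s Hs.
assert (Hh : s - t <> 0) by lra.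
assert (Hh' : Rabs (s - t) < d) by (apply Rabs_def1; lra).
specialize (Hd (s - t) Hh Hh'). replace (t + (s - t)) with s in Hd by ring.
rewrite H0, Rminus_0_r in Hd. apply Rabs_def2 in Hd.
assert (Hq : 0 < f s / (s - t)) by lra.
replace (f s) with (f s / (s - t) * (s - t)) by (field; lra).
apply Rmult_lt_0_compat; lra.
Qed.

(** Strictly below the 1/40000 of [rho2_lower], and below the 1/256 of [agrees]. *)
Definition d_cut : R := 1 / 50000.

Lemma K_max_ge : 20 <= K_max.
Proof.
assert (0 < z_max) by (unfold z_max; pose proof (exp_pos (4 * horizon)); lra).
assert (0 <= V_max).
{ unfold V_max. pose proof (pow2_ge_0 z_max). assert (0 < irho3 (1 / 40000)) by (apply irho3_pos; lra).
  apply Rmult_le_pos; [apply Rmult_le_pos; [apply Rmult_le_pos|]|]; unfold horizon; lra. }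
unfold K_max. pose proof (pow2_ge_0 V_max). lra.
Qed.

Section Shooting.

Variable m : R.
Hypothesis Hmass : mem m masses.

Lemma mass_bounds : 9 / 10 <= m <= 11 / 10.
Proof.
destruct Hmass as [H1 H2]. unfold masses in *. cbn [fst snd] in *.
assert (Hlo : (9 * two30 <= 10 * (two30 - Z.shiftl 1 14))%Z) by (intros H; discriminate H).
assert (Hhi : (10 * (two30 + Z.shiftl 1 14) <= 11 * two30)%Z) by (intros H; discriminate H).
apply IZR_le in Hlo, Hhi. rewrite !mult_IZR in *. pose proof two30_pos. split; nra.
Qed.

Let Phi := cut_field m K_max d_cut.
Let U (th : R) : R -> vec R := picard_limit Phi (brake_state th).

Lemma Phi_lipschitz : exists L B, 0 < L /\ 0 <= B /\ vlipschitz L Phi /\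
  forall x c, Rabs (get c (Phi x)) <= B.
Proof. pose proof K_max_ge. apply cut_field_lipschitz; unfold d_cut; lra. Qed.

Lemma U_start th : U th 0 = brake_state th.
Proof.
destruct Phi_lipschitz as [L [B [HL [HB [Hlip Hbnd]]]]].
apply (picard_limit_follows Phi L B); assumption.
Qed.

Lemma U_follows th : follows Phi (U th).
Proof.
destruct Phi_lipschitz as [L [B [HL [HB [Hlip Hbnd]]]]].
apply (picard_limit_follows Phi L B); assumption.
Qed.

Lemma U_near s : exists M, 0 < M /\ forall th th' t c, 0 <= t <= s ->
  Rabs (get c (U th' t) - get c (U th t)) <= M * Rabs (th' - th).
Proof.
destruct Phi_lipschitz as [L [B [HL [HB [Hlip Hbnd]]]]].
exists (exp (10 * L * s)). split; [apply exp_pos|].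
intros th th' t c Ht.
pose proof (flow_dependence Phi L (U th') (U th) HL Hlip (U_follows th') (U_follows th) t) as Hd.
rewrite !U_start in Hd.
replace (vdist2 (brake_state th') (brake_state th)) with ((th' - th) ^ 2) in Hd
  by (unfold vdist2, brake_state; cbn [vz vw vY vV vE]; ring).
rewrite (Rabs_right t) in Hd by lra.
assert (Hc : (get c (U th' t) - get c (U th t)) ^ 2 <= vdist2 (U th' t) (U th t)).
{ unfold vdist2.
  pose proof (pow2_ge_0 (vz (U th' t) - vz (U th t))). pose proof (pow2_ge_0 (vw (U th' t) - vw (U th t))).
  pose proof (pow2_ge_0 (vY (U th' t) - vY (U th t))). pose proof (pow2_ge_0 (vV (U th' t) - vV (U th t))).
  pose proof (pow2_ge_0 (vE (U th' t) - vE (U th t))).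
  destruct c; cbn [get]; lra. }
assert (He1 : exp (10 * L * t) <= exp (10 * L * s)).
{ destruct (Req_dec t s) as [->|]; [lra|]. left. apply exp_increasing. nra. }
assert (He2 : 1 <= exp (10 * L * s)).
{ destruct (Req_dec s 0) as [->|]; [rewrite Rmult_0_r, exp_0; lra|].
  rewrite <- exp_0 at 1. left. apply exp_increasing. nra. }
assert (Hsq : (get c (U th' t) - get c (U th t)) ^ 2 <= (exp (10 * L * s) * Rabs (th' - th)) ^ 2).
{ rewrite Rpow_mult_distr, pow2_abs.
  pose proof (pow2_ge_0 (th' - th)). apply Rle_trans with (1 := Hc), Rle_trans with (1 := Hd).
  rewrite Rmult_comm. apply Rmult_le_compat_r; [lra|]. nra. }
rewrite <- (pow2_abs (get c (U th' t) - _)) in Hsq.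
assert (0 <= exp (10 * L * s) * Rabs (th' - th)).
{ apply Rmult_le_pos; [lra|apply Rabs_pos]. }
apply Rnot_lt_le. intros Hlt. pose proof (Rabs_pos (get c (U th' t) - get c (U th t))). nra.
Qed.

Lemma Phi_true x : in_region K_max d_cut x -> 0 < rho2 x /\ Phi x = field m x.
Proof.
intros H. split; [|apply cut_field_eq, H]. destruct H as [_ H]. unfold d_cut in H. lra.
Qed.

Lemma follows_on_region th T : (forall t, 0 <= t <= T -> in_region K_max d_cut (U th t)) ->
  follows_on m (U th) T.
Proof.
intros H t Ht. destruct (Phi_true _ (H t Ht)) as [Hr Hf].
split; [exact Hr|]. intros c. rewrite <- Hf. apply U_follows.
Qed.

(** As [w = 0] at the start, negativity of [w] on a whole interval from 0 is not evidently open in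
    [th]. The bound [B] on the field gives an initial stretch, common to all [th], where coordinates
    move by at most 1/4 and [w_negative_before_collision] applies; the remaining times form a
    compact interval. *)
Lemma early : exists e, 0 < e /\ forall th, 65 / 64 <= th <= 3 / 2 ->
  forall t, 0 < t <= e -> vw (U th t) < 0 /\ 0 < vY (U th t).
Proof.
pose proof K_max_ge.
destruct Phi_lipschitz as [L [B [HL [HB [Hlip Hbnd]]]]].
set (e := / (4 * (B + 1))).
assert (He : 0 < e) by (apply Rinv_0_lt_compat; lra).
assert (HBe : B * e <= 1 / 4).
{ unfold e. apply Rmult_le_reg_r with (4 * (B + 1)); [lra|].
  rewrite Rmult_assoc, Rinv_l by lra. lra. }
exists e. split; [exact He|]. intros th Hth.
assert (Hclose : forall t c, 0 <= t <= e ->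
  Rabs (get c (U th t) - get c (brake_state th)) <= 1 / 4).
{ intros t c Ht. rewrite <- (U_start th).
  apply Rle_trans with (B * Rabs (t - 0)).
  - apply (derive_abs_bound (fun s => get c (U th s)) (fun s => get c (Phi (U th s)))).
    + intros r. apply U_follows.
    + intros r. apply Hbnd.
  - rewrite Rminus_0_r, Rabs_right by lra. nra. }
assert (Hfol : follows_on m (U th) e).
{ apply follows_on_region. intros t Ht. split.
  - intros c. pose proof (Hclose t c Ht) as Hc. apply Rabs_le_between in Hc.
    apply Rabs_le. destruct c; cbn [get brake_state vz vw vY vV vE] in *; lra.
  - pose proof (Hclose t CY Ht) as Hc. apply Rabs_le_between in Hc.
    cbn [get brake_state vY] in Hc. unfold rho2, d_cut.
    replace (vz (U th t) ^ 4) with ((vz (U th t) ^ 2) ^ 2) by ring.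
    pose proof (pow2_ge_0 (vz (U th t) ^ 2)). nra. }
intros t Ht.
assert (Hz : forall s, 0 <= s <= t -> 0 < vz (U th s)).
{ intros s Hs. pose proof (Hclose s Cz ltac:(lra)) as Hc. apply Rabs_le_between in Hc.
  cbn [get brake_state vz] in Hc. lra. }
split.
- apply (w_negative_before_collision m th e (U th) mass_bounds Hfol (U_start th)); [lra|exact Hz].
- pose proof (Hclose t CY ltac:(lra)) as Hc. apply Rabs_le_between in Hc.
  cbn [get brake_state vY] in Hc. lra.
Qed.

(** The circle between cut and estimates is broken here. The closed region passes to the limit [t],
    so the true field governs all of [[0, t]]; the estimates then put the state strictly inside, and
    continuity gives more time. *)
Lemma descent_in_region th T : 65 / 64 <= th <= 3 / 2 -> 0 <= T <= horizon ->
  (forall t, 0 < t < T -> vw (U th t) < 0) -> (forall t, 0 < t < T -> 0 < vY (U th t)) ->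
  forall t, 0 <= t <= T -> in_region K_max d_cut (U th t).
Proof.
intros Hth HT Hw HY. pose proof K_max_ge as HK.
apply (real_induction (fun t => in_region K_max d_cut (U th t)) 0 T).
intros t Ht Hprev.
assert (Hd : forall c, is_derive (fun s => get c (U th s)) t (get c (Phi (U th t)))).
{ intros c. apply U_follows. }
assert (Hr : is_derive (fun s => rho2 (U th s)) t
   (2 * vY (U th t) * vY (Phi (U th t)) + vz (U th t) ^ 3 * vz (Phi (U th t)))).
{ apply is_derive_rho2; [apply (Hd Cz)|apply (Hd CY)]. }
assert (Hin : in_region K_max d_cut (U th t)).
{ destruct (Req_dec t 0) as [->|Hne].
  - rewrite U_start. split.
    + intros c. apply Rabs_le. destruct c; cbn [get brake_state vz vw vY vV vE]; lra.
    + unfold rho2, brake_state, d_cut; cbn [vz vY]. nra.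
  - split.
    + intros c. apply Rabs_le.
      assert (H1 : 0 <= get c (U th t) + K_max).
      { apply (limit_nonneg (fun s => get c (U th s) + K_max) t (get c (Phi (U th t)) + 0)); [lra| |].
        - apply (is_derive_plus (V := R_NormedModule) (fun s => get c (U th s)) (fun _ => K_max)); [apply Hd|].
          exact (is_derive_const (V := R_NormedModule) K_max t).
        - intros s Hs. destruct (Hprev s ltac:(lra)) as [Hc _]. specialize (Hc c).
          apply Rabs_le_between in Hc. lra. }
      assert (H2 : 0 <= K_max - get c (U th t)).
      { apply (limit_nonneg (fun s => K_max - get c (U th s)) t (0 - get c (Phi (U th t)))); [lra| |].
        - apply (is_derive_minus (V := R_NormedModule) (fun _ => K_max) (fun s => get c (U th s))); [|apply Hd].
          exact (is_derive_const (V := R_NormedModule) K_max t).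
        - intros s Hs. destruct (Hprev s ltac:(lra)) as [Hc _]. specialize (Hc c).
          apply Rabs_le_between in Hc. lra. }
      lra.
    + assert (H : 0 <= rho2 (U th t) - d_cut); [|lra].
      eapply (limit_nonneg (fun s => rho2 (U th s) - d_cut) t (_ - 0)); [lra| |].
      * apply (is_derive_minus (V := R_NormedModule) (fun s => rho2 (U th s)) (fun _ => d_cut)); [apply Hr|].
        exact (is_derive_const (V := R_NormedModule) d_cut t).
      * intros s Hs. destruct (Hprev s ltac:(lra)) as [_ Hc]. lra. }
split; [exact Hin|].
assert (Hfol : follows_on m (U th) t).
{ apply follows_on_region. intros s Hs. destruct (Req_dec s t) as [->|]; [exact Hin|apply Hprev; lra]. }
assert (Hw' : forall s, 0 < s < t -> vw (U th s) < 0) by (intros; apply Hw; lra).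
assert (HY' : forall s, 0 < s < t -> 0 < vY (U th s)) by (intros; apply HY; lra).
assert (Hb : forall c, Rabs (get c (U th t)) <= K_max - 1).
{ apply (region_bound m th t (U th) mass_bounds Hth Hfol (U_start th) Hw' HY'); lra. }
assert (Hrb : 1 / 40000 <= rho2 (U th t)).
{ apply (rho2_lower m th t (U th) mass_bounds Hth Hfol (U_start th) Hw' HY'); lra. }
assert (Hnear : forall c, exists e, 0 < e /\ forall s, t < s < t + e -> Rabs (get c (U th s)) <= K_max).
{ intros c. destruct (is_derive_near _ t _ 1 (Hd c)) as [e [He H]]; [lra|].
  exists e. split; [exact He|]. intros s Hs.
  assert (Hs' : Rabs (s - t) < e) by (apply Rabs_def1; lra).
  specialize (H s Hs'). specialize (Hb c).
  replace (get c (U th s)) with ((get c (U th s) - get c (U th t)) + get c (U th t)) by ring.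
  apply Rle_trans with (1 := Rabs_triang _ _). lra. }
destruct (continuous_near _ t _ d_cut Hr) as [e0 [He0 Hn0]]; [unfold d_cut; lra|].
destruct (Hnear Cz) as [e1 [He1 Hn1]]. destruct (Hnear Cw) as [e2 [He2 Hn2]].
destruct (Hnear CY) as [e3 [He3 Hn3]]. destruct (Hnear CV) as [e4 [He4 Hn4]].
destruct (Hnear CE) as [e5 [He5 Hn5]].
exists (Rmin (Rmin e0 e1) (Rmin (Rmin e2 e3) (Rmin e4 e5))).
split; [repeat apply Rmin_glb_lt; assumption|].
intros s Hs _.
pose proof (Rmin_l (Rmin e0 e1) (Rmin (Rmin e2 e3) (Rmin e4 e5))).
pose proof (Rmin_r (Rmin e0 e1) (Rmin (Rmin e2 e3) (Rmin e4 e5))).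
pose proof (Rmin_l e0 e1). pose proof (Rmin_r e0 e1).
pose proof (Rmin_l (Rmin e2 e3) (Rmin e4 e5)). pose proof (Rmin_r (Rmin e2 e3) (Rmin e4 e5)).
pose proof (Rmin_l e2 e3). pose proof (Rmin_r e2 e3).
pose proof (Rmin_l e4 e5). pose proof (Rmin_r e4 e5).
split; [|left; apply Hn0; lra].
intros c; destruct c; [apply Hn1|apply Hn2|apply Hn3|apply Hn4|apply Hn5]; lra.
Qed.

Lemma descent_follows th T : 65 / 64 <= th <= 3 / 2 -> 0 <= T <= horizon ->
  (forall t, 0 < t < T -> vw (U th t) < 0) -> (forall t, 0 < t < T -> 0 < vY (U th t)) ->
  follows_on m (U th) T.
Proof. intros. apply follows_on_region, descent_in_region; assumption. Qed.

(** [Y] is required to be negative and not merely 0, which makes the condition open in [th]; so is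
    [0 < w] in [turning_first]. *)
Definition syzygy_first (th : R) : Prop :=
  exists s, 0 < s /\ vY (U th s) < 0 /\ forall t, 0 < t <= s -> vw (U th t) < 0.

Definition turning_first (th : R) : Prop :=
  exists s, 0 < s /\ 0 < vw (U th s) /\ forall t, 0 <= t <= s -> 0 < vY (U th t).

Lemma agrees_Phi : agrees m Phi.
Proof. pose proof K_max_ge. apply cut_field_agrees; [lra|unfold d_cut; lra]. Qed.

(** Where the computation shows only [z > 0], [z] was positive all along because it has been
    decreasing, and then [w < 0]. The decrease rests on the sign of [w] in the past, hence the
    induction. *)
Lemma syzygy_first_low : syzygy_first (65 / 64).
Proof.
destruct (low_shot m Phi (U (65 / 64)) Hmass agrees_Phi (U_follows _) (U_start _))
  as [s [Hs [HYs [Hws Hin]]]].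
assert (Hs0 : s <> 0).
{ intros ->. rewrite U_start in HYs. cbn [brake_state vY] in HYs. lra. }
exists s. split; [lra|]. split; [exact HYs|].
destruct early as [e [He Hearly]].
assert (H : forall t, 0 <= t <= s -> t = s \/ t = 0 \/ vw (U (65 / 64) t) < 0).
{ apply (real_induction (fun t => t = s \/ t = 0 \/ vw (U (65 / 64) t) < 0)).
  intros t Ht Hprev.
  destruct (Req_dec t s) as [->|Hts].
  { split; [left; reflexivity|]. exists 1. split; [lra|]. intros; lra. }
  destruct (Req_dec t 0) as [->|Ht0].
  { split; [right; left; reflexivity|]. exists e. split; [exact He|].
    intros r Hr _. right; right. apply Hearly; lra. }
  assert (Hfol : follows_on m (U (65 / 64)) t).
  { intros r Hr. destruct (Hin r ltac:(lra)) as [Hr1 [Hr2 _]].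
    split; [exact Hr1|]. intros c. rewrite <- Hr2. apply U_follows. }
  assert (Hw : forall r, 0 < r < t -> vw (U (65 / 64) r) < 0).
  { intros r Hr. destruct (Hprev r ltac:(lra)) as [|[|]]; lra. }
  assert (Hwt : vw (U (65 / 64) t) < 0).
  { destruct (Hin t ltac:(lra)) as [_ [_ [Hz|Hw']]]; [|exact Hw'].
    apply (w_negative_before_collision m (65 / 64) t (U (65 / 64)) mass_bounds Hfol (U_start _)); [lra|].
    intros r Hr. apply Rlt_le_trans with (1 := Hz).
      apply (z_decr m t (U (65 / 64)) Hfol Hw); lra. }
  split; [right; right; exact Hwt|].
  destruct (continuous_near (fun s => - vw (U (65 / 64) s)) t (- vw (Phi (U (65 / 64) t))) 0)
    as [e' [He' Hn]]; [|lra|].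
  - apply (is_derive_opp (V := R_NormedModule) (fun s => vw (U (65 / 64) s))).
    apply (U_follows _ t Cw).
  - exists e'. split; [exact He'|]. intros r Hr _. right; right. specialize (Hn r Hr). lra. }
intros t Ht. destruct (H t ltac:(lra)) as [->|[|]]; [exact Hws|lra|assumption].
Qed.

Lemma turning_first_high : turning_first (3 / 2).
Proof.
destruct (high_shot m Phi (U (3 / 2)) Hmass agrees_Phi (U_follows _) (U_start _))
  as [s [Hs [Hws Hin]]].
exists s. split; [|split; assumption].
destruct (Req_dec s 0) as [->|]; [|lra].
rewrite U_start in Hws. cbn [brake_state vw] in Hws. lra.
Qed.

Lemma U_continuous th c t : continuity_pt (fun s => get c (U th s)) t.
Proof.
apply continuity_pt_filterlim. apply (ex_derive_continuous (fun s => get c (U th s)) t).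
eexists. apply U_follows.
Qed.

(** On [[e, s]] the maximum of [w] is negative and survives a small change of [th]; on the initial
    stretch [early] applies. *)
Lemma syzygy_first_open th : 65 / 64 <= th <= 3 / 2 -> syzygy_first th ->
  exists d, 0 < d /\ forall th', 65 / 64 <= th' <= 3 / 2 -> Rabs (th' - th) < d -> syzygy_first th'.
Proof.
intros Hth [s [Hs [HYs Hw]]].
destruct early as [e [He Hearly]].
assert (Hes : e < s).
{ apply Rnot_le_lt. intros Hle. destruct (Hearly th Hth s ltac:(lra)). lra. }
destruct (continuity_ab_maj (fun t => vw (U th t)) e s) as [a [Ha1 Ha2]]; [lra| |].
{ intros t _. apply (U_continuous th Cw). }
destruct (U_near s) as [M [HM Hnear]].
pose proof (Hw a ltac:(lra)) as Hwa.
exists (Rmin (- vY (U th s)) (- vw (U th a)) / M).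
assert (Hmin : 0 < Rmin (- vY (U th s)) (- vw (U th a))) by (apply Rmin_glb_lt; lra).
split; [apply Rdiv_lt_0_compat; assumption|].
intros th' Hth' Hd.
assert (Hd' : M * Rabs (th' - th) < Rmin (- vY (U th s)) (- vw (U th a))).
{ apply (Rmult_lt_compat_l M) in Hd; [|exact HM].
  replace (M * (Rmin (- vY (U th s)) (- vw (U th a)) / M)) with
    (Rmin (- vY (U th s)) (- vw (U th a))) in Hd by (field; lra). exact Hd. }
pose proof (Rmin_l (- vY (U th s)) (- vw (U th a))).
pose proof (Rmin_r (- vY (U th s)) (- vw (U th a))).
exists s. split; [exact Hs|]. split.
- pose proof (Hnear th th' s CY ltac:(lra)) as Hn. apply Rabs_le_between in Hn.
  cbn [get] in Hn. lra.
- intros t Ht. destruct (Rle_lt_dec t e) as [Hte|Hte].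
  + apply Hearly; [exact Hth'|lra].
  + pose proof (Hnear th th' t Cw ltac:(lra)) as Hn. apply Rabs_le_between in Hn.
    cbn [get] in Hn. pose proof (Ha1 t ltac:(lra)) as Hta. cbv beta in Hta. lra.
Qed.

Lemma turning_first_open th : 65 / 64 <= th <= 3 / 2 -> turning_first th ->
  exists d, 0 < d /\ forall th', 65 / 64 <= th' <= 3 / 2 -> Rabs (th' - th) < d -> turning_first th'.
Proof.
intros Hth [s [Hs [Hws HY]]].
destruct (continuity_ab_min (fun t => vY (U th t)) 0 s) as [a [Ha1 Ha2]]; [lra| |].
{ intros t _. apply (U_continuous th CY). }
destruct (U_near s) as [M [HM Hnear]].
pose proof (HY a ltac:(lra)) as HYa.
exists (Rmin (vw (U th s)) (vY (U th a)) / M).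
assert (Hmin : 0 < Rmin (vw (U th s)) (vY (U th a))) by (apply Rmin_glb_lt; lra).
split; [apply Rdiv_lt_0_compat; assumption|].
intros th' Hth' Hd.
assert (Hd' : M * Rabs (th' - th) < Rmin (vw (U th s)) (vY (U th a))).
{ apply (Rmult_lt_compat_l M) in Hd; [|exact HM].
  replace (M * (Rmin (vw (U th s)) (vY (U th a)) / M)) with
    (Rmin (vw (U th s)) (vY (U th a))) in Hd by (field; lra). exact Hd. }
pose proof (Rmin_l (vw (U th s)) (vY (U th a))).
pose proof (Rmin_r (vw (U th s)) (vY (U th a))).
exists s. split; [exact Hs|]. split.
- pose proof (Hnear th th' s Cw ltac:(lra)) as Hn. apply Rabs_le_between in Hn.
  cbn [get] in Hn. lra.
- intros t Ht. pose proof (Hnear th th' t CY ltac:(lra)) as Hn. apply Rabs_le_between in Hn.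
  cbn [get] in Hn. pose proof (Ha1 t ltac:(lra)) as Hta. cbv beta in Hta. lra.
Qed.

Lemma syzygy_turning_exclusive th : ~ (syzygy_first th /\ turning_first th).
Proof.
intros [[s [Hs [HYs Hw]]] [r [Hr [Hwr HY]]]].
destruct (Rle_lt_dec s r) as [H|H].
- pose proof (HY s ltac:(lra)). lra.
- pose proof (Hw r ltac:(lra)). lra.
Qed.

(** Take [th] in neither class. The regime [w < 0 < Y] must end before [horizon]. If only one of the
    two vanished at its end, it would do so with nonzero derivative, change sign, and put [th] in a
    class; so both vanish. *)
Lemma orthogonal_shot : exists th S, 65 / 64 <= th <= 3 / 2 /\ 0 < S <= horizon /\
  vw (U th S) = 0 /\ vY (U th S) = 0 /\
  (forall t, 0 < t < S -> vw (U th t) < 0) /\ (forall t, 0 < t < S -> 0 < vY (U th t)).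
Proof.
destruct (interval_connected syzygy_first turning_first (65 / 64) (3 / 2)) as [th [Hth [HnA HnB]]].
- lra.
- exact syzygy_first_low.
- exact turning_first_high.
- exact syzygy_turning_exclusive.
- exact syzygy_first_open.
- exact turning_first_open.
- exists th. apply NNPP. intros Hno.
  destruct early as [e [He Hearly]].
  assert (H : forall t, 0 <= t <= horizon -> t = 0 \/ (vw (U th t) < 0 /\ 0 < vY (U th t))).
  { apply (real_induction (fun t => t = 0 \/ (vw (U th t) < 0 /\ 0 < vY (U th t)))).
    intros t Ht Hprev.
    destruct (Req_dec t 0) as [->|Ht0].
    { split; [left; reflexivity|]. exists e. split; [exact He|].
      intros r Hr _. right. apply Hearly; [exact Hth|lra]. }
    assert (Hw : forall s, 0 < s < t -> vw (U th s) < 0).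
    { intros s Hs. destruct (Hprev s ltac:(lra)) as [|[]]; lra. }
    assert (HY : forall s, 0 < s < t -> 0 < vY (U th s)).
    { intros s Hs. destruct (Hprev s ltac:(lra)) as [|[]]; lra. }
    pose proof (descent_follows th t Hth ltac:(lra) Hw HY) as Hfol.
    assert (Hwt : vw (U th t) <= 0).
    { apply (w_nonpos m th t (U th) Hfol (U_start th) Hw); lra. }
    assert (HYt : 0 <= vY (U th t)).
    { apply (Y_nonneg m th t (U th) Hth Hfol (U_start th) HY); lra. }
    destruct (Hfol t ltac:(lra)) as [Hr Hd].
    pose proof (Hd Cw) as Dw. pose proof (Hd CY) as DY. cbn [get field vw vY] in Dw, DY.
    destruct (Req_dec (vw (U th t)) 0) as [Hw0|Hw0]; destruct (Req_dec (vY (U th t)) 0) as [HY0|HY0].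
    - exfalso. apply Hno. exists t. repeat split; try assumption; lra.
    - exfalso. apply HnB.
      assert (Hz : vz (U th t) < 0).
      { apply (before_turning m th t (U th) mass_bounds Hfol (U_start th) Hw); lra || assumption. }
      assert (HL : vw (U th t) ^ 2 / 4 = 1 + vz (U th t) ^ 2 * vE (U th t)).
      { apply (level_zero m th t (U th) Hfol (U_start th)). lra. }
      assert (Hg : 0 < irho3 (rho2 (U th t))) by (apply irho3_pos, Hr).
      (* Here [w' > 0]: from [w = 0] follows [z^2 E = -1], so [z E > 0], and [- m z^5 g > 0] because
         [z < 0]. *)
      destruct (derive_pos_right _ t _ Dw Hw0) as [e1 [He1 Hn1]].
      { set (zt := vz (U th t)) in *. set (Et := vE (U th t)) in *. set (gt := irho3 _) in *.
        rewrite Hw0 in HL.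
        assert (0 < 2 * zt * Et).
        { assert (H1 : zt * (zt * Et) = -1) by nra. assert (0 < zt * Et); [|lra].
          apply Rnot_le_lt. intros Hle. nra. }
        assert (Hz5 : 0 < - zt ^ 5) by (replace (- zt ^ 5) with ((- zt) ^ 5) by ring; apply pow_lt; lra).
        pose proof mass_bounds.
        assert (0 < m * - zt ^ 5 * gt) by (repeat apply Rmult_lt_0_compat; lra).
        lra. }
      destruct (continuous_near _ t _ 0 DY) as [e2 [He2 Hn2]]; [lra|].
      set (d := Rmin (e1 / 2) (e2 / 2)).
      assert (Hdpos : 0 < d /\ d < e1 /\ d < e2) by (unfold d, Rmin; destruct Rle_dec; lra).
      exists (t + d). split; [lra|]. split; [apply Hn1; lra|].
      intros s Hs. destruct (Rtotal_order s t) as [Hst|[->|Hst]].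
      + destruct (Req_dec s 0) as [->|]; [rewrite U_start; cbn [brake_state vY]; lra|apply HY; lra].
      + lra.
      + apply Hn2. lra.
    - exfalso. apply HnA.
      assert (Hz : vz (U th t) < 0).
      { apply (before_syzygy m th t (U th) mass_bounds Hth Hfol (U_start th) Hw); lra || assumption. }
      assert (HV : vV (U th t) < 0).
      { apply (V_negative m th t (U th) mass_bounds ltac:(lra) Hfol (U_start th) HY). lra. }
      (* Here [Y' = z^2 V < 0], as [z] and [V] are both negative. *)
      destruct (derive_pos_right (fun s => - vY (U th s)) t (- (vz (U th t) ^ 2 * vV (U th t))))
        as [e1 [He1 Hn1]].
      { apply (is_derive_opp (V := R_NormedModule) (fun s => vY (U th s))), DY. }
      { lra. }
      { assert (0 < vz (U th t) ^ 2) by nra. nra. }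
      destruct (continuous_near (fun s => - vw (U th s)) t (- vw (field m (U th t))) 0) as [e2 [He2 Hn2]]; [|lra|].
      { apply (is_derive_opp (V := R_NormedModule) (fun s => vw (U th s))), (Hd Cw). }
      set (d := Rmin (e1 / 2) (e2 / 2)).
      assert (Hdpos : 0 < d /\ d < e1 /\ d < e2) by (unfold d, Rmin; destruct Rle_dec; lra).
      exists (t + d). split; [lra|]. split; [pose proof (Hn1 (t + d) ltac:(lra)); lra|].
      intros s Hs. destruct (Rtotal_order s t) as [Hst|[->|Hst]].
      + apply Hw. lra.
      + lra.
      + pose proof (Hn2 s ltac:(lra)). lra.
    - split; [right; lra|].
      destruct (continuous_near _ t _ 0 DY) as [e2 [He2 Hn2]]; [lra|].
      destruct (continuous_near (fun s => - vw (U th s)) t (- vw (field m (U th t))) 0) as [e1 [He1 Hn1]]; [|lra|].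
      { apply (is_derive_opp (V := R_NormedModule) (fun s => vw (U th s))), (Hd Cw). }
      exists (Rmin e1 e2). split; [apply Rmin_glb_lt; assumption|].
      intros s Hs _. pose proof (Rmin_l e1 e2). pose proof (Rmin_r e1 e2).
      right. pose proof (Hn1 s ltac:(lra)). split; [lra|]. apply Hn2. lra. }
  assert (Hh : 0 < horizon) by (unfold horizon; lra).
  assert (Hw : forall s, 0 < s < horizon -> vw (U th s) < 0).
  { intros s Hs. destruct (H s ltac:(lra)) as [|[]]; lra. }
  assert (HY : forall s, 0 < s < horizon -> 0 < vY (U th s)).
  { intros s Hs. destruct (H s ltac:(lra)) as [|[]]; lra. }
  pose proof (descent_follows th horizon Hth ltac:(lra) Hw HY) as Hfol.
  pose proof (horizon_not_reached m th horizon (U th) mass_bounds Hth Hfol (U_start th) Hw HY).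
  lra.
Qed.

(** * Continuation by symmetry to a periodic orbit *)

Lemma follows_shift (Psi : vec R -> vec R) (u : R -> vec R) (a : R) :
  follows Psi u -> follows Psi (fun s => u (a + s)).
Proof.
intros Hu t c. specialize (Hu (a + t) c).
set (f := fun s => get c (u s)). change (is_derive f (a + t) (get c (Psi (u (a + t))))) in Hu.
change (is_derive (fun s => f (a + s)) t (get c (Psi (u (a + t))))).
set (l := get c _) in *. clearbody f l.
auto_derive; [exists l; exact Hu|].
replace (Derive _ _) with l by (symmetry; apply is_derive_unique; exact Hu). ring.
Qed.

Lemma reverse_involutive x : reverse (reverse x) = x.
Proof. apply vec_ext. intros c; destruct c; cbn; ring. Qed.

Lemma flip_involutive x : flip (flip x) = x.
Proof. apply vec_ext. intros c; destruct c; cbn; ring. Qed.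

Lemma in_region_reverse K d x : in_region K d (reverse x) <-> in_region K d x.
Proof.
unfold in_region, rho2, reverse; cbn [vz vY].
split; intros [H1 H2]; (split; [intros c; specialize (H1 c)|exact H2]);
  destruct c; cbn [get vz vw vY vV vE] in *; rewrite ?Rabs_Ropp in *; exact H1.
Qed.

Lemma in_region_flip K d x : in_region K d (flip x) <-> in_region K d x.
Proof.
unfold in_region, rho2, flip; cbn [vz vY].
replace ((- vY x) ^ 2) with (vY x ^ 2) by ring.
split; intros [H1 H2]; (split; [intros c; specialize (H1 c)|exact H2]);
  destruct c; cbn [get vz vw vY vV vE] in *; rewrite ?Rabs_Ropp in *; exact H1.
Qed.

(** The state at 0 is fixed by [reverse], the one at [S] by [reverse] followed by [flip]. By
    uniqueness the orbit is symmetric about both instants, and the two symmetries compose to a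
    [flip] after time [2 S]. They also carry the bounds from [[0, S]] to the whole line, where the
    cut is therefore never felt. *)
Lemma symmetric_orbit : exists th S u,
  65 / 64 <= th <= 3 / 2 /\ 0 < S /\ u 0 = brake_state th /\
  (forall T, follows_on m u T) /\
  (forall t, 0 < rho2 (u t) /\ forall c, is_derive (fun s => get c (u s)) t (get c (field m (u t)))) /\
  vw (u S) = 0 /\ vY (u S) = 0 /\
  (forall t, 0 < t < S -> vw (u t) < 0) /\ (forall t, 0 < t < S -> 0 < vY (u t)) /\
  (forall t, u (- t) = reverse (u t)) /\ (forall t, u (t + 4 * S) = u t).
Proof.
pose proof K_max_ge.
destruct Phi_lipschitz as [L [B [HL [HB [Hlip Hbnd]]]]].
destruct orthogonal_shot as [th [S [Hth [HS [HwS [HYS [Hw HY]]]]]]].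
set (u := U th) in *.
assert (Hu : follows Phi u) by apply U_follows.
assert (Hrev : forall t, u (- t) = reverse (u t)).
{ intros t. rewrite <- (reverse_involutive (u (- t))). f_equal.
  replace (- t) with (0 - t) by ring.
  apply (flow_unique Phi L (fun s => reverse (u (0 - s))) u HL Hlip); [|exact Hu|].
  - apply follows_reverse; [lra|exact Hu].
  - unfold u. rewrite Rminus_0_r, U_start. apply vec_ext. intros c; destruct c; cbn; ring. }
assert (Hrefl : forall t, u (S + t) = flip (reverse (u (2 * S - (S + t))))).
{ intros t.
  apply (flow_unique Phi L (fun s => u (S + s)) (fun s => flip (reverse (u (2 * S - (S + s))))) HL Hlip).
  - apply follows_shift, Hu.
  - apply (follows_shift Phi (fun s => flip (reverse (u (2 * S - s)))) S).
    apply follows_flip; [lra|]. apply follows_reverse; [lra|exact Hu].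
  - rewrite !Rplus_0_r. replace (2 * S - S) with S by ring.
    apply vec_ext. intros c; destruct c; cbn [get flip reverse vz vw vY vV vE]; rewrite ?HwS, ?HYS; ring. }
assert (Hflip : forall t, u (t + 2 * S) = flip (u t)).
{ intros t. replace (t + 2 * S) with (S + (S + t)) by ring. rewrite Hrefl.
  replace (2 * S - (S + (S + t))) with (- t) by ring.
  rewrite Hrev, reverse_involutive. reflexivity. }
assert (Hper : forall t, u (t + 4 * S) = u t).
{ intros t. replace (t + 4 * S) with (t + 2 * S + 2 * S) by ring.
  rewrite !Hflip, flip_involutive. reflexivity. }
assert (Hreg0 : forall t, 0 <= t <= S -> in_region K_max d_cut (u t)).
{ apply descent_in_region; try assumption. lra. }
assert (Hreg2 : forall t, - S <= t <= S -> in_region K_max d_cut (u t)).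
{ intros t Ht. destruct (Rle_lt_dec 0 t); [apply Hreg0; lra|].
  replace t with (- - t) by ring. rewrite Hrev. apply in_region_reverse, Hreg0. lra. }
assert (Hregn : forall n t, - S <= t <= S + 2 * S * INR n -> in_region K_max d_cut (u t)).
{ induction n as [|n IH]; intros t Ht.
  - apply Hreg2. simpl in Ht. lra.
  - rewrite S_INR in Ht. destruct (Rle_lt_dec t (S + 2 * S * INR n)); [apply IH; lra|].
    replace t with ((t - 2 * S) + 2 * S) by ring. rewrite Hflip. apply in_region_flip, IH.
    pose proof (pos_INR n). nra. }
assert (Hreg : forall t, in_region K_max d_cut (u t)).
{ assert (Hp : forall t, 0 <= t -> in_region K_max d_cut (u t)).
  { intros t Ht. destruct (INR_unbounded (t / (2 * S))) as [n Hn].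
    apply (Hregn n). split; [lra|].
    apply (Rmult_lt_compat_l (2 * S)) in Hn; [|lra].
    replace (2 * S * (t / (2 * S))) with t in Hn by (field; lra). lra. }
  intros t. destruct (Rle_lt_dec 0 t); [apply Hp; assumption|].
  replace t with (- - t) by ring. rewrite Hrev. apply in_region_reverse, Hp. lra. }
exists th, S, u. split; [exact Hth|]. split; [lra|]. split; [apply U_start|].
split; [intros T; apply follows_on_region; intros; apply Hreg|].
split.
{ intros t. destruct (Phi_true _ (Hreg t)) as [Hr Hf].
  split; [exact Hr|]. intros c. rewrite <- Hf. apply Hu. }
repeat split; assumption.
Qed.

End Shooting.

(** * From the regularized flow to Newton's equations *)

Lemma inverse_derive (f g : R -> R) (t a : R) :
  (forall x y, x < y -> f x < f y) -> (forall x, f (g x) = x) ->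
  is_derive f (g t) a -> 0 < a -> is_derive g t (/ a).
Proof.
intros Hinc Hfg Hf Ha.
assert (Hg : forall x y, x < y -> g x < g y).
{ intros x y Hxy. apply Rnot_le_lt. intros Hle.
  destruct (Req_dec (g y) (g x)) as [He|Hne].
  - apply (f_equal f) in He. rewrite !Hfg in He. lra.
  - assert (H := Hinc (g y) (g x)). rewrite !Hfg in H. lra. }
assert (Hcont : forall e, 0 < e -> exists d, 0 < d /\ forall x, Rabs (x - t) < d -> Rabs (g x - g t) < e).
{ intros e He.
  pose proof (Hinc (g t - e) (g t) ltac:(lra)) as H1. pose proof (Hinc (g t) (g t + e) ltac:(lra)) as H2.
  rewrite Hfg in H1, H2.
  exists (Rmin (t - f (g t - e)) (f (g t + e) - t)). split; [apply Rmin_glb_lt; lra|].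
  intros x Hx.
  pose proof (Rmin_l (t - f (g t - e)) (f (g t + e) - t)).
  pose proof (Rmin_r (t - f (g t - e)) (f (g t + e) - t)).
  apply Rabs_def2 in Hx. apply Rabs_def1.
  - apply Rnot_le_lt. intros Hle.
    destruct (Req_dec (g x) (g t + e)) as [He'|Hne].
    + apply (f_equal f) in He'. rewrite Hfg in He'. lra.
    + pose proof (Hinc (g t + e) (g x) ltac:(lra)) as Hc. rewrite Hfg in Hc. lra.
  - apply Rnot_le_lt. intros Hle.
    destruct (Req_dec (g x) (g t - e)) as [He'|Hne].
    + apply (f_equal f) in He'. rewrite Hfg in He'. lra.
    + pose proof (Hinc (g x) (g t - e) ltac:(lra)) as Hc. rewrite Hfg in Hc. lra. }
apply is_derive_Reals in Hf. apply is_derive_Reals. intros eps Heps.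
(* The first entry keeps the quotient [q] of [f] above [a / 2]; the second then makes
   [|a - q| / (q a)] smaller than [eps]. *)
set (e1 := Rmin (a / 2) (eps * a * a / 4)).
assert (He1 : 0 < e1).
{ apply Rmin_glb_lt; [lra|]. assert (0 < eps * a * a) by (repeat apply Rmult_lt_0_compat; lra). lra. }
destruct (Hf e1 He1) as [d1 Hd1].
destruct (Hcont d1 (cond_pos d1)) as [d2 [Hd2 Hd2']].
exists (mkposreal d2 Hd2). intros k Hk Hk'. simpl in Hk'.
set (h := g (t + k) - g t).
assert (Hh : h <> 0).
{ unfold h. destruct (Rtotal_order k 0) as [Hneg|[He|Hpos]]; [|contradiction|].
  - pose proof (Hg (t + k) t ltac:(lra)). lra.
  - pose proof (Hg t (t + k) ltac:(lra)). lra. }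
assert (Hhd : Rabs h < d1).
{ apply Hd2'. replace (t + k - t) with k by ring. exact Hk'. }
specialize (Hd1 h Hh Hhd).
replace (g t + h) with (g (t + k)) in Hd1 by (unfold h; ring).
rewrite !Hfg in Hd1. replace (t + k - t) with k in Hd1 by ring.
set (q := k / h) in *.
assert (He1a : e1 <= a / 2) by apply Rmin_l.
assert (He1b : e1 <= eps * a * a / 4) by apply Rmin_r.
assert (Hq : a / 2 < q) by (apply Rabs_def2 in Hd1; lra).
replace (h / k) with (/ q) by (unfold q; field; split; assumption).
replace (/ q - / a) with ((a - q) * / (q * a)) by (field; lra).
assert (Hqa : 0 < q * a) by (apply Rmult_lt_0_compat; lra).
rewrite Rabs_mult, (Rabs_right (/ (q * a))) by (apply Rle_ge; left; apply Rinv_0_lt_compat, Hqa).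
rewrite Rabs_minus_sym.
apply Rmult_lt_reg_r with (q * a); [exact Hqa|].
rewrite Rmult_assoc, Rinv_l, Rmult_1_r by lra.
apply Rlt_le_trans with (1 := Hd1). 
apply Rle_trans with (eps * a * a / 4); [lra|]. 
assert (0 < eps * a) by (apply Rmult_lt_0_compat; lra). nra.
Qed.

(** * Plane curves and the gradient of the potential at isosceles configurations *)

Lemma is_deriveC_pair (f1 f2 : R -> R) (t l1 l2 : R) :
  is_derive f1 t l1 -> is_derive f2 t l2 -> is_deriveC (fun s => (f1 s, f2 s)) t (l1, l2).
Proof.
intros H1 H2. unfold is_deriveC.
pose proof (is_derive_scal_l (V := C_R_NormedModule) f1 t l1 (1, 0) H1) as D1.
pose proof (is_derive_scal_l (V := C_R_NormedModule) f2 t l2 (0, 1) H2) as D2.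
pose proof (is_derive_plus (V := C_R_NormedModule) _ _ _ _ _ D1 D2) as D.
eapply is_derive_ext; [|replace (l1, l2) with (@plus C_R_NormedModule (@scal _ C_R_NormedModule l1 (1, 0)) (@scal _ C_R_NormedModule l2 (0, 1))); [exact D|]].
- intros s. cbv beta. apply injective_projections; unfold scal, plus; simpl;
    unfold mult, plus, scal; simpl; unfold mult; simpl; ring.
- apply injective_projections; unfold scal, plus; simpl;
    unfold mult, plus, scal; simpl; unfold mult; simpl; ring.
Qed.

Lemma is_deriveC_fst (f : R -> C) (t : R) (l : C) :
  is_deriveC f t l -> is_derive (fun s => fst (f s)) t (fst l).
Proof.
intros H. unfold is_deriveC, is_derive in *.
apply (filterdiff_comp (U := R_NormedModule) f (fun c : C => fst c) _ (fun c : C => fst c)) in H.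
- exact H.
- apply filterdiff_linear. apply (is_linear_fst (U := R_NormedModule) (V := R_NormedModule)).
Qed.

Lemma is_deriveC_snd (f : R -> C) (t : R) (l : C) :
  is_deriveC f t l -> is_derive (fun s => snd (f s)) t (snd l).
Proof.
intros H. unfold is_deriveC, is_derive in *.
apply (filterdiff_comp (U := R_NormedModule) f (fun c : C => snd c) _ (fun c : C => snd c)) in H.
- exact H.
- apply filterdiff_linear. apply (is_linear_snd (U := R_NormedModule) (V := R_NormedModule)).
Qed.

Lemma Cmod_sqr (c : C) : Cmod c ^ 2 = fst c ^ 2 + snd c ^ 2.
Proof.
unfold Cmod. rewrite <- Rsqr_pow2, Rsqr_sqrt; [reflexivity|].
apply Rplus_le_le_0_compat; apply pow2_ge_0.
Qed.

(* Bodies 1 and 2 sit at (-X/2, .) and (X/2, .), and body 3 on the second axis. *)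
Definition placed (m a b : R) : config := fun i =>
  match i with
  | B1 => (- a / 2, - (m / (2 + m)) * b)
  | B2 => (a / 2, - (m / (2 + m)) * b)
  | B3 => (0, 2 / (2 + m) * b)
  end.

Lemma placed_derive (m : R) (a b : R -> R) (t da db : R) :
  is_derive a t da -> is_derive b t db -> velocity (fun r => placed m (a r) (b r)) t (placed m da db).
Proof.
intros Ha Hb i.
assert (Hs : forall k, is_derive (fun r => k * b r) t (k * db)).
{ intros k. apply (is_derive_scal b), Hb. }
assert (Ha2 : is_derive (fun r => a r / 2) t (da / 2)) by (clear Hs; derivative; field).
assert (Ha2' : is_derive (fun r => - a r / 2) t (- da / 2)) by (clear Hs; derivative; field).
destruct i; cbn [placed]; apply is_deriveC_pair; auto.
exact (is_derive_const (V := R_NormedModule) 0 t).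
Qed.

Definition dist2 (a b : C) : R := (fst a - fst b) ^ 2 + (snd a - snd b) ^ 2.

Lemma Cmod_minus (a b : C) : Cmod (a - b)%C = sqrt (dist2 a b).
Proof. reflexivity. Qed.

Lemma dist2_sym a b : dist2 a b = dist2 b a.
Proof. unfold dist2. ring. Qed.

(** As a function of one position the potential is a sum of two Kepler potentials and a constant, so
    this serves for each of the three bodies. *)
Lemma grad_two_centers (F : C -> R) (p p1 p2 : C) (k1 k2 c0 : R) :
  (forall x, F x = k1 * / sqrt (dist2 x p1) + k2 * / sqrt (dist2 x p2) + c0) ->
  0 < dist2 p p1 -> 0 < dist2 p p2 ->
  grad F p =
   (- (k1 * irho3 (dist2 p p1) * (fst p - fst p1) + k2 * irho3 (dist2 p p2) * (fst p - fst p2)),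
    - (k1 * irho3 (dist2 p p1) * (snd p - snd p1) + k2 * irho3 (dist2 p p2) * (snd p - snd p2))).
Proof.
intros HF H1 H2. destruct p as [px py]. unfold grad, Re, Im; cbn [fst snd].
assert (Dx : forall q, is_derive (fun x => dist2 (x, py) q) px (2 * (px - fst q))).
{ intros [qx qy]. unfold dist2; cbn [fst snd]. auto_derive; [exact I|ring]. }
assert (Dy : forall q, is_derive (fun y => dist2 (px, y) q) py (2 * (py - snd q))).
{ intros [qx qy]. unfold dist2; cbn [fst snd]. auto_derive; [exact I|ring]. }
assert (Hsum : forall (f1 f2 : R -> R) t d1 d2 G, (forall x, G x = k1 * / sqrt (f1 x) + k2 * / sqrt (f2 x) + c0) ->
   0 < f1 t -> 0 < f2 t -> is_derive f1 t (2 * d1) -> is_derive f2 t (2 * d2) ->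
   Derive G t = - (k1 * irho3 (f1 t) * d1 + k2 * irho3 (f2 t) * d2)).
{ intros f1 f2 t d1 d2 G HG P1 P2 D1 D2. apply is_derive_unique.
  apply (is_derive_ext (fun x => k1 * / sqrt (f1 x) + k2 * / sqrt (f2 x) + c0)); [intros; symmetry; apply HG|].
  pose proof (is_derive_inv_sqrt f1 t _ P1 D1) as I1.
  pose proof (is_derive_inv_sqrt f2 t _ P2 D2) as I2.
  set (i1 := fun s => / sqrt (f1 s)). set (i2 := fun s => / sqrt (f2 s)).
  set (r1 := irho3 (f1 t)) in *. set (r2 := irho3 (f2 t)) in *.
  change (is_derive i1 t (- (1 / 2 * (r1 * (2 * d1))))) in I1.
  change (is_derive i2 t (- (1 / 2 * (r2 * (2 * d2))))) in I2.
  change (is_derive (fun x => k1 * i1 x + k2 * i2 x + c0) t (- (k1 * r1 * d1 + k2 * r2 * d2))).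
  clearbody i1 i2 r1 r2. clear D1 D2. derivative. field. }
f_equal.
- apply (Hsum (fun x => dist2 (x, py) p1) (fun x => dist2 (x, py) p2)); auto; apply Dx.
- apply (Hsum (fun y => dist2 (px, y) p1) (fun y => dist2 (px, y) p2)); auto; apply Dy.
Qed.

Lemma irho3_square a : 0 < a -> irho3 (a ^ 2) = / a ^ 3.
Proof.
intros Ha. unfold irho3. replace (a ^ 2) with (a * a) by ring. rewrite sqrt_square by lra.
f_equal. ring.
Qed.

(** Since [placed] is linear in its last two arguments, accelerations are placed as well, and
    Newton's equations for three bodies reduce to the scalar equations for [X] and [Y]. *)
Lemma placed_force m a b : 0 < m -> 0 < a ->
  let q := placed m a b in
  let r3 := irho3 (b ^ 2 + a ^ 2 / 4) in
  forall i, (isosceles_masses m i *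
     placed m (- (2 / a ^ 2 + m * a * r3)) (- ((2 + m) * b * r3)) i)%C =
  grad (fun x => potential (isosceles_masses m) (upd q i x)) (q i).
Proof.
intros Hm Ha q r3.
assert (Ha2 : 0 < a ^ 2) by (apply pow_lt, Ha).
assert (Hr : 0 < b ^ 2 + a ^ 2 / 4) by (pose proof (pow2_ge_0 b); lra).
assert (E12 : dist2 (q B1) (q B2) = a ^ 2).
{ unfold dist2, q; cbn [placed fst snd]. field. lra. }
assert (E13 : dist2 (q B1) (q B3) = b ^ 2 + a ^ 2 / 4).
{ unfold dist2, q; cbn [placed fst snd]. field. lra. }
assert (E23 : dist2 (q B2) (q B3) = b ^ 2 + a ^ 2 / 4).
{ unfold dist2, q; cbn [placed fst snd]. field. lra. }
intros i; destruct i.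
- rewrite (grad_two_centers _ (q B1) (q B2) (q B3) 1 m
     (m * / sqrt (dist2 (q B2) (q B3)))).
  + rewrite E12, E13. rewrite (irho3_square a Ha). fold r3.
    unfold q; apply injective_projections; cbn; field; lra.
  + intros x. unfold potential, dist.
    change (upd q B1 x B1) with x. change (upd q B1 x B2) with (q B2).
    change (upd q B1 x B3) with (q B3). cbn [isosceles_masses].
    rewrite !Cmod_minus. rewrite (dist2_sym (q B2) x), (dist2_sym (q B3) x), (dist2_sym (q B3)).
    unfold Rdiv. rewrite !Rmult_1_l. reflexivity.
  + rewrite E12. exact Ha2.
  + rewrite E13. exact Hr.
- rewrite (grad_two_centers _ (q B2) (q B1) (q B3) 1 m
     (m * / sqrt (dist2 (q B1) (q B3)))).
  + rewrite (dist2_sym (q B2) (q B1)), E12, E23. rewrite (irho3_square a Ha). fold r3.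
    unfold q; apply injective_projections; cbn; field; lra.
  + intros x. unfold potential, dist.
    change (upd q B2 x B1) with (q B1). change (upd q B2 x B2) with x.
    change (upd q B2 x B3) with (q B3). cbn [isosceles_masses].
    rewrite !Cmod_minus. rewrite (dist2_sym (q B3) x), (dist2_sym (q B3)).
    unfold Rdiv. rewrite !Rmult_1_l. ring.
  + rewrite dist2_sym, E12. exact Ha2.
  + rewrite E23. exact Hr.
- rewrite (grad_two_centers _ (q B3) (q B1) (q B2) m m
     (1 * / sqrt (dist2 (q B1) (q B2)))).
  + rewrite (dist2_sym (q B3) (q B1)), (dist2_sym (q B3) (q B2)), E13, E23. fold r3.
    unfold q; apply injective_projections; cbn; field; lra.
  + intros x. unfold potential, dist.
    change (upd q B3 x B1) with (q B1). change (upd q B3 x B2) with (q B2).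
    change (upd q B3 x B3) with x. cbn [isosceles_masses].
    rewrite !Cmod_minus. rewrite (dist2_sym (q B2)).
    unfold Rdiv. rewrite !Rmult_1_l. ring.
  + rewrite dist2_sym, E13. exact Hr.
  + rewrite dist2_sym, E23. exact Hr.
Qed.

(** * The Levi-Civita Hamiltonian near isosceles states *)

Definition lc_plus (a b e f : R) : R := (e + (a ^ 2 - b ^ 2) / 2) ^ 2 + (f + a * b) ^ 2.
Definition lc_minus (a b e f : R) : R := (e - (a ^ 2 - b ^ 2) / 2) ^ 2 + (f - a * b) ^ 2.

(** With [z = a + b i] and [x = e + f i], [lc_plus] and [lc_minus] are the squared distances of body
    3 from bodies 1 and 2. All eight real coordinates are kept because the gradients also
    differentiate in directions that leave the isosceles states. *)
Lemma lc_hamiltonian_isosceles m h a b c d e f k l : 0 < m ->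
  lc_hamiltonian (isosceles_masses m) h (a, b) (c, d) (e, f) (k, l) =
  (c ^ 2 + d ^ 2) / 4 - 1 + (a ^ 2 + b ^ 2) *
    ((k ^ 2 + l ^ 2) / (2 * mu m) - h - m * / sqrt (lc_plus a b e f)
      - m * / sqrt (lc_minus a b e f)).
Proof.
intros Hm. unfold lc_hamiltonian, mu1, mu2, mu. rewrite !Cmod_sqr. cbn [isosceles_masses fst snd].
assert (Hp : Cmod ((e, f) + RtoC (1 / (1 + 1)) * ((a, b) * (a, b)))%C = sqrt (lc_plus a b e f)).
{ unfold Cmod, lc_plus; cbn. f_equal. field. }
assert (Hn : Cmod ((e, f) - RtoC (1 / (1 + 1)) * ((a, b) * (a, b)))%C = sqrt (lc_minus a b e f)).
{ unfold Cmod, lc_minus; cbn. f_equal. field. }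
rewrite Hp, Hn. unfold Rdiv.
set (i := / sqrt (lc_plus a b e f)). set (j := / sqrt (lc_minus a b e f)). clearbody i j.
field. lra.
Qed.

Lemma lc_derive m (A P M : R -> R) (t dA dP dM k0 k1 : R) :
  0 < P t -> 0 < M t -> is_derive A t dA -> is_derive P t dP -> is_derive M t dM ->
  is_derive (fun s => k0 + A s * (k1 - m * / sqrt (P s) - m * / sqrt (M s))) t
   (dA * (k1 - m * / sqrt (P t) - m * / sqrt (M t))
    + A t * (m / 2 * (irho3 (P t) * dP) + m / 2 * (irho3 (M t) * dM))).
Proof.
intros HP HM DA DP DM.
pose proof (is_derive_inv_sqrt P t _ HP DP) as IP.
pose proof (is_derive_inv_sqrt M t _ HM DM) as IM.
set (i := fun s => / sqrt (P s)). set (j := fun s => / sqrt (M s)).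
set (r := irho3 (P t)) in *. set (r' := irho3 (M t)) in *.
change (is_derive i t (- (1 / 2 * (r * dP)))) in IP.
change (is_derive j t (- (1 / 2 * (r' * dM)))) in IM.
change (is_derive (fun s => k0 + A s * (k1 - m * i s - m * j s)) t
   (dA * (k1 - m * i t - m * j t) + A t * (m / 2 * (r * dP) + m / 2 * (r' * dM)))).
clearbody i j r r'. clear DP DM. derivative. field.
Qed.

Section LeviCivita.

Variables (m h z w Y p : R).
Hypothesis Hm : 0 < m.
Hypothesis Hr : 0 < Y ^ 2 + z ^ 4 / 4.

Let r2 := Y ^ 2 + z ^ 4 / 4.
Let H := lc_hamiltonian (isosceles_masses m) h.

Lemma lc_plus_value : lc_plus z 0 0 Y = r2.
Proof. unfold lc_plus, r2. field. Qed.
Lemma lc_minus_value : lc_minus z 0 0 Y = r2.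
Proof. unfold lc_minus, r2. field. Qed.

(** The common shape of the partial derivatives in [z] and [x]: only the factor [A] and the two
    squared distances vary, and at an isosceles state both distances equal [r2]. *)
Lemma lc_derive_value (F A P M : R -> R) (t dA dP dM k0 k1 v : R) :
  (forall s, F s = k0 + A s * (k1 - m * / sqrt (P s) - m * / sqrt (M s))) ->
  P t = r2 -> M t = r2 -> is_derive A t dA -> is_derive P t dP -> is_derive M t dM ->
  v = dA * (k1 - 2 * m * / sqrt r2) + A t * (m / 2 * irho3 r2 * (dP + dM)) ->
  Derive F t = v.
Proof.
intros HF HP HM DA DP DM ->. apply is_derive_unique.
apply (is_derive_ext (fun s => k0 + A s * (k1 - m * / sqrt (P s) - m * / sqrt (M s)))).
{ intros; symmetry; apply HF. }
pose proof (lc_derive m A P M t dA dP dM k0 k1) as D. rewrite HP, HM in D.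
specialize (D Hr Hr DA DP DM).
replace (dA * (k1 - 2 * m * / sqrt r2) + A t * (m / 2 * irho3 r2 * (dP + dM))) with
 (dA * (k1 - m * / sqrt r2 - m * / sqrt r2) + A t * (m / 2 * (irho3 r2 * dP) + m / 2 * (irho3 r2 * dM)))
 by ring.
exact D.
Qed.

Lemma lc_value : H (z, 0) (w, 0) (0, Y) (0, p) =
  w ^ 2 / 4 - 1 + z ^ 2 * (p ^ 2 / (2 * mu m) - h - 2 * m * / sqrt r2).
Proof.
unfold H. rewrite lc_hamiltonian_isosceles, lc_plus_value, lc_minus_value by exact Hm.
unfold Rdiv. ring.
Qed.

Lemma lc_grad_w : grad (fun b => H (z, 0) b (0, Y) (0, p)) (w, 0) = (w / 2, 0).
Proof.
unfold grad, H, Re, Im; cbn [fst snd]. f_equal; apply is_derive_unique;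
  (eapply is_derive_ext; [intros s; symmetry; apply lc_hamiltonian_isosceles, Hm|]);
  set (K := (z ^ 2 + 0 ^ 2) * _); (auto_derive; [exact I|field]).
Qed.

Lemma lc_grad_p : grad (fun b => H (z, 0) (w, 0) (0, Y) b) (0, p) = (0, z ^ 2 * (p / mu m)).
Proof.
assert (Hmu : 0 < mu m) by (unfold mu; apply Rdiv_lt_0_compat; lra).
unfold grad, H, Re, Im; cbn [fst snd]. f_equal; apply is_derive_unique;
  (eapply is_derive_ext; [intros s; symmetry; apply lc_hamiltonian_isosceles, Hm|]);
  rewrite lc_plus_value, lc_minus_value; set (i := / sqrt r2); clearbody i;
  generalize dependent (mu m); intros M HM; (auto_derive; [lra|field; lra]).
Qed.

Lemma lc_grad_x : grad (fun a => H (z, 0) (w, 0) a (0, p)) (0, Y) =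
  (0, 2 * m * z ^ 2 * Y * irho3 r2).
Proof.
unfold grad, H, Re, Im; cbn [fst snd]. f_equal.
- apply (lc_derive_value _ (fun _ => z ^ 2 + 0 ^ 2) (fun s => lc_plus z 0 s Y) (fun s => lc_minus z 0 s Y)
    0 0 (z ^ 2) (- z ^ 2) ((w ^ 2 + 0 ^ 2) / 4 - 1) ((0 ^ 2 + p ^ 2) / (2 * mu m) - h)).
  + intros s. apply lc_hamiltonian_isosceles, Hm.
  + apply lc_plus_value.
  + apply lc_minus_value.
  + exact (is_derive_const (V := R_NormedModule) (z ^ 2 + 0 ^ 2) 0).
  + unfold lc_plus. auto_derive; [exact I|field].
  + unfold lc_minus. auto_derive; [exact I|field].
  + ring.
- apply (lc_derive_value _ (fun _ => z ^ 2 + 0 ^ 2) (fun s => lc_plus z 0 0 s) (fun s => lc_minus z 0 0 s)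
    Y 0 (2 * Y) (2 * Y) ((w ^ 2 + 0 ^ 2) / 4 - 1) ((0 ^ 2 + p ^ 2) / (2 * mu m) - h)).
  + intros s. apply lc_hamiltonian_isosceles, Hm.
  + apply lc_plus_value.
  + apply lc_minus_value.
  + exact (is_derive_const (V := R_NormedModule) (z ^ 2 + 0 ^ 2) Y).
  + unfold lc_plus. auto_derive; [exact I|field].
  + unfold lc_minus. auto_derive; [exact I|field].
  + rewrite Rmult_0_l. field.
Qed.

Lemma lc_grad_z : grad (fun a => H a (w, 0) (0, Y) (0, p)) (z, 0) =
  (2 * z * (p ^ 2 / (2 * mu m) - h - 2 * m * / sqrt r2) + m * z ^ 5 * irho3 r2, 0).
Proof.
unfold grad, H, Re, Im; cbn [fst snd]. f_equal.
- apply (lc_derive_value _ (fun s => s ^ 2 + 0 ^ 2) (fun s => lc_plus s 0 0 Y) (fun s => lc_minus s 0 0 Y)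
    z (2 * z) (z ^ 3) (z ^ 3) ((w ^ 2 + 0 ^ 2) / 4 - 1) ((0 ^ 2 + p ^ 2) / (2 * mu m) - h)).
  + intros s. apply lc_hamiltonian_isosceles, Hm.
  + apply lc_plus_value.
  + apply lc_minus_value.
  + auto_derive; [exact I|ring].
  + unfold lc_plus. auto_derive; [exact I|field].
  + unfold lc_minus. auto_derive; [exact I|field].
  + replace (0 ^ 2 + p ^ 2) with (p ^ 2) by ring.
    set (k := p ^ 2 / (2 * mu m)). set (i := / sqrt r2). clearbody k i. field.
(* Transversally to the isosceles states the two distances change oppositely, and their
   contributions cancel. *)
- apply (lc_derive_value _ (fun s => z ^ 2 + s ^ 2) (fun s => lc_plus z s 0 Y) (fun s => lc_minus z s 0 Y)
    0 0 (2 * Y * z) (- (2 * Y * z)) ((w ^ 2 + 0 ^ 2) / 4 - 1) ((0 ^ 2 + p ^ 2) / (2 * mu m) - h)).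
  + intros s. apply lc_hamiltonian_isosceles, Hm.
  + apply lc_plus_value.
  + apply lc_minus_value.
  + auto_derive; [exact I|ring].
  + unfold lc_plus. auto_derive; [exact I|field].
  + unfold lc_minus. auto_derive; [exact I|field].
  + ring.
Qed.

End LeviCivita.

(** * The periodic brake orbit in physical time *)

Section Orbit.

Variables (m th S : R) (u : R -> vec R).
Hypothesis Hm : 9 / 10 <= m <= 11 / 10.
Hypothesis Hth : 65 / 64 <= th <= 3 / 2.
Hypothesis HS : 0 < S.
Hypothesis H0 : u 0 = brake_state th.
Hypothesis Hfol : forall T, follows_on m u T.
Hypothesis Hflow : forall t, 0 < rho2 (u t) /\
  forall c, is_derive (fun s => get c (u s)) t (get c (field m (u t))).
Hypothesis HwS : vw (u S) = 0.
Hypothesis HYS : vY (u S) = 0.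
Hypothesis Hw : forall t, 0 < t < S -> vw (u t) < 0.
Hypothesis HY : forall t, 0 < t < S -> 0 < vY (u t).
Hypothesis Hrev : forall t, u (- t) = reverse (u t).
Hypothesis Hper : forall t, u (t + 4 * S) = u t.

Let z t := vz (u t).
Let w t := vw (u t).
Let Y t := vY (u t).
Let V t := vV (u t).
Let E t := vE (u t).
Let g t := irho3 (rho2 (u t)).

Lemma orbit_z_derive t : is_derive z t (w t / 2).
Proof. apply (proj2 (Hflow t) Cz). Qed.
Lemma orbit_w_derive t : is_derive w t (2 * z t * E t - m * z t ^ 5 * g t).
Proof. apply (proj2 (Hflow t) Cw). Qed.
Lemma orbit_Y_derive t : is_derive Y t (z t ^ 2 * V t).
Proof. apply (proj2 (Hflow t) CY). Qed.
Lemma orbit_V_derive t : is_derive V t (- ((2 + m) * z t ^ 2 * Y t * g t)).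
Proof. apply (proj2 (Hflow t) CV). Qed.

Lemma orbit_level t : w t ^ 2 / 4 = 1 + z t ^ 2 * E t.
Proof.
assert (Hp : forall t, 0 <= t -> w t ^ 2 / 4 = 1 + z t ^ 2 * E t).
{ intros r Hr. apply (level_zero m th r u (Hfol r) H0). lra. }
destruct (Rle_lt_dec 0 t); [apply Hp; assumption|].
pose proof (Hp (- t) ltac:(lra)) as H. unfold z, w, E in *. rewrite Hrev in H.
cbn [reverse vz vw vE] in H. rewrite <- H. field.
Qed.

Definition total_energy : R := -1 - 2 * m * / sqrt (th ^ 2 + 1 / 4).

Lemma orbit_energy t : E t + mu m * V t ^ 2 / 2 - 2 * m * / sqrt (rho2 (u t)) = total_energy.
Proof.
assert (Hp : forall t, 0 <= t -> energy m (u t) = total_energy).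
{ intros r Hr. apply (energy_constant m th r u Hm Hth (Hfol r) H0). lra. }
change (energy m (u t) = total_energy).
destruct (Rle_lt_dec 0 t); [apply Hp; assumption|].
rewrite <- (Hp (- t)) by lra. rewrite Hrev. unfold energy, rho2, reverse; cbn [vz vY vV vE].
replace ((- vV (u t)) ^ 2) with (vV (u t) ^ 2) by ring. reflexivity.
Qed.

Definition tau (s : R) : R := RInt (fun r => z r ^ 2) 0 s.

Lemma tau_derive s : is_derive tau s (z s ^ 2).
Proof.
apply (is_derive_primitive (fun r => z r ^ 2)). intros r.
apply (ex_derive_continuous (fun r => z r ^ 2)).
pose proof (orbit_z_derive r) as Dz. clear - Dz. clearbody z w.
auto_derive. repeat split. eexists; exact Dz.
Qed.

Lemma tau_0 : tau 0 = 0.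
Proof. exact (RInt_point (V := R_CompleteNormedModule) 0 _). Qed.

(** The derivative [z^2] vanishes only at isolated instants, because [w <> 0] wherever [z = 0]. A
    short stretch to the right of the midpoint on which [z <> 0] is enough. *)
Lemma tau_incr a b : a < b -> tau a < tau b.
Proof.
intros Hab.
assert (Hle : forall x y, x <= y -> tau x <= tau y).
{ intros x y Hxy. apply (derive_le tau (fun s => z s ^ 2)); [exact Hxy| |].
  - intros; apply tau_derive.
  - intros; apply pow2_ge_0. }
assert (Hc : exists c d, a <= c /\ c < d /\ d <= b /\ forall s, c < s < d -> 0 < z s ^ 2).
{ set (c := (a + b) / 2).
  destruct (Req_dec (z c) 0) as [Hz|Hz].
  - pose proof (orbit_level c) as HL. rewrite Hz in HL.
    assert (Hwc : w c <> 0) by (intros Hwc; rewrite Hwc in HL; lra).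
    assert (He : exists e, 0 < e /\ forall s, c < s < c + e -> 0 < z s ^ 2).
    { destruct (Rtotal_order (w c) 0) as [Hneg|[|Hpos]]; [|contradiction|].
      - destruct (derive_pos_right (fun s => - z s) c (- (w c / 2))) as [e [He H]]; [|lra|lra|].
        + apply (is_derive_opp (V := R_NormedModule) z), orbit_z_derive.
        + exists e. split; [exact He|]. intros s Hs. specialize (H s Hs). nra.
      - destruct (derive_pos_right z c (w c / 2) (orbit_z_derive c)) as [e [He H]]; [lra|lra|].
        exists e. split; [exact He|]. intros s Hs. specialize (H s Hs). nra. }
    destruct He as [e [He H]]. exists c, (Rmin (c + e) b).
    pose proof (Rmin_l (c + e) b). pose proof (Rmin_r (c + e) b).
    assert (c < b) by (unfold c; lra).
    split; [unfold c; lra|]. split; [apply Rmin_glb_lt; lra|]. split; [lra|].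
    intros s Hs. apply H. lra.
  - destruct (is_derive_near z c _ (Rabs (z c)) (orbit_z_derive c)) as [e [He H]];
      [apply Rabs_pos_lt, Hz|].
    exists c, (Rmin (c + e) b).
    pose proof (Rmin_l (c + e) b). pose proof (Rmin_r (c + e) b).
    assert (c < b) by (unfold c; lra).
    split; [unfold c; lra|]. split; [apply Rmin_glb_lt; lra|]. split; [lra|].
    intros s Hs. assert (Hs' : Rabs (s - c) < e) by (apply Rabs_def1; lra).
    specialize (H s Hs'). apply pow2_gt_0. intros Hzs. rewrite Hzs in H.
    rewrite Rminus_0_l, Rabs_Ropp in H. lra. }
destruct Hc as [c [d [Hac [Hcd [Hdb Hz]]]]].
apply Rle_lt_trans with (tau c); [apply Hle, Hac|].
apply Rlt_le_trans with (tau d); [|apply Hle, Hdb].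
apply (derive_lt tau (fun s => z s ^ 2)); [exact Hcd| |exact Hz].
intros; apply tau_derive.
Qed.

Lemma tau_inj a b : tau a = tau b -> a = b.
Proof.
intros H. destruct (Rtotal_order a b) as [Hab|[Hab|Hab]]; [|exact Hab|].
- pose proof (tau_incr a b Hab). lra.
- pose proof (tau_incr b a Hab). lra.
Qed.

Definition period : R := tau (4 * S).

Lemma period_pos : 0 < period.
Proof. rewrite <- tau_0. apply tau_incr. lra. Qed.

Lemma tau_period s : tau (s + 4 * S) = tau s + period.
Proof.
assert (Hd : forall r, is_derive (fun r => tau (r + 4 * S) - tau r) r 0).
{ intros r. pose proof (tau_derive r) as D1. pose proof (tau_derive (r + 4 * S)) as D2.
  assert (Hz : z (r + 4 * S) = z r) by (unfold z; rewrite Hper; reflexivity).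
  rewrite Hz in D2. set (a := z r ^ 2) in *.
  assert (D3 : is_derive (fun r => tau (r + 4 * S)) r (1 * a)).
  { apply (is_derive_comp (V := R_NormedModule) tau (fun r => r + 4 * S)); [exact D2|].
    auto_derive; [exact I|ring]. }
  replace 0 with (1 * a - a) by ring.
  apply (is_derive_minus (V := R_NormedModule) (fun r => tau (r + 4 * S)) tau); assumption. }
assert (H : tau (s + 4 * S) - tau s = tau (0 + 4 * S) - tau 0).
{ destruct (Rle_lt_dec 0 s) as [Hs|Hs].
  - apply (derive_const (fun r => tau (r + 4 * S) - tau r) (fun _ => 0) 0 s Hs); auto.
  - symmetry. apply (derive_const (fun r => tau (r + 4 * S) - tau r) (fun _ => 0) s 0); auto. lra. }
rewrite tau_0, Rplus_0_l in H. unfold period. lra.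
Qed.

Lemma tau_period_n n s : tau (s + 4 * S * INR n) = tau s + period * INR n.
Proof.
induction n as [|n IH]; [simpl; rewrite !Rmult_0_r, !Rplus_0_r; reflexivity|].
rewrite S_INR. replace (s + 4 * S * (INR n + 1)) with (s + 4 * S * INR n + 4 * S) by ring.
rewrite tau_period, IH. ring.
Qed.

(** A sigma type, because [sigma] is to be a function; for the same reason the number of periods is
    computed with [up] and not taken from an existential statement. *)
Lemma tau_surjective t : {s | tau s = t}.
Proof.
set (n := Z.to_nat (Rdefinitions.up (Rabs t / period))).
pose proof period_pos as Hp.
assert (Hn : Rabs t <= period * INR n).
{ destruct (archimed (Rabs t / period)) as [H _].
  assert (Hq : 0 <= Rabs t / period).
  { apply Rmult_le_pos; [apply Rabs_pos|left; apply Rinv_0_lt_compat, Hp]. }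
  assert (Hz : (0 <= Rdefinitions.up (Rabs t / period))%Z) by (apply le_IZR; lra).
  unfold n. rewrite INR_IZR_INZ, Z2Nat.id by exact Hz.
  replace (Rabs t) with (period * (Rabs t / period)) at 1 by (field; lra).
  apply Rmult_le_compat_l; lra. }
destruct (f_interv_is_interv tau (- (4 * S * INR n) - 1) (4 * S * INR n + 1) t) as [s [_ Hs]].
- pose proof (pos_INR n). nra.
- apply Rabs_le_between in Hn.
  assert (H1 : tau (- (4 * S * INR n)) = - (period * INR n)).
  { pose proof (tau_period_n n (- (4 * S * INR n))) as H. rewrite Rplus_opp_l, tau_0 in H. lra. }
  assert (H2 : tau (4 * S * INR n) = period * INR n).
  { rewrite <- (Rplus_0_l (4 * S * INR n)), tau_period_n, tau_0. ring. }
  pose proof (tau_incr (- (4 * S * INR n) - 1) (- (4 * S * INR n)) ltac:(lra)).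
  pose proof (tau_incr (4 * S * INR n) (4 * S * INR n + 1) ltac:(lra)). lra.
- intros x _. apply continuity_pt_filterlim. apply (ex_derive_continuous tau x).
  eexists. apply tau_derive.
- exists s. exact Hs.
Qed.

Definition sigma (t : R) : R := proj1_sig (tau_surjective t).

Lemma tau_sigma t : tau (sigma t) = t.
Proof. exact (proj2_sig (tau_surjective t)). Qed.

Lemma sigma_tau s : sigma (tau s) = s.
Proof. apply tau_inj, tau_sigma. Qed.

Lemma sigma_period t : sigma (t + period) = sigma t + 4 * S.
Proof. apply tau_inj. rewrite tau_sigma, tau_period, tau_sigma. reflexivity. Qed.

Lemma sigma_derive t : z (sigma t) <> 0 -> is_derive sigma t (/ z (sigma t) ^ 2).
Proof.
intros Hz. apply (inverse_derive tau sigma).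
- exact tau_incr.
- exact tau_sigma.
- apply tau_derive.
- apply pow2_gt_0, Hz.
Qed.

Lemma along_sigma (f : R -> R) (t df : R) : z (sigma t) <> 0 -> is_derive f (sigma t) df ->
  is_derive (fun r => f (sigma r)) t (df / z (sigma t) ^ 2).
Proof.
intros Hz Hf. unfold Rdiv. rewrite Rmult_comm.
apply (is_derive_comp (V := R_NormedModule) f sigma); [exact Hf|apply sigma_derive, Hz].
Qed.

Lemma sigma_near t : z (sigma t) <> 0 -> locally t (fun r => z (sigma r) <> 0).
Proof.
intros Hz.
pose proof (along_sigma z t _ Hz (orbit_z_derive (sigma t))) as Hd.
destruct (is_derive_near _ t _ (Rabs (z (sigma t))) Hd) as [d [Hd0 H]]; [apply Rabs_pos_lt, Hz|].
exists (mkposreal d Hd0). intros r Hr. specialize (H r Hr). intros Hzr.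
rewrite Hzr, Rminus_0_l, Rabs_Ropp in H. lra.
Qed.

Lemma orbit_w_over_z_derive s : z s <> 0 ->
  is_derive (fun r => w r / z r) s (- (2 / z s ^ 2 + m * z s ^ 4 * g s)).
Proof.
intros Hz. pose proof (orbit_z_derive s) as Dz. pose proof (orbit_w_derive s) as Dw.
pose proof (orbit_level s) as HL. clearbody z w E g.
derivative; [exact Hz|].
assert (Hw2 : w s * w s = 4 + 4 * (z s ^ 2 * E s)) by nra.
field_simplify; [|exact Hz|exact Hz].
replace (w s ^ 2) with (4 + 4 * (z s ^ 2 * E s)) by (rewrite <- Hw2; ring).
field. exact Hz.
Qed.

Definition motion (t : R) : config := placed m (z (sigma t) ^ 2) (Y (sigma t)).
(** [w / z] is dX/dt. At a collision it is only the default value of a division by 0, and the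
    correctness lemmas assume [z <> 0]. *)
Definition motion_velocity (t : R) : config := placed m (w (sigma t) / z (sigma t)) (V (sigma t)).
Definition motion_acceleration (t : R) : config :=
  placed m (- (2 / z (sigma t) ^ 4 + m * z (sigma t) ^ 2 * g (sigma t)))
         (- ((2 + m) * Y (sigma t) * g (sigma t))).

Lemma motion_velocity_correct t : z (sigma t) <> 0 -> velocity motion t (motion_velocity t).
Proof.
intros Hz. apply (placed_derive m (fun r => z (sigma r) ^ 2) (fun r => Y (sigma r))).
- replace (w (sigma t) / z (sigma t)) with (z (sigma t) * w (sigma t) / z (sigma t) ^ 2) by (field; exact Hz).
  apply (along_sigma (fun s => z s ^ 2)); [exact Hz|].
  pose proof (orbit_z_derive (sigma t)) as Dz. clear - Dz. clearbody z w.
  set (s := sigma t) in *. clearbody s. derivative. field.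
- replace (V (sigma t)) with (z (sigma t) ^ 2 * V (sigma t) / z (sigma t) ^ 2) by (field; exact Hz).
  apply (along_sigma Y); [exact Hz|apply orbit_Y_derive].
Qed.

Lemma motion_acceleration_correct t : z (sigma t) <> 0 ->
  velocity motion_velocity t (motion_acceleration t).
Proof.
intros Hz. apply (placed_derive m (fun r => w (sigma r) / z (sigma r)) (fun r => V (sigma r))).
- replace (- (2 / z (sigma t) ^ 4 + m * z (sigma t) ^ 2 * g (sigma t))) with
    (- (2 / z (sigma t) ^ 2 + m * z (sigma t) ^ 4 * g (sigma t)) / z (sigma t) ^ 2) by (field; exact Hz).
  apply (along_sigma (fun s => w s / z s)); [exact Hz|]. apply orbit_w_over_z_derive, Hz.
- replace (- ((2 + m) * Y (sigma t) * g (sigma t))) with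
    (- ((2 + m) * z (sigma t) ^ 2 * Y (sigma t) * g (sigma t)) / z (sigma t) ^ 2) by (field; exact Hz).
  apply (along_sigma V); [exact Hz|apply orbit_V_derive].
Qed.

Lemma motion_dist12 t : dist (motion t) B1 B2 = z (sigma t) ^ 2.
Proof.
unfold dist. rewrite Cmod_minus. unfold dist2, motion; cbn [placed fst snd].
apply eq_trans with (sqrt (z (sigma t) ^ 2 * z (sigma t) ^ 2)); [|apply sqrt_square, pow2_ge_0].
f_equal. field. lra.
Qed.

Lemma motion_dist13 t : dist (motion t) B1 B3 = sqrt (rho2 (u (sigma t))).
Proof.
unfold dist. rewrite Cmod_minus. unfold rho2. fold (z (sigma t)) (Y (sigma t)).
f_equal. unfold dist2, motion; cbn [placed fst snd]. field. lra.
Qed.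

Lemma motion_dist23 t : dist (motion t) B2 B3 = sqrt (rho2 (u (sigma t))).
Proof.
unfold dist. rewrite Cmod_minus. unfold rho2. fold (z (sigma t)) (Y (sigma t)).
f_equal. unfold dist2, motion; cbn [placed fst snd]. field. lra.
Qed.

Lemma sqrt_rho2_pos t : 0 < sqrt (rho2 (u t)).
Proof. apply sqrt_lt_R0, Hflow. Qed.

Lemma motion_newton t : z (sigma t) <> 0 -> newton_at (isosceles_masses m) motion t.
Proof.
intros Hz. exists motion_velocity. split.
- apply (filter_imp (fun r => z (sigma r) <> 0)); [|apply sigma_near, Hz].
  exact motion_velocity_correct.
- exists (motion_acceleration t). split; [apply motion_acceleration_correct, Hz|].
  intros i.
  assert (Hz2 : 0 < z (sigma t) ^ 2) by (apply pow2_gt_0, Hz).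
  pose proof (placed_force m (z (sigma t) ^ 2) (Y (sigma t)) ltac:(lra) Hz2 i) as H.
  replace (irho3 (Y (sigma t) ^ 2 + (z (sigma t) ^ 2) ^ 2 / 4)) with (g (sigma t)) in H
    by (unfold g, rho2; f_equal; unfold z, Y; field).
  replace ((z (sigma t) ^ 2) ^ 2) with (z (sigma t) ^ 4) in H by ring.
  exact H.
Qed.

(** Isosceles states have real [z] and [w] and imaginary [x] and [p]. With [p = mu m * V],
    conservation of energy identifies the bracket of the Hamiltonian with [- E], and Hamilton's
    equations become [field]. *)
Lemma orbit_lc : lc_orbit (isosceles_masses m) total_energy tau
  (fun s => (z s, 0)) (fun s => (w s, 0)) (fun s => (0, Y s)) (fun s => (0, mu m * V s)).
Proof.
assert (Hmu : 0 < mu m) by (unfold mu; apply Rdiv_lt_0_compat; lra).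
assert (Hr : forall s, 0 < Y s ^ 2 + z s ^ 4 / 4) by (intros s; apply (proj1 (Hflow s))).
assert (HE : forall s, (mu m * V s) ^ 2 / (2 * mu m) - total_energy
   - 2 * m * / sqrt (Y s ^ 2 + z s ^ 4 / 4) = - E s).
{ intros s. pose proof (orbit_energy s) as H.
  change (rho2 (u s)) with (Y s ^ 2 + z s ^ 4 / 4) in H.
  replace ((mu m * V s) ^ 2 / (2 * mu m)) with (mu m * V s ^ 2 / 2) by (field; lra). lra. }
assert (Hc : forall s, is_derive (fun _ : R => 0) s 0).
{ intros s. exact (is_derive_const (V := R_NormedModule) 0 s). }
split.
- intros s. rewrite lc_value by (try lra; apply Hr). rewrite HE, (orbit_level s). ring.
- intros s. rewrite Cmod_sqr; cbn [fst snd]. replace (z s ^ 2 + 0 ^ 2) with (z s ^ 2) by ring.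
  apply tau_derive.
- intros s. rewrite lc_grad_w by lra. apply is_deriveC_pair; [apply orbit_z_derive|apply Hc].
- intros s. rewrite lc_grad_z by (try lra; apply Hr). rewrite HE.
  replace (Copp (2 * z s * - E s + m * z s ^ 5 * irho3 (Y s ^ 2 + z s ^ 4 / 4), 0))
    with (2 * z s * E s - m * z s ^ 5 * g s, 0).
  + apply is_deriveC_pair; [apply orbit_w_derive|apply Hc].
  + change (irho3 (Y s ^ 2 + z s ^ 4 / 4)) with (g s).
    apply injective_projections; cbn; ring.
- intros s. rewrite lc_grad_p by lra.
  replace (mu m * V s / mu m) with (V s) by (field; lra).
  apply is_deriveC_pair; [apply Hc|apply orbit_Y_derive].
- intros s. rewrite lc_grad_x by (try lra; apply Hr).
  replace (Copp (0, 2 * m * z s ^ 2 * Y s * irho3 (Y s ^ 2 + z s ^ 4 / 4)))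
    with (0, mu m * - ((2 + m) * z s ^ 2 * Y s * g s)).
  + apply is_deriveC_pair; [apply Hc|]. apply (is_derive_scal V), orbit_V_derive.
  + change (irho3 (Y s ^ 2 + z s ^ 4 / 4)) with (g s). unfold mu.
    apply injective_projections; cbn; field; lra.
Qed.

Lemma motion_regularized : regularized_solution (isosceles_masses m) motion.
Proof.
split.
- intros t. unfold centered, motion; cbn [placed isosceles_masses].
  apply injective_projections; cbn; field; lra.
- intros t. rewrite motion_dist13. apply Rgt_not_eq, sqrt_rho2_pos.
- intros t. rewrite motion_dist23. apply Rgt_not_eq, sqrt_rho2_pos.
- intros t Ht. apply motion_newton. intros Hz. apply Ht. rewrite motion_dist12, Hz. ring.
- exists total_energy, tau, (fun s => (z s, 0)), (fun s => (w s, 0)), (fun s => (0, Y s)),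
    (fun s => (0, mu m * V s)).
  split; [exact orbit_lc|]. split.
  + intros t. exists (sigma t). apply tau_sigma.
  + intros s. unfold motion. rewrite sigma_tau. split.
    * unfold xi1; cbn [placed]. apply injective_projections; cbn; field; lra.
    * unfold xi2; cbn [placed isosceles_masses]. apply injective_projections; cbn; field; lra.
Qed.

Lemma motion_isosceles : isosceles motion.
Proof.
exists Ci. split.
- unfold Cmod, Ci; cbn. replace (0 * (0 * 1) + 1 * (1 * 1)) with 1 by ring. apply sqrt_1.
- intros t. unfold motion, Im; cbn [placed]. split.
  + cbn. ring.
  + apply injective_projections; cbn; field; lra.
Qed.

Lemma motion_periodic : periodic motion.
Proof.
exists period. split; [exact period_pos|]. intros t i. unfold motion.
rewrite sigma_period. unfold z, Y. rewrite Hper. reflexivity.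
Qed.

Lemma sigma_0 : sigma 0 = 0.
Proof. apply tau_inj. rewrite tau_sigma, tau_0. reflexivity. Qed.

Lemma motion_brake : brake_instant motion 0.
Proof.
assert (Hz0 : z 0 = 1 /\ w 0 = 0 /\ V 0 = 0).
{ unfold z, w, V. rewrite H0. cbn. repeat split; reflexivity. }
destruct Hz0 as [Hz0 [Hw0 HV0]].
intros i. assert (Hz : z (sigma 0) <> 0) by (rewrite sigma_0, Hz0; lra).
replace (RtoC 0) with (motion_velocity 0 i); [apply motion_velocity_correct, Hz|].
unfold motion_velocity. rewrite sigma_0, Hw0, HV0.
destruct i; cbn [placed]; apply injective_projections; cbn; unfold Rdiv; ring.
Qed.

Lemma motion_collinear s : collinear (motion (tau s)) <-> z s = 0 \/ Y s = 0.
Proof.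
unfold collinear, motion. rewrite sigma_tau. unfold Im; cbn [placed].
match goal with |- (snd ?c = 0 <-> _) => assert (Hc : snd c = - (z s ^ 2 * Y s)) end.
{ cbn. field. lra. }
rewrite Hc. split.
- intros H. assert (Hp : z s ^ 2 * Y s = 0) by lra.
  apply Rmult_integral in Hp. destruct Hp as [Hp|Hp]; [left|right; exact Hp].
  apply NNPP. intros Hz. pose proof (pow2_gt_0 _ Hz). lra.
- intros [H|H]; rewrite H; ring.
Qed.

Lemma first_collision : exists s1, 0 < s1 < S /\ z s1 = 0.
Proof.
assert (HzS : z S < 0).
{ apply (before_turning m th S u Hm (Hfol S) H0 Hw); [lra|exact HwS]. }
apply (collision_time m th S u (Hfol S) H0 S); [lra|exact HzS].
Qed.

(** Collinearity means [z = 0] or [Y = 0]. Up to [S] the strictly decreasing [z] has exactly one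
    zero, and [Y] is positive before [S]. *)
Lemma motion_hits : exists t1, first_two_hits motion 0 t1 (tau S).
Proof.
destruct first_collision as [s1 [Hs1 Hz1]].
exists (tau s1). split.
- split; [rewrite <- tau_0|]; apply tau_incr; lra.
- intros t Ht. rewrite <- (tau_sigma t) at 1. rewrite motion_collinear.
  assert (Hs : 0 < sigma t <= S).
  { assert (Ht' : tau 0 < tau (sigma t) <= tau S) by (rewrite tau_0, tau_sigma; exact Ht).
    split.
    - apply Rnot_le_lt. intros Hle. destruct (Req_dec (sigma t) 0) as [He|Hne].
      + rewrite He in Ht'. lra.
      + pose proof (tau_incr (sigma t) 0 ltac:(lra)). lra.
    - apply Rnot_lt_le. intros Hlt. pose proof (tau_incr _ _ Hlt). lra. }
  split.
  + intros [Hz|HYt].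
    * left. rewrite <- (tau_sigma t). f_equal.
      destruct (Rtotal_order (sigma t) s1) as [Hlt|[He|Hlt]]; [|exact He|].
      -- pose proof (z_strict m S u (Hfol S) Hw (sigma t) s1 ltac:(lra) ltac:(lra)) as H.
         change (z s1 < z (sigma t)) in H. lra.
      -- pose proof (z_strict m S u (Hfol S) Hw s1 (sigma t) ltac:(lra) ltac:(lra)) as H.
         change (z (sigma t) < z s1) in H. lra.
    * right. rewrite <- (tau_sigma t). f_equal.
      apply NNPP. intros Hne. pose proof (HY (sigma t) ltac:(lra)) as H.
      change (0 < Y (sigma t)) in H. lra.
  + intros [He|He]; rewrite He, sigma_tau; [left; exact Hz1|right; exact HYS].
Qed.

(** At this hit dX/dt = 0 and [xi2 = 0], so the size is stationary and the velocity of [xi2] is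
    perpendicular to the line of the bodies, whereas a tangent vector of [C] moves [xi2] along that
    line. Reversing the tangent part therefore changes the sign of [size_dot] and preserves the
    shape term, and the polarized form vanishes. *)
Lemma motion_orthogonal : hits_C_orthogonally (isosceles_masses m) motion (tau S).
Proof.
assert (HzS : z S < 0).
{ apply (before_turning m th S u Hm (Hfol S) H0 Hw); [lra|exact HwS]. }
assert (HYS' : Y S = 0) by exact HYS.
assert (HwS' : w S = 0) by exact HwS.
assert (HX : 0 < z S ^ 2) by (apply pow2_gt_0; lra).
assert (Hsym : forall i j, dist (motion (tau S)) i j = dist (motion (tau S)) j i).
{ intros i j. unfold dist. rewrite !Cmod_minus, dist2_sym. reflexivity. }
split; [apply motion_collinear; right; exact HYS|]. split.
{ assert (H12 : dist (motion (tau S)) B1 B2 <> 0).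
  { rewrite motion_dist12, sigma_tau. lra. }
  assert (H13 : dist (motion (tau S)) B1 B3 <> 0).
  { rewrite motion_dist13. apply Rgt_not_eq, sqrt_rho2_pos. }
  assert (H23 : dist (motion (tau S)) B2 B3 <> 0).
  { rewrite motion_dist23. apply Rgt_not_eq, sqrt_rho2_pos. }
  intros i j Hij; destruct i, j; try (exfalso; apply Hij; reflexivity); try assumption;
    rewrite Hsym; assumption. }
exists (motion_velocity (tau S)). split.
{ apply motion_velocity_correct. rewrite sigma_tau. lra. }
intros v [c [Hc0 [Hcol Hv]]].
unfold motion, motion_velocity in *. rewrite sigma_tau in *. rewrite HYS', HwS' in *.
set (X := z S ^ 2) in *.
replace (0 / z S) with 0 by (field; lra).
set (q := placed m X 0) in *.
set (a1 := fun s => fst (c s B1)). set (b1 := fun s => snd (c s B1)).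
set (a2 := fun s => fst (c s B2)). set (b2 := fun s => snd (c s B2)).
set (a3 := fun s => fst (c s B3)). set (b3 := fun s => snd (c s B3)).
assert (D1 : is_derive a1 0 (fst (v B1))) by exact (is_deriveC_fst _ _ _ (Hv B1)).
assert (D1' : is_derive b1 0 (snd (v B1))) by exact (is_deriveC_snd _ _ _ (Hv B1)).
assert (D2 : is_derive a2 0 (fst (v B2))) by exact (is_deriveC_fst _ _ _ (Hv B2)).
assert (D2' : is_derive b2 0 (snd (v B2))) by exact (is_deriveC_snd _ _ _ (Hv B2)).
assert (D3 : is_derive a3 0 (fst (v B3))) by exact (is_deriveC_fst _ _ _ (Hv B3)).
assert (D3' : is_derive b3 0 (snd (v B3))) by exact (is_deriveC_snd _ _ _ (Hv B3)).
(* The collinearity condition along the curve [c]; its derivative at 0 is the linear equation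
   satisfied by tangent vectors. *)
set (G := fun s => - (a2 s - a1 s) * (b3 s - b1 s) + (b2 s - b1 s) * (a3 s - a1 s)).
assert (HG : forall s, G s = 0).
{ intros s. rewrite <- (Hcol s). unfold collinear, Im, G. cbn. unfold a1, a2, a3, b1, b2, b3. ring. }
assert (DG : is_derive G 0 0).
{ apply (is_derive_ext (fun _ => 0)); [intros; symmetry; apply HG|].
  exact (is_derive_const (V := R_NormedModule) 0 0). }
assert (V1 : a1 0 = - X / 2 /\ b1 0 = 0 /\ a2 0 = X / 2 /\ b2 0 = 0 /\ a3 0 = 0 /\ b3 0 = 0).
{ unfold a1, b1, a2, b2, a3, b3. rewrite !Hc0. unfold q; cbn [placed fst snd]. repeat split; ring. }
destruct V1 as [Ea1 [Eb1 [Ea2 [Eb2 [Ea3 Eb3]]]]].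
assert (Htan : snd (v B3) - snd (v B1) = (snd (v B2) - snd (v B1)) / 2).
{ assert (DG' : is_derive G 0 (- X * (snd (v B3) - snd (v B1))
      + (snd (v B2) - snd (v B1)) * (X / 2))).
  { unfold G. clearbody a1 a2 a3 b1 b2 b3. clear DG HG G. derivative.
    rewrite Ea1, Eb1, Ea2, Eb2, Ea3, Eb3. field. }
  apply is_derive_unique in DG. apply is_derive_unique in DG'. rewrite DG in DG'.
  apply Rmult_eq_reg_l with X; lra. }
clear D1 D1' D2 D2' D3 D3' DG HG.
set (p := placed m 0 (V S)).
assert (Hy3 : snd (v B3) = (snd (v B1) + snd (v B2)) / 2) by lra.
assert (Hsize : size_dot (isosceles_masses m) q (fun i => p i + v i)%C =
  - size_dot (isosceles_masses m) q (fun i => p i - v i)%C).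
{ unfold size_dot, Rdiv. rewrite Ropp_mult_distr_l. f_equal.
  unfold xi1, xi2, q, p, Re; cbn. field. lra. }
assert (Hshape : Cmod (xi1 q * xi2 (isosceles_masses m) (fun i => p i + v i)
    - xi2 (isosceles_masses m) q * xi1 (fun i => p i + v i))%C ^ 2 =
  Cmod (xi1 q * xi2 (isosceles_masses m) (fun i => p i - v i)
    - xi2 (isosceles_masses m) q * xi1 (fun i => p i - v i))%C ^ 2).
{ rewrite !Cmod_sqr. unfold xi1, xi2, q, p; cbn. rewrite Hy3. field. lra. }
unfold reduced_metric, twoK0. rewrite Hsize, Hshape. unfold Rdiv. ring.
Qed.

End Orbit.

Lemma mass_interval (m : R) : Rabs (m - 1) <= / 65536 -> mem m masses.
Proof.
intros H. apply Rabs_le_between in H.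
assert (Hs : (65536 * Z.shiftl 1 14)%Z = two30) by reflexivity.
apply (f_equal IZR) in Hs. rewrite mult_IZR in Hs. pose proof two30_pos.
unfold mem, masses; cbn [fst snd]. rewrite minus_IZR, plus_IZR. split; nra.
Qed.

Theorem theorem2 :
  exists M : R -> Prop,
    open M /\ M 1 /\
    forall m3 : R, M m3 ->
      0 < m3 /\
      exists q : R -> config,
        regularized_solution (isosceles_masses m3) q /\
        isosceles q /\
        periodic q /\
        exists t0 t1 t2 : R,
          brake_instant q t0 /\
          first_two_hits q t0 t1 t2 /\
          hits_C_orthogonally (isosceles_masses m3) q t2.
Proof.
(* The radius is that of the interval [masses], for which both shots are certified. *)
exists (fun m => Rabs (m - 1) < / 65536). split; [|split].
- intros m Hm. exists (mkposreal (/ 65536 - Rabs (m - 1)) ltac:(lra)).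
  intros m' Hm'. change (Rabs (m' - m) < / 65536 - Rabs (m - 1)) in Hm'.
  replace (m' - 1) with ((m' - m) + (m - 1)) by ring.
  apply Rle_lt_trans with (1 := Rabs_triang _ _). lra.
- rewrite Rminus_diag, Rabs_R0. lra.
- intros m Hm. pose proof (mass_interval m (Rlt_le _ _ Hm)) as Hmass.
  pose proof (mass_bounds m Hmass) as Hb. split; [lra|].
  destruct (symmetric_orbit m Hmass)
    as [th [S [u [Hth [HS [H0 [Hfol [Hflow [HwS [HYS [Hw [HY [Hrev Hper]]]]]]]]]]]]].
  exists (motion m th S u HS H0 Hfol Hflow Hrev Hper). split; [|split; [|split]].
  + exact (motion_regularized m th S u Hb Hth HS H0 Hfol Hflow Hrev Hper).
  + exact (motion_isosceles m th S u Hb HS H0 Hfol Hflow Hrev Hper).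
  + exact (motion_periodic m th S u HS H0 Hfol Hflow Hrev Hper).
  + destruct (motion_hits m th S u Hb HS H0 Hfol Hflow HwS HYS Hw HY Hrev Hper) as [t1 Ht1].
    exists 0, t1, (tau u S). split; [|split]; [|exact Ht1|].
    * exact (motion_brake m th S u HS H0 Hfol Hflow Hrev Hper).
    * exact (motion_orthogonal m th S u Hb HS H0 Hfol Hflow HwS HYS Hw Hrev Hper).
Qed.
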